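(* Let $0\le q\le p$ be integers, $\psi_h^0\in V_h^q$, and let $\{\alpha_k\}_{k\ge1}$ be a sequence of positive real numbers. Then for each $k\ge1$ there exists a unique solution $(\bm q_h^k,u_h^k,\hat u_h^k)\in\bm\Sigma_h^p\times V_h^p\times M_{h,0}^p$, $\psi_h^k\in V_h^q$ of $$\mathcal{A}_{\mathsf D}((\bm q_h^k,u_h^k,\hat u_h^k),(\bm r_h,v_h,\hat v_h))+\mathcal{A}_{\mathsf C}((u_h^k,\hat u_h^k),(v_h,\hat v_h))+\frac1{\alpha_k}(\psi_h^k-\psi_h^{k-1},v_h)=(f,v_h),$$ $$(u_h^k,w_h)-(\nabla\mathcal{R}^*(\psi_h^k),w_h)=0,$$ for all $(\bm r_h,v_h,\hat v_h)\in\bm\Sigma_h^p\times V_h^p\times M_{h,0}^p$ and all $w_h\in V_h^q$ (where, for $k\geq 2$, $\psi_h^{k-1}$ is the latent variable from the previous step).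
   Context: $\Omega\subset\mathbb{R}^n$ is a bounded Lipschitz domain with a conforming simplicial shape-regular mesh $\mathcal{T}_h$; $\Gamma_h$ is the set of facets (including boundary facets), $\partial\mathcal{T}_h$ the set of element boundaries $\partial T$ with outward unit normal $\bm n$; $(\cdot,\cdot)$ is the $L^2(\Omega)$ inner product, $(q,\varphi)_{\partial\mathcal{T}_h}=\sum_{T\in\mathcal{T}_h}\int_{\partial T}q\varphi\,\mathrm{d}s$; $\nabla_h$ is the elementwise gradient. Data: $\kappa\in L^\infty(\Omega)$ scalar, uniformly bounded below by a positive number; $\beta\in[L^\infty(\Omega)]^n$ with $\nabla\cdot\beta=0$ and continuous normal components across element interfaces; $f\in L^2(\Omega)$; obstacle $\phi\in H^1(\Omega)\cap C(\overline\Omega)$ with $\phi|_{\partial\Omega}\le0$. (The continuous problem is: find $u\in K=\{v\in H_0^1(\Omega):v\ge\phi\text{ a.e.}\}$ with $(\kappa\nabla u,\nabla(v-u))+(\beta\cdot\nabla u,v-u)\ge(f,v-u)$ for all $v\in K$.) Spaces ($\mathbb{P}_p$ = polynomials of degree at most $p$, $\mathrm{RT}_p(T)=[\mathbb{P}_p(T)]^n+\mathbf{x}\,\mathbb{P}_p(T)$): $\bm\Sigma_h^p=\{\mathbf{r}_h\in[L^2(\Omega)]^n:\mathbf{r}_h|_T\in\mathrm{RT}_p(T)\ \forall T\}$, $V_h^p=\{v_h\in L^2(\Omega):v_h|_T\in\mathbb{P}_p(T)\ \forall T\}$, $M_{h,0}^p=\{\mu\in L^2(\Gamma_h):\mu|_F\in\mathbb{P}_p(F)\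 \forall F\in\Gamma_h,\ \mu|_F=0\ \forall F\subset\partial\Omega\}$. Forms: $\mathcal{B}(\bm q_h,(v,\hat v))=(\bm q_h,\nabla_hv)-(v-\hat v,\bm q_h\cdot\bm n)_{\partial\mathcal{T}_h}$; $\mathcal{A}_{\mathsf D}((\bm q_h,u_h,\hat u_h),(\bm r_h,v_h,\hat v_h))=(\kappa^{-1}\bm q_h,\bm r_h)+\mathcal{B}(\bm r_h,(u_h,\hat u_h))-\mathcal{B}(\bm q_h,(v_h,\hat v_h))$; $\mathcal{A}_{\mathsf C}((u_h,\hat u_h),(v_h,\hat v_h))=-(\beta u_h,\nabla_hv_h)+(\beta\cdot\bm n\,u_h^{\mathrm{up}},v_h-\hat v_h)_{\partial\mathcal{T}_h}$, with $u_h^{\mathrm{up}}=\hat u_h$ where $\beta\cdot\bm n<0$ and $u_h^{\mathrm{up}}=u_h$ otherwise. Legendre function: $R:\Omega\times\mathbb{R}\to\mathbb{R}\cup\{+\infty\}$ is a Carathéodory function such that, for a.e. $x$, $R(x,\cdot)$ is a (closed convex) Legendre function (proper, strictly convex and differentiable on the nonempty interior of its domain, with singular gradient at the boundary of the domain) with $\operatorname{dom}R(x,\cdot)=[\phi(x),\infty)$, and supercoercive: $R(x,y)/|y|\to\infty$ as $|y|\to\infty$. $R^*(x,\cdot)$ is its convex conjugate, $\nabla\mathcal{R}^*(\psi)(x)=\partial_zR^*(x,\psi(x))$. Standing convention: $\nabla\mathcal{R}^*$ is well defined and continuous on $L^\infty(\Omega)$ and maps $L^\infty(\Omega)$ into $\{o\in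 L^2(\Omega):o\ge\phi\text{ a.e.}\}$. A typical choice is $R(x,y)=(y-\phi(x))\log(y-\phi(x))-(y-\phi(x))$, giving $\nabla\mathcal{R}^*(\psi)=\exp(\psi)+\phi$. *)

(* Defs.v *)
From HB Require Import structures.
From mathcomp Require Import all_boot all_order all_algebra.
From mathcomp Require Import all_classical all_reals all_analysis measurable_realfun.
From mathcomp Require mpoly.

Set Implicit Arguments.
Unset Strict Implicit.
Unset Printing Implicit Defensive.

Import Order.TTheory GRing.Theory Num.Theory numFieldNormedType.Exports.
Local Open Scope classical_set_scope.
Local Open Scope ring_scope.

(* Lebesgue measure on R^n = 'rV[R]_n.  The sigma-algebra is the product one,
   as for tuples in the library. *)
Definition measure_rV_display : measure_display.
Proof. exact: default_measure_display. Qed.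

Section measurable_rV.
Context {R : realType} (n : nat).

Let coord (i : 'I_n) (x : 'rV[R]_n) : measurableTypeR R := x ord0 i.

Let rV_set0 : g_sigma_preimage coord set0.
Proof. exact: sigma_algebra0. Qed.

Let rV_setC A : g_sigma_preimage coord A -> g_sigma_preimage coord (~` A).
Proof. exact: sigma_algebraC. Qed.

Let rV_bigcup (F : (set 'rV[R]_n)^nat) :
  (forall i, g_sigma_preimage coord (F i)) ->
  g_sigma_preimage coord (\bigcup_i (F i)).
Proof. exact: sigma_algebra_bigcup. Qed.

HB.instance Definition _ := @isMeasurable.Build measure_rV_display
  'rV[R]_n (g_sigma_preimage coord) rV_set0 rV_setC rV_bigcup.

End measurable_rV.

Definition rV_cons (R : realType) (n : nat)
  (z : measurableTypeR R * 'rV[R]_n) : 'rV[R]_n.+1 :=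
  \row_j (if unlift ord0 j is Some k then z.2 ord0 k else z.1).

Lemma measurable_coord (R : realType) n (i : 'I_n) :
  measurable_fun [set: 'rV[R]_n] (fun x => x ord0 i : measurableTypeR R).
Proof.
move=> _ Y mY; rewrite setTI; apply: sub_sigma_algebra => /=.
rewrite -bigcup_seq/=; exists i => /=; first by rewrite mem_index_enum.
by exists Y => //; rewrite setTI.
Qed.

Lemma measurable_fun_rV (R : realType) n d (T : measurableType d)
    (f : T -> 'rV[R]_n) :
  (forall i, measurable_fun setT (fun x => f x ord0 i : measurableTypeR R)) ->
  measurable_fun setT f.
Proof.
move=> mf.
apply: (@measurability _ _ _ _ _ _
  (\big[setU/set0]_(i < n) preimage_set_system setT
     (fun x : 'rV[R]_n => x ord0 i : measurableTypeR R) measurable)) => //.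
move=> A [B]; elim/big_ind: _ => //.
- by move=> P Q hP hQ [/hP|/hQ].
- move=> i _ [C mC <-] <-.
  by rewrite !setTI -comp_preimage -[X in measurable X]setTI; exact: mf.
Qed.

Lemma measurable_rV_cons (R : realType) n :
  measurable_fun setT (@rV_cons R n).
Proof.
apply: measurable_fun_rV => i.
case: (unliftP ord0 i) => [k|] ->.
  rewrite [X in measurable_fun _ X](_ : _ = (fun x : 'rV[R]_n =>
    x ord0 k : measurableTypeR R) \o snd); last first.
    by apply/funext => z /=; rewrite mxE liftK.
  by apply: measurableT_comp => //; exact: measurable_coord.
rewrite [X in measurable_fun _ X](_ : _ = fst)//.
by apply/funext => z; rewrite mxE unlift_none.
Qed.

Section rV_measure_cons.
Context {R : realType} (n : nat).
Variable mu : {sigma_finite_measure set 'rV[R]_n -> \bar R}.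

Definition rV_measure_cons : set 'rV[R]_n.+1 -> \bar R :=
  pushforward (@lebesgue_measure R \x mu)%E (@rV_cons R n).

Let preim_measurable A : measurable A -> measurable (@rV_cons R n @^-1` A).
Proof. by move=> mA; rewrite -[X in measurable X]setTI; exact: measurable_rV_cons. Qed.

Let mcons0 : rV_measure_cons set0 = 0%E.
Proof. by rewrite /rV_measure_cons /pushforward preimage_set0 measure0. Qed.

Let mcons_ge0 A : (0 <= rV_measure_cons A)%E.
Proof. by apply: integral_ge0 => x _; exact: measure_ge0. Qed.

Let mcons_sigma_additive : semi_sigma_additive rV_measure_cons.
Proof.
move=> F mF tF mUF; rewrite /rV_measure_cons /pushforward preimage_bigcup.
apply: measure_semi_sigma_additive => [k||].
- exact: preim_measurable.
- apply/trivIsetP => /= i j _ _ ij; rewrite -preimage_setI.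
  by move/trivIsetP : tF => /(_ _ _ _ _ ij) ->//; rewrite preimage_set0.
- by rewrite -preimage_bigcup; exact: preim_measurable.
Qed.

HB.instance Definition _ := isMeasure.Build _ _ _ rV_measure_cons
  mcons0 mcons_ge0 mcons_sigma_additive.

Let mcons_sigma_finite : sigma_finite setT rV_measure_cons.
Proof.
have /sigma_finiteP[F [TF ndF Foo]] := sigma_finiteT (@lebesgue_measure R).
have /sigma_finiteP[G [TG ndG Goo]] := sigma_finiteT mu.
pose hd (x : 'rV[R]_n.+1) : measurableTypeR R := x ord0 ord0.
pose tl (x : 'rV[R]_n.+1) : 'rV[R]_n := \row_k x ord0 (lift ord0 k).
have mhd : measurable_fun setT hd by exact: measurable_coord.
have mtl : measurable_fun setT tl.
  apply: measurable_fun_rV => k.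
  rewrite [X in measurable_fun _ X](_ : _ = fun x : 'rV[R]_n.+1 =>
    x ord0 (lift ord0 k) : measurableTypeR R); first exact: measurable_coord.
  by apply/funext => x; rewrite mxE.
have hd_cons z : hd (rV_cons z) = z.1 by rewrite /hd mxE unlift_none.
have tl_cons z : tl (rV_cons z) = z.2.
  by apply/rowP => k; rewrite !mxE liftK.
exists (fun k => hd @^-1` F k `&` tl @^-1` G k).
  apply/esym/seteqP; split=> // x _.
  have [i _ Fi] : (\bigcup_k F k) (hd x) by rewrite -TF.
  have [j _ Gj] : (\bigcup_k G k) (tl x) by rewrite -TG.
  exists (maxn i j) => //; split.
  - by have /subsetPset/(_ _ Fi) := ndF _ _ (leq_maxl i j).
  - by have /subsetPset/(_ _ Gj) := ndG _ _ (leq_maxr i j).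
move=> k; have [mF Fk] := Foo k; have [mG Gk] := Goo k; split.
  apply: measurableI.
  - by rewrite -[X in measurable X]setTI; exact: mhd.
  - by rewrite -[X in measurable X]setTI; exact: mtl.
rewrite /rV_measure_cons /pushforward.
rewrite (_ : _ @^-1` _ = F k `*` G k).
  by rewrite product_measure1E// lte_mul_pinfty// ge0_fin_numE.
by apply/seteqP; split => z /=; rewrite hd_cons tl_cons.
Qed.

HB.instance Definition _ := Measure_isSigmaFinite.Build _ _ _ rV_measure_cons
  mcons_sigma_finite.

End rV_measure_cons.

Fixpoint lebesgue_rV (R : realType) (n : nat) :
    {sigma_finite_measure set 'rV[R]_n -> \bar R} :=
  match n with
  | 0 => (\d_(0 : 'rV[R]_0))
  | n'.+1 => rV_measure_cons (lebesgue_rV R n')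
  end.

Lemma lebesgue_rV_box (R : realType) n (A : 'I_n -> set (measurableTypeR R)) :
  (forall i, measurable (A i)) ->
  lebesgue_rV R n [set x | forall i, A i (x ord0 i)] =
  (\prod_(i < n) lebesgue_measure (A i))%E.
Proof.
elim: n A => [|n IH] A mA.
  by rewrite big_ord0/= diracE mem_set//= => -[].
rewrite big_ord_recl/= /rV_measure_cons /pushforward.
rewrite (_ : _ @^-1` _ =
    A ord0 `*` [set x : 'rV[R]_n | forall i, A (lift ord0 i) (x ord0 i)]).
  rewrite product_measure1E//; first by congr (_ * _)%E; exact: IH.
  rewrite (_ : [set x | _] =
      \bigcap_i (fun x : 'rV[R]_n => x ord0 i) @^-1` A (lift ord0 i)).
    apply: fin_bigcap_measurable => // i _.
    by rewrite -[X in measurable X]setTI; exact: measurable_coord.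
  by apply/seteqP; split => x /= h i; [move=> _|]; exact: h.
apply/seteqP; split => [z /= h|z /= [h0 h] i].
- split; first by have := h ord0; rewrite mxE unlift_none.
  by move=> i; have := h (lift ord0 i); rewrite mxE liftK.
- by case: (unliftP ord0 i) => [k|] ->; rewrite mxE ?liftK ?unlift_none.
Qed.

Section Euclidean.
Context {R : realType} {n : nat}.

Definition dotv (u v : 'rV[R]_n) : R := \sum_i u ord0 i * v ord0 i.

Definition enorm (u : 'rV[R]_n) : R := Num.sqrt (dotv u u).

Definition boundary (D : set 'rV[R]_n) : set 'rV[R]_n := closure D `\` D°.

(* Functions are total; only their values on D matter. *)
Definition Lp (D : set 'rV[R]_n) (p : \bar R) (f : 'rV[R]_n -> R) : Prop :=
  f \_ D \in Lfun (lebesgue_rV R n) p.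

Definition Lp_norm (D : set 'rV[R]_n) (p : \bar R) (f : 'rV[R]_n -> R) : \bar R :=
  Lnorm (lebesgue_rV R n) p (EFin \o (f \_ D)).

End Euclidean.

Section Domain.
Context {R : realType} {m : nat}.
Local Notation n := m.+1.
Local Notation E := 'rV[R]_n.
Implicit Types (Omega : set E) (eta phi : E -> R) (beta : E -> E).

(* Near each boundary point, in some rotated coordinates y *m Q, the domain is
   the strict epigraph of a Lipschitz function of all but one coordinate. *)
Definition lipschitz_boundary Omega : Prop :=
  forall x, boundary Omega x ->
  exists (r : R) (Q : 'M[R]_n) (g : 'rV[R]_m -> R) (L : R),
    [/\ 0 < r, Q *m Q^T = 1%:M,
        forall y z, `|g y - g z| <= L * enorm (y - z) &
        forall y, enorm (y - x) < r ->
          (Omega y <-> g (col' ord0 (y *m Q)) < (y *m Q) ord0 ord0)].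

Definition bounded_lipschitz_domain Omega : Prop :=
  [/\ Omega !=set0, open Omega, connected Omega, bounded_set Omega &
      lipschitz_boundary Omega].

Definition partial (i : 'I_n) eta : E -> R :=
  fun x => 'D_(delta_mx ord0 i : E) eta x.

Definition grad eta : E -> E := fun x => \row_i partial i eta x.

Definition smooth eta : Prop :=
  forall s : seq 'I_n, let g := foldr partial eta s in
  continuous g /\ forall i x, derivable g x (delta_mx ord0 i : E).

Definition test_function Omega eta : Prop :=
  smooth eta /\
  exists2 K : set E, compact K /\ K `<=` Omega & forall x, ~ K x -> eta x = 0.

Definition H1 Omega phi : Prop :=
  Lp Omega 2%:E phi /\
  forall i, exists2 g : E -> R, Lp Omega 2%:E g &
    forall eta, test_function Omega eta ->
      \int[lebesgue_rV R n]_(x in Omega) (phi x * partial i eta x) =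
      - \int[lebesgue_rV R n]_(x in Omega) (g x * eta x).

Definition weakly_divergence_free Omega beta : Prop :=
  forall eta, test_function Omega eta ->
    \int[lebesgue_rV R n]_(x in Omega) dotv (beta x) (grad eta x) = 0.

End Domain.

(* The cells are given by their sets of vertices; facets are the faces with one
   vertex less. *)
Record mesh (R : realType) (n : nat) := Mesh {
  nverts : nat;
  vertex : 'I_nverts -> 'rV[R]_n;
  cells : {set {set 'I_nverts}} }.

Section Mesh.
Context {R : realType} {m : nat}.
Local Notation n := m.+1.
Local Notation E := 'rV[R]_n.
Variable M : mesh R n.
Local Notation V := 'I_(nverts M).
Implicit Types (S T F : {set V}).

Definition hull S : set E :=
  [set x | exists w : V -> R,
    [/\ forall i, 0 <= w i, \sum_(i in S) w i = 1 &
        x = \sum_(i in S) w i *: vertex i]].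

Definition affinely_independent S : Prop :=
  forall w : V -> R, \sum_(i in S) w i = 0 ->
    \sum_(i in S) w i *: vertex i = 0 -> forall i, i \in S -> w i = 0.

Definition is_facet F : bool :=
  (#|F| == n) && [exists T in cells M, F \subset T].

Definition cell := {T : {set V} | T \in cells M}.
Definition facet := {F : {set V} | is_facet F}.

Definition conforming_mesh (Omega : set E) : Prop :=
  [/\ forall T, T \in cells M -> #|T| = n.+1 /\ affinely_independent T,
      closure Omega = \bigcup_(T in [set` cells M]) hull T &
      forall T T', T \in cells M -> T' \in cells M ->
        hull T `&` hull T' = hull (T :&: T')].

(* Each cell contains a ball of radius at least diam / sigma. *)
Definition shape_regular (sigma : R) : Prop :=
  forall T, T \in cells M -> exists (c : E) (r : R),
    [/\ 0 < r, forall y, enorm (y - c) <= r -> hull T y &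
        forall y z, hull T y -> hull T z -> enorm (y - z) <= sigma * r].

Definition outward_unit_normal T F : E :=
  get [set nu : E | [/\ dotv nu nu = 1,
    forall i j, i \in F -> j \in F -> dotv nu (vertex j - vertex i) = 0 &
    forall i j, i \in F -> j \in T :\: F -> dotv nu (vertex j - vertex i) < 0]].

(* Surface integral over a facet with vertices a_0, ..., a_m, through the
   parametrization t |-> a_0 + sum_i t_i (a_i - a_0) of the facet by the
   reference simplex; sqrt (det (J J^T)) is its surface element. *)
Definition reference_simplex : set 'rV[R]_m :=
  [set t | (forall i, 0 <= t ord0 i) /\ \sum_i t ord0 i <= 1].

Definition facet_vertex F (i : nat) : E := nth 0 [seq vertex v | v <- enum F] i.

Definition facet_jacobian F : 'M[R]_(m, n) :=
  \matrix_(i < m) (facet_vertex F i.+1 - facet_vertex F 0).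

Definition facet_param F (t : 'rV[R]_m) : E :=
  facet_vertex F 0 + t *m facet_jacobian F.

Definition facet_int F (g : E -> R) : R :=
  Num.sqrt (\det (facet_jacobian F *m (facet_jacobian F)^T)) *
  \int[lebesgue_rV R m]_(t in reference_simplex) g (facet_param F t).

Definition Linfty_facet F (g : E -> R) : Prop :=
  Lp reference_simplex +oo%E (g \o facet_param F).

Definition ae_facet F (P : E -> Prop) : Prop :=
  {ae lebesgue_rV R m, forall t, reference_simplex t -> P (facet_param F t)}.

Definition skeleton_int (g : cell -> facet -> E -> R) : R :=
  \sum_(T : cell) \sum_(F : facet | val F \subset val T) facet_int (val F) (g T F).

(* [bn T F] is the trace of beta . n on the facet F of T, where n is the outward
   normal of T; beta is only L^infty, so the trace is the one defined by Green's
   formula (div beta = 0). *)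
Definition normal_trace (Omega : set E) (beta : E -> E)
    (bn : cell -> facet -> E -> R) : Prop :=
  forall T : cell,
    (forall F : facet, val F \subset val T -> Linfty_facet (val F) (bn T F)) /\
    forall eta : E -> R, smooth eta ->
      \int[lebesgue_rV R n]_(x in Omega `&` (hull (val T))°)
         dotv (beta x) (grad eta x) =
      \sum_(F : facet | val F \subset val T)
         facet_int (val F) (fun x => bn T F x * eta x).

Definition continuous_normal_components (bn : cell -> facet -> E -> R) : Prop :=
  forall (T T' : cell) (F : facet), T != T' ->
    val F \subset val T -> val F \subset val T' ->
    ae_facet (val F) (fun x => bn T F x = - bn T' F x).

End Mesh.

Section Legendre.
Context {R : realType}.
Implicit Types g : R -> \bar R.

Definition effdom g : set R := [set y | (g y < +oo)%E].

Definition proper g : Prop := (forall y, -oo < g y)%E /\ effdom g !=set0.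

Definition econvex g : Prop := forall y z t, 0 <= t <= 1 ->
  (g (t * y + (1 - t) * z)%R <= t%:E * g y + (1 - t)%:E * g z)%E.

Definition strictly_convex_on (D : set R) g : Prop :=
  forall y z t, D y -> D z -> y != z -> 0 < t < 1 ->
  (g (t * y + (1 - t) * z)%R < t%:E * g y + (1 - t)%:E * g z)%E.

Definition legendre g : Prop :=
  [/\ proper g, econvex g, lower_semicontinuous g, (effdom g)° !=set0 &
   [/\ strictly_convex_on (effdom g)° g,
       forall y, (effdom g)° y -> derivable (fine \o g) y 1 &
       forall b, (closure (effdom g) `\` (effdom g)°) b ->
         (fun y => `|derive1 (fine \o g) y|) @ within (effdom g)° (nbhs b) --> +oo]].

Definition supercoercive g : Prop :=
  (fun y => g y * (`|y|^-1)%:E)%E @ +oo --> +oo%E /\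
  (fun y => g y * (`|y|^-1)%:E)%E @ -oo --> +oo%E.

Definition fconj g (z : R) : \bar R :=
  ereal_sup [set ((z * y)%:E - g y)%E | y in [set: R]].

End Legendre.

Section LegendreFunction.
Context {R : realType} {m : nat}.
Local Notation n := m.+1.
Local Notation E := 'rV[R]_n.
Local Notation leb := (lebesgue_rV R n).
Variables (Omega : set E) (phi : E -> R) (Rf : E -> R -> \bar R).

(* Continuity in y is on the effective domain: Rf x jumps to +oo at phi x. *)
Definition caratheodory : Prop :=
  (forall y, measurable_fun Omega (fun x => Rf x y)) /\
  {ae leb, forall x, Omega x -> {within effdom (Rf x), continuous (Rf x)}}.

Definition legendre_function : Prop :=
  caratheodory /\
  {ae leb, forall x, Omega x ->
    [/\ legendre (Rf x), effdom (Rf x) = `[phi x, +oo[%classic & supercoercive (Rf x)]}.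

Definition gradRstar (psi : E -> R) : E -> R :=
  fun x => derive1 (fine \o fconj (Rf x)) (psi x).

Definition gradRstar_well_behaved : Prop :=
  [/\ forall psi, Lp Omega +oo%E psi ->
        {ae leb, forall x, Omega x ->
          (\forall z \near psi x, fconj (Rf x) z \is a fin_num) /\
          derivable (fine \o fconj (Rf x)) (psi x) 1},
      forall psi, Lp Omega +oo%E psi ->
        Lp Omega 2%:E (gradRstar psi) /\
        {ae leb, forall x, Omega x -> phi x <= gradRstar psi x} &
      forall psi, Lp Omega +oo%E psi -> forall e : R, 0 < e ->
        exists2 d : R, 0 < d & forall psi', Lp Omega +oo%E psi' ->
          (Lp_norm Omega +oo (psi' \- psi)%R < d%:E)%E ->
          (Lp_norm Omega 2%:E (gradRstar psi' \- gradRstar psi)%R < e%:E)%E].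

End LegendreFunction.

Section Discretization.
Context {R : realType} {m : nat}.
Local Notation n := m.+1.
Local Notation E := 'rV[R]_n.
Local Notation poly := (mpoly.mpoly n R).
Local Notation leb := (lebesgue_rV R n).
Variables (Omega : set E) (M : mesh R n).
Local Notation cell := (cell M).
Local Notation facet := (facet M).

Definition peval (P : poly) (x : E) : R := mpoly.meval (fun i => x ord0 i) P.

Definition deg_le (p : nat) (P : poly) : bool := all (fun mon => mpoly.mdeg mon <= p)%N (mpoly.msupp P).

(* A broken polynomial v in L^2(Omega) is given by the family of the polynomials
   v|_T.  As the cells are nondegenerate, v|_T determines the polynomial, so equality
   of families is equality in L^2(Omega). *)
Definition Vh (p : nat) (v : cell -> poly) : Prop := forall T, deg_le p (v T).

Definition Sigmah (p : nat) (q : cell -> 'I_n -> poly) : Prop :=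
  forall T, exists (a : 'I_n -> poly) (b : poly),
    [/\ forall i, deg_le p (a i), deg_le p b &
        forall i x, peval (q T i) x = peval (a i) x + x ord0 i * peval b x].

(* Elements of P_p(F) are restrictions to F of polynomials in n variables; two
   families represent the same function on the skeleton iff they agree on each F. *)
Definition Mh0 (p : nat) (mu : facet -> poly) : Prop :=
  (forall F, deg_le p (mu F)) /\
  forall F : facet, hull (val F) `<=` boundary Omega ->
    forall x, hull (val F) x -> peval (mu F) x = 0.

Definition fun_of (v : cell -> poly) : E -> R := fun x =>
  \sum_(T : cell) \1_((hull (val T))°) x * peval (v T) x.

Definition vec_of (q : cell -> 'I_n -> poly) : E -> E := fun x =>
  \row_i fun_of (fun T => q T i) x.

Definition gradh (v : cell -> poly) : cell -> 'I_n -> poly :=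
  fun T i => mpoly.mderiv i (v T).

Definition inner (f g : E -> R) : R := \int[leb]_(x in Omega) (f x * g x).

Definition innerv (f g : E -> E) : R := \int[leb]_(x in Omega) dotv (f x) (g x).

Definition formB (q : cell -> 'I_n -> poly) (v : cell -> poly)
    (vhat : facet -> poly) : R :=
  innerv (vec_of q) (vec_of (gradh v)) -
  skeleton_int (fun T F x => (peval (v T) x - peval (vhat F) x) *
    dotv (\row_i peval (q T i) x) (outward_unit_normal (val T) (val F))).

Definition formAD (kappa : E -> R)
    (q : cell -> 'I_n -> poly) (u : cell -> poly) (uhat : facet -> poly)
    (r : cell -> 'I_n -> poly) (v : cell -> poly) (vhat : facet -> poly) : R :=
  innerv (fun x => (kappa x)^-1 *: vec_of q x) (vec_of r) +
  formB r u uhat - formB q v vhat.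

Definition formAC (beta : E -> E) (bn : cell -> facet -> E -> R)
    (u : cell -> poly) (uhat : facet -> poly)
    (v : cell -> poly) (vhat : facet -> poly) : R :=
  - innerv (fun x => fun_of u x *: beta x) (vec_of (gradh v)) +
  skeleton_int (fun T F x =>
    bn T F x * (if bn T F x < 0 then peval (uhat F) x else peval (u T) x) *
    (peval (v T) x - peval (vhat F) x)).

Record state := State {
  flux : cell -> 'I_n -> poly;
  primal : cell -> poly;
  trace : facet -> poly;
  latent : cell -> poly }.

Definition same_state (s s' : state) : Prop :=
  [/\ flux s = flux s', primal s = primal s', latent s = latent s' &
      forall (F : facet) x, hull (val F) x ->
        peval (trace s F) x = peval (trace s' F) x].

Definition step_solution (p q : nat) (kappa : E -> R) (beta : E -> E)
    (bn : cell -> facet -> E -> R) (f : E -> R) (Rf : E -> R -> \bar R)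
    (alpha : R) (psi_prev : cell -> poly) (s : state) : Prop :=
  [/\ [/\ Sigmah p (flux s), Vh p (primal s), Mh0 p (trace s) & Vh q (latent s)],
      forall r v vhat, Sigmah p r -> Vh p v -> Mh0 p vhat ->
        formAD kappa (flux s) (primal s) (trace s) r v vhat +
        formAC beta bn (primal s) (trace s) v vhat +
        alpha^-1 * inner (fun_of (latent s) \- fun_of psi_prev) (fun_of v) =
        inner f (fun_of v) &
      forall w, Vh q w ->
        inner (fun_of (primal s)) (fun_of w) -
        inner (gradRstar Rf (fun_of (latent s))) (fun_of w) = 0].

End Discretization.

(* Main.v *)
(* Idea. Testing a step with its own solution leaves [(kappa^-1 q, q)] plus
   the upwind jump terms [1/2 |beta.n| (u - uh)^2], so the form [A_D + A_C] is
   positive semidefinite and a zero of its energy has vanishing flux. With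
   zero flux the first equation reads [B(r, (u, uh)) = 0] for all [r] in
   [RT_p], i.e. [(r, grad u) = (u - uh, r.n)]. Write [a_j] for the vertices of
   [T], [lambda_j] for its barycentric coordinates and [D_j = a_j . grad u].
   The field [r = \sum_j lambda_j D_j (a_j - x)] has zero normal component on
   every facet, and [(r, grad u)] is the variance of the [D_j] with weights
   [lambda_j], which gives [grad u = 0]; the fields [p (x - a_i)] see only the
   facet opposite to [a_i], which gives [u = uh] on each facet. As [u] is
   piecewise constant, single valued across facets and zero on the boundary,
   it vanishes: in a bounded domain, a nonempty family of cells closed under
   crossing facets reaches the boundary. The same argument for the adjoint
   shows that the finite-dimensional linear part can be eliminated, leaving an
   equation for [psi] in [V_h^q] whose operator is continuous and strongly
   monotone, because [grad R*] is monotone. Such an equation is solved by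
   induction on the dimension and the intermediate value theorem. Uniqueness
   is the same energy argument applied to the difference of two solutions. *)

(* The elimination of the linear part meets an obstacle: the pair [(a, b)] behind a Raviart-Thomas
   field [a + x b] and the polynomial behind a facet function are not unique, so the matrix [A] of
   [A_D + A_C] in coordinates is singular in general. What survives is that a vector in the right
   kernel of [A] has zero primal component. The coupling with [psi] and the load see only that
   component, so they lie in the row space of [A], and any preimages serve for the elimination. The
   strong monotonicity comes from the linear part alone: [grad R*] is merely monotone, and the
   constant is a minimum over the unit sphere of a form that is positive because zero energy forces
   [psi = 0]. This implication tests the first equation with [v = psi], which is where [q <= p]
   enters. The assumptions on [grad R*] concern bounded functions; they apply because discrete
   latent variables are bounded, and continuity from [L^infty] to [L^2], paired with bounded test
   functions, becomes continuity of a map between coordinate spaces. *)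
Require Import Defs.
From HB Require Import structures.
From mathcomp Require Import all_boot all_order all_algebra ring lra.
From mathcomp Require Import all_classical all_reals all_analysis measurable_realfun ess_sup_inf.
From mathcomp Require mpoly.
Import (canonicals,coercions) mpoly.
Import Order.TTheory GRing.Theory Num.Theory numFieldNormedType.Exports.
Local Open Scope classical_set_scope.
Local Open Scope ring_scope.
Set Implicit Arguments.
Unset Strict Implicit.
Unset Printing Implicit Defensive.

(** * Strongly monotone maps in finite dimension *)

Section DotProduct.
Context {R : realType}.

Section Dotv.
Variable n : nat.
Implicit Types u v w : 'rV[R]_n.

Lemma dotvC u v : dotv u v = dotv v u.
Proof. by apply: eq_bigr => i _; rewrite mulrC. Qed.

Lemma dotvDl u v w : dotv (u + v) w = dotv u w + dotv v w.
Proof. by rewrite /dotv -big_split; apply: eq_bigr => i _; rewrite mxE mulrDl. Qed.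

Lemma dotvZl (c : R) u v : dotv (c *: u) v = c * dotv u v.
Proof. by rewrite /dotv mulr_sumr; apply: eq_bigr => i _; rewrite mxE mulrA. Qed.

Lemma dotvDr u v w : dotv u (v + w) = dotv u v + dotv u w.
Proof. by rewrite dotvC dotvDl !(dotvC u). Qed.

Lemma dotvZr (c : R) u v : dotv u (c *: v) = c * dotv u v.
Proof. by rewrite dotvC dotvZl dotvC. Qed.

Lemma dotvNl u v : dotv (- u) v = - dotv u v.
Proof. by rewrite -scaleN1r dotvZl mulN1r. Qed.

Lemma dotvNr u v : dotv u (- v) = - dotv u v.
Proof. by rewrite dotvC dotvNl dotvC. Qed.

Lemma dotvBl u v w : dotv (u - v) w = dotv u w - dotv v w.
Proof. by rewrite dotvDl dotvNl. Qed.

Lemma dotvBr u v w : dotv u (v - w) = dotv u v - dotv u w.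
Proof. by rewrite dotvDr dotvNr. Qed.

Lemma dotv0l v : dotv 0 v = 0.
Proof. by rewrite -(scale0r 0) dotvZl mul0r. Qed.

Lemma dotv0r v : dotv v 0 = 0.
Proof. by rewrite dotvC dotv0l. Qed.

Lemma dotv_suml (I : finType) (P : pred I) (F : I -> 'rV[R]_n) v :
  dotv (\sum_(i | P i) F i) v = \sum_(i | P i) dotv (F i) v.
Proof.
by elim/big_rec2: _ => [|i a b _ <-]; rewrite ?dotv0l ?dotvDl.
Qed.

Lemma dotv_ge0 v : 0 <= dotv v v.
Proof. by apply: sumr_ge0 => i _; rewrite -expr2 sqr_ge0. Qed.

Lemma dotv_eq0 v : dotv v v = 0 -> v = 0.
Proof.
move=> /eqP; rewrite psumr_eq0; last by move=> i _; rewrite -expr2 sqr_ge0.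
move=> /allP h; apply/rowP => i; rewrite mxE.
by have /= := h i (mem_index_enum _); rewrite -expr2 sqrf_eq0 => /eqP.
Qed.

Lemma dotv_mx u v : dotv u v = (u *m v^T) ord0 ord0.
Proof. by rewrite mxE; apply: eq_bigr => i _; rewrite !mxE. Qed.

(* From [c |d|^2 + v.d <= 0] and [0 <= |c d + v|^2]. *)
Lemma dotv_sq_le (c : R) (d v : 'rV[R]_n) : 0 <= c ->
  c * dotv d d <= - dotv v d -> c ^+ 2 * dotv d d <= dotv v v.
Proof.
move=> c0 h; have := dotv_ge0 (c *: d + v).
rewrite dotvDl !dotvDr !dotvZl !dotvZr (dotvC d v) => h2.
have : c * (c * dotv d d) <= c * (- dotv v d) by rewrite ler_wpM2l.
rewrite expr2 => h3; lra.
Qed.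

(** Both distances are squared Euclidean ones, the quantity that monotonicity estimates control,
    whereas the norm of row vectors is the sup norm. *)
Definition dotv_continuous k (F : 'rV[R]_n -> 'rV[R]_k) :=
  forall x (e : R), 0 < e -> exists2 d : R, 0 < d &
    forall y, dotv (y - x) (y - x) < d -> dotv (F y - F x) (F y - F x) < e.

End Dotv.

Lemma dotv_row_mx n k (u v : 'rV[R]_n) (w z : 'rV[R]_k) :
  dotv (row_mx u w) (row_mx v z) = dotv u v + dotv w z.
Proof.
rewrite /dotv big_split_ord /=; congr (_ + _); apply: eq_bigr => i _.
  by rewrite !row_mxEl.
by rewrite !row_mxEr.
Qed.

Lemma dotv_scalar (a b : R) : dotv (a%:M : 'rV_1) b%:M = a * b.
Proof. by rewrite /dotv big_ord1 !mxE !mulr1n. Qed.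

(* Freeze the first coordinate [t], solve the other equations by induction for
   [X t]; the remaining scalar equation is continuous and strongly increasing
   in [t]. *)
Lemma strongly_monotone_zero (c : R) : 0 < c ->
  forall n (F : 'rV[R]_n -> 'rV[R]_n), dotv_continuous F ->
  (forall x y, c * dotv (x - y) (x - y) <= dotv (F x - F y) (x - y)) ->
  exists x, F x = 0.
Proof.
move=> c0; elim=> [F _ _|n IH]; first by exists 0; apply/rowP => -[].
change (forall F : 'rV[R]_(1 + n) -> 'rV[R]_(1 + n), dotv_continuous F ->
  (forall x y, c * dotv (x - y) (x - y) <= dotv (F x - F y) (x - y)) ->
  exists x, F x = 0).
move=> F cF mF.
pose P t x : 'rV[R]_(1 + n) := row_mx (t%:M : 'rV_1) x.
have PB t s x y : P t x - P s y = P (t - s) (x - y).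
  by rewrite /P opp_row_mx add_row_mx raddfB.
have dP t x : dotv (P t x) (P t x) = t ^+ 2 + dotv x x.
  by rewrite dotv_row_mx dotv_scalar expr2.
pose rF t x := rsubmx (F (P t x)).
pose lF t x := (lsubmx (F (P t x))) ord0 ord0.
have FE t x : F (P t x) = P (lF t x) (rF t x).
  by rewrite /P /lF -mx11_scalar hsubmxK.
have sl t : exists x, rF t x = 0.
  apply: (IH (rF t)) => [x e e0|x y].
    have [d d0 hd] := cF (P t x) e e0; exists d => // y.
    have := hd (P t y); rewrite !FE !PB !dP subrr expr0n add0r => hy /hy.
    by apply: le_lt_trans; rewrite lerDr sqr_ge0.
  have := mF (P t x) (P t y); rewrite !FE !PB !dP dotv_row_mx dotv_scalar.
  by rewrite subrr expr0n mulr0 !add0r.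
have [X hX] := choice sl; pose h t := lF t (X t).
have hmono t s : c * (t - s) ^+ 2 <= (h t - h s) * (t - s).
  have := mF (P t (X t)) (P s (X s)).
  rewrite !FE !hX !PB !dP dotv_row_mx dotv_scalar subrr dotv0l addr0.
  by move=> /(le_trans _)->//; rewrite (ler_wpM2l (ltW c0))// lerDl dotv_ge0.
have hcont : continuous h.
  move=> s; apply/cvgrPdist_lt => e e0.
  (* Half of [d] is spent on [t - s], half on [X t - X s]. For the latter, strong monotonicity of
     the slice gives [c^2 |X t - X s|^2 <= |rF t (X s)|^2]; as [rF s (X s) = 0], continuity of [F]
     at the same point with tolerance [c^2 d / 2] suffices. *)
  have [d d0 hd] := cF (P s (X s)) (e ^+ 2) (exprn_gt0 _ e0).
  have d20 : 0 < c ^+ 2 * (d / 2) by rewrite mulr_gt0 ?divr_gt0 ?exprn_gt0.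
  have [d' d'0 hd'] := cF (P s (X s)) _ d20.
  pose r := Num.min (Num.min d' (d / 2)) 1.
  have r0 : 0 < r by rewrite !lt_min d'0 divr_gt0 ?ltr01.
  near=> t.
  have ts : `|s - t| < r.
    by near: t; apply: cvgr_dist_lt => //; exact: cvg_id.
  have ts2 : (t - s) ^+ 2 < r.
    rewrite -real_normK ?num_real// distrC expr2.
    have r1 : r <= 1 by rewrite /r ge_min lexx orbT.
    have := normr_ge0 (s - t).
    nra.
  move: ts2; rewrite !lt_min => /andP[/andP[t1 t2] _].
  have /dotv_sq_le : c * dotv (X t - X s) (X t - X s) <=
      - dotv (rF t (X s)) (X t - X s).
    have := mF (P t (X t)) (P t (X s)); rewrite !FE !PB !dP dotv_row_mx dotv_scalar.
    by rewrite subrr expr0n mulr0 !add0r hX sub0r dotvNl.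
  move=> /(_ (ltW c0)) hXX.
  have hr : dotv (rF t (X s)) (rF t (X s)) < c ^+ 2 * (d / 2).
    have := hd' (P t (X s)); rewrite !FE !PB !dP subrr dotv0l addr0 hX subr0.
    by move=> /(_ t1); apply: le_lt_trans; rewrite lerDr sqr_ge0.
  have hXd : dotv (X t - X s) (X t - X s) < d / 2.
    by rewrite -(ltr_pM2l (exprn_gt0 2 c0)); exact: le_lt_trans hXX hr.
  have := hd (P t (X t)); rewrite !FE !PB !dP !hX subrr dotv0l addr0 => hd2.
  rewrite distrC -(ltr_pXn2r (ltn0Sn 1)) ?nnegrE ?normr_ge0// ?ltW//.
  rewrite real_normK ?num_real//; apply: hd2; lra.
(* Strong monotonicity gives [h b - h 0 >= c b >= |h 0|], and symmetrically at [- b], so [h] changes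
   sign on [[-b, b]]. *)
pose b := `|h 0| / c + 1.
have b0 : 0 < b by rewrite ltr_wpDl ?divr_ge0 ?normr_ge0// ltW.
have cb : `|h 0| <= c * b by rewrite mulrDr mulrCA divff ?gt_eqF// mulr1 lerDl mulr1 ltW.
have hb : 0 <= h b.
  have := hmono b 0; rewrite subr0 expr2 mulrA ler_pM2r// => H.
  have := ler_norm (- h 0); rewrite normrN; lra.
have hNb : h (- b) <= 0.
  have := hmono 0 (- b); rewrite sub0r opprK expr2 mulrA ler_pM2r// => H.
  have := ler_norm (h 0); lra.
have [] := @IVT _ h (- b) b 0.
- lra.
- exact: continuous_subspaceT.
- by rewrite ge_min le_max hNb hb orbT.
by move=> t _ ht; exists (P t (X t)); rewrite FE hX -/(h t) ht /P !raddf0 row_mx0.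
Unshelve. all: by end_near.
Qed.
End DotProduct.

(** * Linear systems coupled with a monotone map *)

Section MixedSystem.
Context {R : realType}.

Lemma cvg_sumr (T : Type) (F : set_system T) (I : Type) (r : seq I) (P : pred I)
    (f : I -> T -> R) (a : I -> R) {FF : Filter F} :
  (forall i, P i -> f i x @[x --> F] --> a i) ->
  \sum_(i <- r | P i) f i x @[x --> F] --> \sum_(i <- r | P i) a i.
Proof. by move=> h; apply: cvg_big => //; exact: add_continuous. Qed.

Lemma continuous_coord n (i : 'I_n) : continuous (fun x : 'rV[R]_n => x ord0 i).
Proof. exact: coord_continuous. Qed.

Lemma continuous_sumr (T : topologicalType) (I : Type) (r : seq I) (P : pred I)
    (f : I -> T -> R) :
  (forall i, P i -> continuous (f i)) ->
  continuous (fun x => \sum_(i <- r | P i) f i x).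
Proof. by move=> h x; apply: cvg_sumr => i /h; exact. Qed.

Lemma continuous_dotv_mul n (Q : 'M[R]_n) :
  continuous (fun x : 'rV[R]_n => dotv (x *m Q) x).
Proof.
apply: continuous_sumr => i _.
have cQ : continuous (fun x : 'rV[R]_n => (x *m Q) ord0 i).
  rewrite (_ : (fun x => _) = fun x : 'rV[R]_n => \sum_j x ord0 j * Q j i); last first.
    by apply/funext => x; rewrite mxE.
  apply: continuous_sumr => j _ x.
  by apply: continuousM; [exact: continuous_coord|exact: cst_continuous].
by move=> x; apply: continuousM; [exact: cQ|exact: continuous_coord].
Qed.

Lemma rV_norm_le n (x : 'rV[R]_n) (r : R) : 0 <= r ->
  (`|x| <= r) = [forall i, `|x ord0 i| <= r].
Proof.
move=> r0; rewrite {1}/Num.norm/= mx_normrE; apply/idP/forallP => [h i|h].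
  by apply: le_trans h; apply: (@le_bigmax _ _ _ 0 (fun i => `|x i.1 i.2|) (ord0, i)).
by apply: bigmax_le => // -[i j] _ /=; rewrite (ord1 i).
Qed.

Lemma coord_dotv n (x : 'rV[R]_n) i : (x ord0 i) ^+ 2 <= dotv x x.
Proof.
rewrite /dotv (bigD1 i)//= -expr2 lerDl sumr_ge0// => j _.
by rewrite -expr2 sqr_ge0.
Qed.

Lemma dotv_mulmx n k (B : 'M[R]_(n, k)) (x : 'rV[R]_n) (y : 'rV[R]_k) :
  dotv (x *m B) y = dotv x (y *m B^T).
Proof. by rewrite !dotv_mx trmx_mul trmxK mulmxA. Qed.

Lemma dotv_CauchySchwarz n (x y : 'rV[R]_n) : dotv x y ^+ 2 <= dotv x x * dotv y y.
Proof.
have [->|y0] := eqVneq y 0; first by rewrite !dotv0r expr0n mulr0.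
have d0 : 0 < dotv y y.
  by rewrite lt_def dotv_ge0 andbT; apply: contra y0 => /eqP/dotv_eq0 ->.
(* This square equals [|y|^2 (|x|^2 |y|^2 - (x.y)^2)]. *)
have := dotv_ge0 (dotv y y *: x - dotv x y *: y).
rewrite dotvBl !dotvBr !dotvZl !dotvZr (dotvC y x) => h.
have : 0 <= dotv y y * (dotv x x * dotv y y - dotv x y ^+ 2).
  by rewrite expr2; nra.
by rewrite pmulr_rge0// subr_ge0.
Qed.

Lemma dotv_mulmx_le n k (Q : 'M[R]_(n, k)) : exists2 K : R, 0 <= K &
  forall x : 'rV[R]_n, dotv (x *m Q) (x *m Q) <= K * dotv x x.
Proof.
exists (\sum_j dotv (col j Q)^T (col j Q)^T) => [|x].
  by apply: sumr_ge0 => j _; exact: dotv_ge0.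
rewrite mulr_suml; apply: ler_sum => j _; rewrite -expr2 (mulrC (dotv _ _)).
have <- : dotv x (col j Q)^T = (x *m Q) ord0 j.
  by rewrite mxE; apply: eq_bigr => i _; rewrite !mxE.
exact: dotv_CauchySchwarz.
Qed.

Lemma dotv_continuousD_affine n k (G : 'rV[R]_n -> 'rV[R]_k) (Q : 'M[R]_(n, k)) b :
  dotv_continuous G -> dotv_continuous (fun x => G x + (x *m Q - b)).
Proof.
move=> cG x e e0; have e40 : 0 < e / 4 by rewrite divr_gt0.
have [d d0 hd] := cG x _ e40; have [K K0 hK] := dotv_mulmx_le Q.
exists (Num.min d (e / 4 / (K + 1))).
  by rewrite lt_min d0/= divr_gt0// ltr_wpDl.
move=> y; rewrite lt_min => /andP[/hd hG].
rewrite ltr_pdivlMr ?ltr_wpDl// => hy.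
have -> : G y + (y *m Q - b) - (G x + (x *m Q - b)) = G y - G x + (y - x) *m Q.
  by rewrite mulmxBl opprD addrACA opprB [in X in _ + X = _]addrA subrK.
set a := G y - G x in hG *; set c := (y - x) *m Q.
have hc : dotv c c < e / 4.
  apply: le_lt_trans (hK _) _; apply: le_lt_trans hy.
  by rewrite mulrC ler_wpM2l ?dotv_ge0// lerDl.
move: a c hG {hy} hc => a c hG hc.
have := dotv_ge0 (a - c); rewrite dotvBl !dotvBr dotvDl !dotvDr (dotvC c a).
lra.
Qed.

(** By homogeneity it is enough to bound the form on the unit sphere, where compactness provides a
    positive minimum. *)
Lemma posdef_bound n (Q : 'M[R]_n) :
  (forall x : 'rV[R]_n, x != 0 -> 0 < dotv (x *m Q) x) ->
  exists2 c : R, 0 < c & forall x : 'rV[R]_n, c * dotv x x <= dotv (x *m Q) x.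
Proof.
move=> Qpos.
pose S := [set x : 'rV[R]_n | dotv x x = 1].
have normS x : x != 0 -> S ((Num.sqrt (dotv x x))^-1 *: x).
  move=> x0; have d0 : 0 < dotv x x.
    by rewrite lt_def dotv_ge0 andbT; apply: contra x0 => /eqP/dotv_eq0 ->.
  rewrite /S/= dotvZl dotvZr mulrA -invfM -expr2 sqr_sqrtr ?dotv_ge0//.
  by rewrite mulVf// gt_eqF.
(* The sphere is empty only in dimension 0, where any constant works. *)
have [S0|S0] := pselect (S !=set0); last first.
  exists 1 => // x; have [->|/normS x0] := eqVneq x 0.
    by rewrite mul0mx !dotv0l mulr0.
  by case: S0; exists ((Num.sqrt (dotv x x))^-1 *: x).
have cS : compact S.
  apply: bounded_closed_compact.
    exists 1; split; first exact: num_real.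
    move=> r r1 x Sx /=; rewrite rV_norm_le ?(le_trans ler01) ?ltW//.
    apply/forallP => i; apply: le_trans (ltW r1).
    rewrite -(@ler_pXn2r _ 2) ?nnegrE// real_normK ?num_real// expr1n -Sx.
    exact: coord_dotv.
  rewrite (_ : S = (fun x : 'rV[R]_n => dotv (x *m 1%:M) x) @^-1` [set 1]).
    apply: closed_comp; last exact: closed_eq.
    by move=> x _; exact: continuous_dotv_mul.
  by apply/seteqP; split=> x /=; rewrite mulmx1.
have [|c Sc hc] := @EVT_min_rV R n (fun x => dotv (x *m Q) x) S S0 cS.
  by apply: continuous_subspaceT; exact: continuous_dotv_mul.
exists (dotv (c *m Q) c).
  apply: Qpos; apply/eqP => c0; move: Sc; rewrite inE c0 /S/= dotv0l => /eqP.
  by rewrite eq_sym oner_eq0.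
move=> x; have [->|x0] := eqVneq x 0; first by rewrite mul0mx !dotv0l mulr0.
have := normS _ x0; rewrite -inE => /hc.
rewrite -scalemxAl !(dotvZl, dotvZr) mulrA -invfM -expr2 sqr_sqrtr ?dotv_ge0//.
rewrite mulrC -ler_pdivlMr// lt_def dotv_ge0 andbT.
by apply: contra x0 => /eqP/dotv_eq0 ->.
Qed.

(* Eliminating [x] from the first equation leaves the strongly monotone
   equation [G psi + psi S C^T = s C^T], where [C = S A] and [l = s A]. *)
Lemma mixed_system_solvable N k (A : 'M[R]_N) (C : 'M[R]_(k, N)) (l : 'rV[R]_N)
    (G : 'rV[R]_k -> 'rV[R]_k) :
  (forall x, 0 <= dotv (x *m A) x) ->
  (forall y : 'cV[R]_N, A *m y = 0 -> C *m y = 0 /\ l *m y = 0) ->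
  (forall x psi, x *m A + psi *m C = 0 -> dotv (x *m A) x = 0 -> psi = 0) ->
  dotv_continuous G ->
  (forall psi psi', 0 <= dotv (G psi - G psi') (psi - psi')) ->
  exists x psi, x *m A + psi *m C = l /\ x *m C^T = G psi.
Proof.
move=> A0 kerA inj cG mG.
have coker0 j : A *m col j (cokermx A) = 0.
  by rewrite colE mulmxA mulmx_coker mul0mx.
have /submxP[S CE] : (C <= A)%MS.
  rewrite submxE; apply/eqP/matrixP => i j; rewrite [RHS]mxE.
  have [/matrixP/(_ i ord0) h _] := kerA _ (coker0 j).
  by move: h; rewrite colE mulmxA -colE !mxE.
have /submxP[s lE] : (l <= A)%MS.
  rewrite submxE; apply/eqP/matrixP => i j; rewrite [RHS]mxE.
  have [_ /matrixP/(_ i ord0) h] := kerA _ (coker0 j).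
  by move: h; rewrite colE mulmxA -colE !mxE.
have SCE psi : dotv (psi *m (S *m C^T)) psi = dotv (psi *m S *m A) (psi *m S).
  by rewrite mulmxA dotv_mulmx trmxK CE mulmxA dotvC.
have [c c0 hc] : exists2 c : R, 0 < c &
    forall psi : 'rV[R]_k, c * dotv psi psi <= dotv (psi *m (S *m C^T)) psi.
  apply: posdef_bound => psi psi0; rewrite SCE lt_def A0 andbT.
  apply: contra psi0 => /eqP a0; apply/eqP.
  apply: (inj (- (psi *m S))); first by rewrite mulNmx CE mulmxA addNr.
  by rewrite mulNmx dotvNl dotvNr opprK.
have [psi psiP] : exists psi, G psi + (psi *m (S *m C^T) - s *m C^T) = 0.
  apply: (strongly_monotone_zero c0) => [|x y].
    exact: dotv_continuousD_affine.
  have -> : forall Q : 'M[R]_k, G x + (x *m Q - s *m C^T) - (G y + (y *m Q - s *m C^T)) =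
      G x - G y + (x - y) *m Q.
    by move=> Q; rewrite mulmxBl opprD addrACA opprB [in X in _ + X = _]addrA subrK.
  rewrite dotvDl.
  by rewrite (le_trans (hc _))// lerDr.
exists (s - psi *m S), psi; split.
  by rewrite mulmxBl -lE CE mulmxA subrK.
by rewrite mulmxBl -mulmxA; move/eqP: psiP; rewrite addr_eq0 opprB => /eqP ->.
Qed.
End MixedSystem.

(** * Integrals of essentially bounded functions *)

Section EssentiallyBounded.
Context d (T : measurableType d) {R : realType} (mu : {measure set T -> \bar R}).
Variable D : set T.
Implicit Types f g : T -> R.

(** A class stable under sums, products and absolute values that contains the coefficients [beta],
    [1/kappa] and [beta.n], bounded only almost everywhere, as well as polynomials. On a set of
    finite measure its members are integrable, which settles the integrability side conditions of
    the bilinear forms. *)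
Definition ess_bounded f : Prop :=
  measurable_fun D f /\ exists K : R, {ae mu, forall x, D x -> `|f x| <= K}.

Lemma ess_bounded_pointwise f K :
  measurable_fun D f -> (forall x, D x -> `|f x| <= K) -> ess_bounded f.
Proof. by move=> mf fK; split => //; exists K; exact: aeW. Qed.

Lemma ess_bounded_cst c : ess_bounded (cst c).
Proof. exact: (@ess_bounded_pointwise _ `|c|). Qed.

Lemma ess_boundedD f g : ess_bounded f -> ess_bounded g -> ess_bounded (f \+ g).
Proof.
move=> [mf [K fK]] [mg [L gL]]; split; first exact: measurable_funD.
exists (K + L); apply: filterS2 fK gL => x fK gL Dx.
by rewrite (le_trans (ler_normD _ _))// lerD ?fK ?gL.
Qed.

Lemma ess_boundedM f g : ess_bounded f -> ess_bounded g -> ess_bounded (f \* g).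
Proof.
move=> [mf [K fK]] [mg [L gL]]; split; first exact: measurable_funM.
exists (K * L); apply: filterS2 fK gL => x fK gL Dx.
by rewrite /= normrM ler_pM ?fK ?gL.
Qed.

Lemma ess_boundedZ c f : ess_bounded f -> ess_bounded (fun x => c * f x).
Proof. by move=> bf; apply: ess_boundedM bf; exact: ess_bounded_cst. Qed.

Lemma ess_boundedN f : ess_bounded f -> ess_bounded (fun x => - f x).
Proof.
move=> /(@ess_boundedZ (-1)); congr ess_bounded.
by apply/funext => x; rewrite mulN1r.
Qed.

Lemma ess_boundedB f g : ess_bounded f -> ess_bounded g -> ess_bounded (f \- g).
Proof. by move=> bf /ess_boundedN; exact: ess_boundedD. Qed.

Lemma ess_bounded_norm f : ess_bounded f -> ess_bounded (fun x => `|f x|).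
Proof.
move=> [mf [K fK]]; split; first exact: measurableT_comp.
by exists K; apply: filterS fK => x fK /fK; rewrite normr_id.
Qed.

Lemma ess_bounded_sum (I : Type) (r : seq I) (P : pred I) (F : I -> T -> R) :
  (forall i, P i -> ess_bounded (F i)) ->
  ess_bounded (fun x => \sum_(i <- r | P i) F i x).
Proof.
move=> bF; elim: r => [|i r IH].
  rewrite (_ : (fun x => _) = cst 0 :> (T -> R)); first exact: ess_bounded_cst.
  by apply/funext => x; rewrite big_nil.
rewrite (_ : (fun x => _) = (fun x => if P i then F i x + \sum_(j <- r | P j) F j x
    else \sum_(j <- r | P j) F j x) :> (T -> R)); last first.
  by apply/funext => x; rewrite big_cons.
by have [/bF bi|//] := boolP (P i); exact: ess_boundedD.
Qed.

Hypothesis mD : measurable D.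
Hypothesis Dfin : (mu D < +oo)%E.

Lemma ess_bounded_integrable f : ess_bounded f -> mu.-integrable D (EFin \o f).
Proof.
move=> [mf [K fK]]; apply/integrableP; split; first exact/measurable_EFinP.
apply: (@le_lt_trans _ _ (`|K|%:E * mu D)%E); last by rewrite lte_mul_pinfty.
apply: integral_le_bound => //; first exact/measurable_EFinP.
by apply: filterS fK => x fK /fK h; rewrite lee_fin (le_trans h)// ler_norm.
Qed.

End EssentiallyBounded.

Section RintegralFacts.
Context d (T : measurableType d) {R : realType} (mu : {measure set T -> \bar R}).
Implicit Types (D : set T) (f g : T -> R).

Lemma Rintegral_eq0_ae D f : measurable D -> mu.-integrable D (EFin \o f) ->
  {ae mu, forall x, D x -> 0 <= f x} -> \int[mu]_(x in D) f x = 0 ->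
  {ae mu, forall x, D x -> f x = 0}.
Proof.
move=> mD intf f0 int0.
have mf : measurable_fun D (EFin \o f) by exact: measurable_int intf.
have : (\int[mu]_(x in D) `|(EFin \o f) x| = 0)%E.
  transitivity (\int[mu]_(x in D) (f x)%:E)%E.
    apply: ae_eq_integral => //; first exact: measurableT_comp.
    by apply: filterS f0 => x f0 /f0 ?; rewrite /= ger0_norm.
  by rewrite -[LHS]fineK ?[fine _]int0//; exact: integrable_fin_num.
move=> /(ae_eq_integral_abs _ mD mf); apply: filterS => x h Dx.
by have /= [] := h Dx.
Qed.

Lemma ae_eq_Rintegral D f g : measurable D -> measurable_fun D f -> measurable_fun D g ->
  {ae mu, forall x, D x -> f x = g x} ->
  \int[mu]_(x in D) f x = \int[mu]_(x in D) g x.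
Proof.
move=> mD mf mg fg; congr fine; apply: ae_eq_integral => //.
- exact/measurable_EFinP.
- exact/measurable_EFinP.
- by apply: filterS fg => x h /h ->.
Qed.

Lemma Rintegral_sum D (I : Type) (r : seq I) (P : pred I) (F : I -> T -> R) :
  measurable D -> (forall i, P i -> mu.-integrable D (EFin \o F i)) ->
  \int[mu]_(x in D) (\sum_(i <- r | P i) F i x) =
  \sum_(i <- r | P i) \int[mu]_(x in D) F i x.
Proof.
move=> mD intF; elim: r => [|i r IH].
  under eq_Rintegral do rewrite big_nil.
  by rewrite big_nil Rintegral_cst// mul0r.
under eq_Rintegral do rewrite big_cons.
rewrite big_cons; case: ifPn => // Pi; rewrite RintegralD ?IH//; first exact: intF.
have := @integrable_sum _ _ _ mu D mD _ r P (fun i x => (F i x)%:E) intF.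
by apply: eq_integrable => // x _; rewrite /= sumEFin.
Qed.

Lemma Rintegral_ae_ge0 D f : measurable D -> measurable_fun D f ->
  {ae mu, forall x, D x -> 0 <= f x} -> 0 <= \int[mu]_(x in D) f x.
Proof.
move=> mD mf f0; rewrite (@ae_eq_Rintegral _ _ (fun x => `|f x|))//.
- exact: Rintegral_ge0.
- exact: measurableT_comp.
- by apply: filterS f0 => x h /h fx; rewrite ger0_norm.
Qed.

End RintegralFacts.

(** * Lebesgue measure and the topology of row vectors *)

Section LebesgueRV.
Context {R : realType} (n : nat).
Local Notation E := 'rV[R]_n.
Local Notation leb := (lebesgue_rV R n).

Lemma measurable_box (A : 'I_n -> set (measurableTypeR R)) :
  (forall i, measurable (A i)) -> measurable [set x : E | forall i, A i (x ord0 i)].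
Proof.
move=> mA; rewrite (_ : [set x | _] =
    \bigcap_i (fun x : E => x ord0 i) @^-1` A i).
  apply: fin_bigcap_measurable => // i _.
  by rewrite -[X in measurable X]setTI; exact: measurable_coord.
by apply/seteqP; split => x /= h i; [move=> _|]; exact: h.
Qed.

Lemma ball_rVE (x y : E) (e : R) : 0 < e ->
  ball x e y <-> forall i, `|x ord0 i - y ord0 i| < e.
Proof.
move=> e0; split=> [[_ h] i|h]; first exact: h.
by split => // i j; rewrite (ord1 i); exact: h.
Qed.

(** The sigma-algebra is generated by the coordinates, so [U] has to be written as a countable union
    of boxes: those with rational centre and radius [1/(k+1)] that are contained in [U]. *)
Lemma open_measurable_rV (U : set E) : open U -> measurable U.
Proof.
move=> oU.
pose B (z : 'rV[rat]_n * nat) : set E :=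
  [set x : E | forall i, ball (ratr (z.1 ord0 i) : R) z.2.+1%:R^-1 (x ord0 i)].
have mB z : measurable (B z).
  apply: (@measurable_box (fun i => ball (ratr (z.1 ord0 i) : R) z.2.+1%:R^-1)) => i.
  exact: measurable_ball.
rewrite (_ : U = \bigcup_z (if `[< B z `<=` U >] then B z else set0)).
  apply: countable_bigcupT_measurable; first exact: countableP.
  by move=> z; case: ifP.
apply/seteqP; split=> [x Ux|x [z _]]; last by case: ifPn => // /asboolP; exact.
have /nbhs_ballP[e /= e0 xU] : nbhs x U by exact: open_nbhs_nbhs.
have e20 : 0 < 2 / e by rewrite divr_gt0.
(* With [c < e / 2], the box of radius [c] around a rational point within [c] of [x] contains [x]
   and stays in the ball of radius [e]. *)
have [k [c [cE ke k0]]] : exists k : nat, exists c : R, [/\ c = k.+1%:R^-1, c < e / 2 & 0 < c].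
  exists (Num.truncn (2 / e)), (Num.truncn (2 / e)).+1%:R^-1.
  by rewrite invr_gt0 -[e / 2]invf_div ltf_pV2 ?posrE// Num.Theory.truncnS_gt.
have rx i : exists r : rat, `|x ord0 i - ratr r| < c.
  have [|r /= /[!in_itv]/= /andP[r1 r2]] := @rat_in_itvoo R (x ord0 i - c) (x ord0 i + c).
    by rewrite ltrBlDr -addrA ltrDl addr_gt0.
  by exists r; rewrite ltr_norml; apply/andP; split; lra.
have [r hr] := choice rx.
exists (\row_i r i, k) => //; rewrite ifT.
  by move=> i; rewrite /ball/= mxE -cE distrC.
apply/asboolP => y By; apply: xU; apply/ball_rVE => // i.
have := By i; rewrite /ball/= mxE -cE => h1; have := hr i => h2.
rewrite (le_lt_trans (ler_distD (ratr (r i)) _ _))//.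
lra.
Qed.

Lemma continuous_measurable_rV (f : E -> R) D : continuous f -> measurable_fun D f.
Proof.
move=> cf; apply: measurable_funTS.
apply: (measurability _ (RGenOpens.measurableE R)) => _ [_ [a [b ->] <-]].
rewrite setTI; apply: open_measurable_rV; apply: open_comp; last exact: interval_open.
by move=> x _; exact: cf.
Qed.

Lemma lebesgue_rV_open_gt0 (U : set E) : open U -> U !=set0 -> (0 < leb U)%E.
Proof.
move=> oU [x Ux].
have /nbhs_ballP[e /= e0 xU] : nbhs x U by exact: open_nbhs_nbhs.
pose B := [set y : E | forall i, ball (x ord0 i) e (y ord0 i)].
apply: (@lt_le_trans _ _ (leb B)); last first.
  apply: le_measure; rewrite ?inE; [|exact: open_measurable_rV|].
    apply: (@measurable_box (fun i => ball (x ord0 i) e)) => i.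
    exact: measurable_ball.
  by move=> y By; apply: xU; apply/ball_rVE => // i; exact: By.
rewrite (lebesgue_rV_box (A := fun i => ball (x ord0 i) e)); last first.
  by move=> i; exact: measurable_ball.
apply: (big_ind (fun x => 0 < x)%E) => //; first exact: mule_gt0.
by move=> i _; rewrite lebesgue_measure_ball ?ltW// lte_fin mulrn_wgt0.
Qed.

Lemma bounded_lebesgue_fin (D : set E) : measurable D -> bounded_set D -> (leb D < +oo)%E.
Proof.
move=> mD [K [_ hK]].
pose k := `|K| + 1; have k0 : 0 < k by rewrite ltr_wpDl.
have {}hK : forall x, D x -> forall i, `|x ord0 i| <= k.
  move=> x Dx; have /hK : K < k by rewrite ltr_pwDr// ler_norm.
  by move=> /(_ _ Dx)/=; rewrite rV_norm_le ?ltW// => /forallP.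
pose B := [set y : E | forall i, ball (0 : R) (k + 1) (y ord0 i)].
apply: (@le_lt_trans _ _ (leb B)).
  apply: le_measure; rewrite ?inE//.
    apply: (@measurable_box (fun i => ball (0 : R) (k + 1))) => i.
    exact: measurable_ball.
  move=> x Dx i; rewrite /ball/= sub0r normrN (le_lt_trans (hK _ Dx i))//.
  by rewrite ltrDl.
rewrite (lebesgue_rV_box (A := fun i => ball (0 : R) (k + 1))); last first.
  by move=> i; exact: measurable_ball.
rewrite (eq_bigr (fun=> ((k + 1) *+ 2)%:E)) ?prodEFin ?ltry// => i _.
by rewrite lebesgue_measure_ball// addr_ge0 ?ltW.
Qed.

(** The points of [U] where [f] is nonzero form an open null set, and nonempty open sets have
    positive measure. *)
Lemma ae_eq0_open (D U : set E) (f : E -> R) : open U -> U `<=` D ->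
  continuous f -> {ae leb, forall x, D x -> f x = 0} -> forall x, U x -> f x = 0.
Proof.
move=> oU UD cf h x Ux; apply/eqP; apply: contrapT => /negP fx0.
pose W := U `&` f @^-1` (~` [set 0]).
have oW : open W.
  apply: openI => //; apply: open_comp; first by move=> ? _; exact: cf.
  by apply: closed_openC; exact: closed_eq.
have Wx : W x by split => //; apply/eqP.
have W0 : leb W = 0%E.
  apply/(negligibleP _ (open_measurable_rV oW)).
  by apply: negligibleS h => y [/UD Dy /= fy] /(_ Dy).
by have := lebesgue_rV_open_gt0 oW (ex_intro _ x Wx); rewrite W0 ltxx.
Qed.

End LebesgueRV.

(** * Polynomial functions *)

Section PolynomialFunctions.
Context {R : realType} {m : nat}.
Local Notation n := m.+1.
Local Notation E := 'rV[R]_n.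
Local Notation poly := (mpoly.mpoly n R).
Implicit Types (P Q : poly) (x : E) (p : nat).

Definition mvar (i : 'I_n) : poly := mpoly.mpolyX R (mpoly.mnm1 i).

Lemma pevalD P Q x : peval (P + Q) x = peval P x + peval Q x.
Proof. exact: mpoly.mevalD. Qed.

Lemma pevalN P x : peval (- P) x = - peval P x.
Proof. exact: mpoly.mevalN. Qed.

Lemma pevalB P Q x : peval (P - Q) x = peval P x - peval Q x.
Proof. exact: mpoly.mevalB. Qed.

Lemma pevalM P Q x : peval (P * Q) x = peval P x * peval Q x.
Proof. exact: mpoly.mevalM. Qed.

Lemma pevalZ c P x : peval (c *: P) x = c * peval P x.
Proof. exact: mpoly.mevalZ. Qed.

Lemma peval0 x : peval (0 : poly) x = 0.
Proof. exact: mpoly.meval0. Qed.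

Lemma peval1 x : peval (1 : poly) x = 1.
Proof. exact: mpoly.meval1. Qed.

Lemma pevalC c x : peval (mpoly.mpolyC n c) x = c.
Proof. exact: mpoly.mevalC. Qed.

Lemma peval_var i x : peval (mvar i) x = x ord0 i.
Proof. exact: mpoly.mevalXU. Qed.

Lemma peval_sum (I : Type) (r : seq I) (A : pred I) (F : I -> poly) x :
  peval (\sum_(i <- r | A i) F i) x = \sum_(i <- r | A i) peval (F i) x.
Proof.
elim/big_rec2: _ => [|i a b _ <-]; first exact: peval0.
by rewrite pevalD.
Qed.

Lemma peval_prod (I : Type) (r : seq I) (A : pred I) (F : I -> poly) x :
  peval (\prod_(i <- r | A i) F i) x = \prod_(i <- r | A i) peval (F i) x.
Proof.
elim/big_rec2: _ => [|i a b _ <-]; first exact: peval1.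
by rewrite pevalM.
Qed.

Lemma poly_ind_ring (S : poly -> Prop) :
  (forall c, S (mpoly.mpolyC n c)) -> (forall i, S (mvar i)) ->
  (forall P Q, S P -> S Q -> S (P + Q)) ->
  (forall P Q, S P -> S Q -> S (P * Q)) -> forall P, S P.
Proof.
move=> SC SX SD SM P; rewrite (mpoly.mpolyE P).
have S1 : S 1 by exact: SC 1.
have S0 : S 0 by exact: SC 0.
apply: (big_ind S S0 SD).
move=> u _; rewrite -mpoly.mul_mpolyC; apply: (SM) => //.
rewrite mpoly.mpolyXE_id; apply: (big_ind S S1 SM) => i _.
elim: (X in _ ^+ X) => [|k IH]; first by rewrite expr0.
by rewrite exprS; apply: SM => //; exact: SX.
Qed.

Lemma peval_continuous P : continuous (peval P).
Proof.
elim/poly_ind_ring: P => [c|i|P Q cP cQ|P Q cP cQ].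
- rewrite (_ : peval _ = cst c); first exact: cst_continuous.
  by apply/funext => x; rewrite pevalC.
- rewrite (_ : peval _ = fun x : E => x ord0 i); first exact: continuous_coord.
  by apply/funext => x; rewrite peval_var.
- rewrite (_ : peval _ = peval P \+ peval Q); last first.
    by apply/funext => x; rewrite pevalD.
  by move=> x; apply: continuousD; [exact: cP|exact: cQ].
- rewrite (_ : peval _ = peval P \* peval Q); last first.
    by apply/funext => x; rewrite pevalM.
  by move=> x; apply: continuousM; [exact: cP|exact: cQ].
Qed.

Lemma is_derive_coord (i j : 'I_n) x :
  is_derive x (delta_mx ord0 i : E) (fun y : E => y ord0 j) ((j == i)%:R : R).
Proof.
have H : (fun h : R => h^-1 *: ((h *: (delta_mx ord0 i : E) + x) ord0 j - x ord0 j)) @ 0^' -->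
    ((j == i)%:R : R).
  apply: cvg_near_cst; near=> h.
  have h0 : h != 0 by near: h; exact: nbhs_dnbhs_neq.
  by rewrite !mxE addrK eqxx /= /GRing.scale/= mulrA mulVf// mul1r.
by apply: DeriveDef; [apply/cvg_ex; exists ((j == i)%:R) | exact: cvg_lim].
Unshelve. all: by end_near.
Qed.

Lemma is_derive_peval P x i :
  is_derive x (delta_mx ord0 i : E) (peval P) (peval (mpoly.mderiv i P) x).
Proof.
elim/poly_ind_ring: P => [c|j|P Q cP cQ|P Q cP cQ].
- rewrite (_ : peval (mpoly.mpolyC n c) = cst c); last first.
    by apply/funext => y; rewrite pevalC.
  by rewrite mpoly.mderivC peval0; exact: is_derive_cst.
- rewrite (_ : peval (mvar j) = fun y : E => y ord0 j); last first.
    by apply/funext => y; rewrite peval_var.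
  rewrite mpoly.mderivX mpoly.mnm1E pevalZ; apply: is_derive_eq.
    exact: is_derive_coord.
  have [->|_] := eqVneq j i; last by rewrite mul0r.
  rewrite mul1r (_ : mpoly.mnm_sub _ _ = mpoly.mnm0) ?peval1//.
    by rewrite mpoly.mpolyX0 peval1.
  by apply/mpoly.mnmP => k; rewrite mpoly.mnmBE mpoly.mnm0E subnn.
- rewrite (_ : peval (P + Q) = peval P + peval Q); last first.
    by apply/funext => y; rewrite pevalD.
  by rewrite mpoly.mderivD pevalD; exact: is_deriveD.
- rewrite (_ : peval (P * Q) = peval P * peval Q); last first.
    by apply/funext => y; rewrite pevalM.
  rewrite mpoly.mderivM pevalD !pevalM; apply: (is_derive_eq (is_deriveM cP cQ)).
  by rewrite /GRing.scale/= addrC [X in X + _]mulrC.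
Qed.

Lemma partial_peval P i : partial i (peval P) = peval (mpoly.mderiv i P).
Proof.
apply/funext => x; have [_ h] := is_derive_peval P x i; exact: h.
Qed.

Lemma grad_peval P x : grad (peval P) x = \row_i peval (mpoly.mderiv i P) x.
Proof. by apply/rowP => i; rewrite !mxE partial_peval. Qed.

Lemma smooth_peval P : smooth (peval P).
Proof.
move=> s /=; have [Q ->] : exists Q, foldr partial (peval P) s = peval Q.
  elim: s => [|i s [Q QE]] /=; first by exists P.
  by exists (mpoly.mderiv i Q); rewrite QE partial_peval.
split; first exact: peval_continuous.
by move=> i x; have [] := is_derive_peval Q x i.
Qed.

(** All derivatives of [P] vanish on [U] as well. The one along the leading monomial [u] is the
    constant [u!] times the leading coefficient, because the leading monomial has maximal total
    degree. *)
Lemma peval_open_eq0 P (U : set E) : open U -> U !=set0 ->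
  (forall x, U x -> peval P x = 0) -> P = 0.
Proof.
move=> oU [x0 Ux0] P0; apply/eqP; apply: contrapT => /negP Pn0.
have dU (Q : poly) i : (forall x, U x -> peval Q x = 0) ->
    forall x, U x -> peval (mpoly.mderiv i Q) x = 0.
  move=> Q0 x Ux; rewrite -partial_peval /partial.
  rewrite (near_eq_derive (g := cst 0)) ?derive_cst//.
  have : nbhs x U by exact: open_nbhs_nbhs.
  by apply: filterS => y /Q0.
have dmU u : forall x, U x -> peval (mpoly.mderivm u P) x = 0.
  rewrite mpoly.mderivm_foldr; elim: (X in foldr _ _ X) => //= i s IH.
  exact: dU.
pose u := mpoly.mlead P.
have := dmU u x0 Ux0.
have -> : mpoly.mderivm u P = mpoly.mpolyC n (mpoly.mcoeff mpoly.mnm0 (mpoly.mderivm u P)).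
  apply: mpoly.msize1_polyC; rewrite mpoly.msizeE; apply/bigmax_leqP_seq => v + _.
  rewrite mpoly.mcoeff_msupp mpoly.mcoeff_mderivm.
  have [->|v0] := eqVneq v mpoly.mnm0; first by rewrite mpoly.mdeg0.
  rewrite mpoly.memN_msupp_eq0 ?mul0rn ?eqxx//.
  apply: mpoly.msize_mdeg_ge; rewrite -mpoly.mlead_deg// mpoly.mdegD.
  by rewrite -[ltnLHS]addn0 ltn_add2l lt0n mpoly.mdeg_eq0.
rewrite pevalC mpoly.mcoeff_mderivm mpoly.addm0 => /eqP.
rewrite mulrn_eq0 mpoly.mleadc_eq0 (negbTE Pn0) orbF; apply/negP.
by rewrite -lt0n prodn_gt0// => i; rewrite ffactnn fact_gt0.
Qed.

Lemma deg_leE p P : deg_le p P = (mpoly.msize P <= p.+1)%N.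
Proof.
rewrite mpoly.msizeE; apply/allP/bigmax_leqP_seq => [h u uP _|h u uP].
  exact: h.
exact: h.
Qed.

Lemma deg_leD p P Q : deg_le p P -> deg_le p Q -> deg_le p (P + Q).
Proof.
rewrite !deg_leE => hP hQ; apply: leq_trans (mpoly.mmeasureD_le _ _ _) _.
by rewrite geq_max hP.
Qed.

Lemma deg_leZ p c P : deg_le p P -> deg_le p (c *: P).
Proof. by rewrite !deg_leE; apply: leq_trans (mpoly.msizeZ_le _ _). Qed.

Lemma deg_leN p P : deg_le p P -> deg_le p (- P).
Proof. by move=> hP; rewrite -scaleN1r; exact: deg_leZ. Qed.

Lemma deg_leB p P Q : deg_le p P -> deg_le p Q -> deg_le p (P - Q).
Proof. by move=> hP hQ; apply: deg_leD => //; exact: deg_leN. Qed.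

Lemma deg_le0 p : deg_le p (0 : poly).
Proof. by rewrite deg_leE mpoly.mmeasure0. Qed.

Lemma deg_leC p c : deg_le p (mpoly.mpolyC n c : poly).
Proof.
by rewrite -[mpoly.mpolyC _ _]mulr1 mpoly.mul_mpolyC deg_leZ// deg_leE mpoly.msize1.
Qed.

Lemma deg_le_sum p (I : Type) (r : seq I) (A : pred I) (F : I -> poly) :
  (forall i, A i -> deg_le p (F i)) -> deg_le p (\sum_(i <- r | A i) F i).
Proof. by move=> h; elim/big_ind: _ => //; [exact: deg_le0|move=> ? ?; exact: deg_leD]. Qed.

Lemma deg_leM p q P Q : deg_le p P -> deg_le q Q -> deg_le (p + q) (P * Q).
Proof.
have [->|P0] := eqVneq P 0; first by rewrite mul0r => _ _; exact: deg_le0.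
have [->|Q0] := eqVneq Q 0; first by rewrite mulr0 => _ _; exact: deg_le0.
rewrite !deg_leE mpoly.msizeM// => hP hQ.
by rewrite -subn1 leq_subLR (leq_trans (leq_add hP hQ))// addSn addnS.
Qed.

Lemma deg_le_var i : deg_le 1 (mvar i).
Proof. by rewrite deg_leE mpoly.msizeX mpoly.mdeg1. Qed.

Lemma deg_leW p q P : (p <= q)%N -> deg_le p P -> deg_le q P.
Proof. by rewrite !deg_leE => pq hP; rewrite (leq_trans hP). Qed.

Lemma deg_le_mderiv p i P : deg_le p P -> deg_le p.-1 (mpoly.mderiv i P).
Proof.
move=> /allP hP; apply/allP => u.
rewrite mpoly.mcoeff_msupp mpoly.mcoeff_mderiv mulrn_eq0 negb_or /=.
rewrite -mpoly.mcoeff_msupp => /hP; rewrite mpoly.mdegD mpoly.mdeg1 addn1.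
by case: (p).
Qed.

Lemma mderiv_deg0 i P : deg_le 0 P -> mpoly.mderiv i P = 0.
Proof.
rewrite deg_leE => /mpoly.msize1_polyC ->; exact: mpoly.mderivC.
Qed.

Lemma mderiv_eq0_const P : (forall i, mpoly.mderiv i P = 0) ->
  P = mpoly.mpolyC n (mpoly.mcoeff mpoly.mnm0 P).
Proof.
move=> dP; apply: mpoly.msize1_polyC; rewrite mpoly.msizeE.
apply/bigmax_leqP_seq => u uP _; rewrite ltnS leqn0 mpoly.mdeg_eq0.
apply: contraT => u0; move: uP; rewrite mpoly.mcoeff_msupp.
have [i ui] : exists i, u i != 0%N.
  apply/existsP; apply: contraNT u0 => /existsPn h; apply/eqP/mpoly.mnmP => i.
  by rewrite mpoly.mnm0E; apply/eqP/negPn/h.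
have := congr1 (mpoly.mcoeff (mpoly.mnm_sub u (mpoly.mnm1 i))) (dP i).
rewrite mpoly.mcoeff_mderiv mpoly.mcoeff0 mpoly.submK; last first.
  by rewrite mpoly.lep1mP.
by move=> /eqP; rewrite mulrn_eq0 /= => ->.
Qed.

Lemma peval_bounded P (D : set E) : bounded_set D ->
  exists K : R, forall x, D x -> `|peval P x| <= K.
Proof.
move=> [K [_ hK]]; elim/poly_ind_ring: P => [c|i|P Q [A hA] [B hB]|P Q [A hA] [B hB]].
- by exists `|c| => x _; rewrite pevalC.
- exists (`|K| + 1) => x Dx; rewrite peval_var.
  have /hK : K < `|K| + 1 by rewrite ltr_pwDr// ler_norm.
  by move=> /(_ _ Dx)/=; rewrite rV_norm_le ?addr_ge0// => /forallP.
- exists (A + B) => x Dx; rewrite pevalD (le_trans (ler_normD _ _))//.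
  by rewrite lerD ?hA ?hB.
- by exists (A * B) => x Dx; rewrite pevalM normrM ler_pM ?hA ?hB.
Qed.

End PolynomialFunctions.

(** * Barycentric coordinates and mesh geometry *)

Section Barycentric.
Context {R : realType} {m : nat}.
Local Notation n := m.+1.
Local Notation E := 'rV[R]_n.
Variable M : mesh R n.
Local Notation V := 'I_(nverts M).
Implicit Types (S T F : {set V}) (x y : E).

Definition nondegenerate T : Prop := #|T| = n.+1 /\ affinely_independent T.

(** Coordinates are stored as pairs (constant, gradient) of affine functions on the whole space: the
    gradient yields the normal of the opposite facet, and signs outside the simplex tell on which
    side of a facet a point lies. *)
Definition is_barycentric T (cg : (V -> R) * (V -> E)) : Prop :=
  (forall x, \sum_(j in T) (cg.1 j + dotv (cg.2 j) x) = 1) /\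
  (forall x, \sum_(j in T) (cg.1 j + dotv (cg.2 j) x) *: vertex j = x).

Lemma barycentric_exists T : nondegenerate T -> exists cg, is_barycentric T cg.
Proof.
move=> [cT indT].
(* Affine independence makes this matrix with rows [(1, a_i)], square by the cardinality of [T],
   invertible; the columns of the inverse are the coefficients of the affine functions sought. *)
pose B : 'M[R]_(#|T|, 1 + n) :=
  \matrix_i row_mx (1%:M : 'rV_1) (vertex (enum_val i)).
pose ext (K : zmodType) (f : 'I_#|T| -> K) (j : V) := \sum_(i | enum_val i == j) f i.
have extE (K : zmodType) (f : 'I_#|T| -> K) k : ext K f (enum_val k) = f k.
  rewrite /ext (bigD1 k)//= big1 ?addr0// => i /andP[/eqP/enum_val_inj ->].
  by rewrite eqxx.
have mulB (v : 'rV[R]_#|T|) : v *m B =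
    row_mx (\sum_i v ord0 i)%:M (\sum_i v ord0 i *: vertex (enum_val i)).
  apply/rowP => k; rewrite !mxE; case: splitP => j jE.
    rewrite (ord1 j) mxE eqxx mulr1n; apply: eq_bigr => i _.
    by rewrite !mxE; case: splitP => j' j'E; rewrite ?(ord1 j') ?mxE ?eqxx ?mulr1//;
      move: j'E jE => ->; rewrite (ord1 j).
  rewrite summxE; apply: eq_bigr => i _; rewrite !mxE; congr (_ * _).
  case: splitP => j' j'E; first by move: j'E jE => ->; rewrite (ord1 j').
  congr (vertex _ _ _); apply: val_inj; apply/eqP.
  by rewrite -(eqn_add2l 1) -jE j'E.
have freeB : row_free B.
  apply: inj_row_free => v; rewrite mulB => h.
  have [h1 h2] : \sum_i v ord0 i = 0 /\ \sum_i v ord0 i *: vertex (enum_val i) = 0.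
    move: h; rewrite -[RHS](@row_mx0 _ 1 1 n) => /eq_row_mx[/matrixP/(_ ord0 ord0)].
    by rewrite !mxE eqxx mulr1n.
  apply/rowP => k; rewrite mxE -(extE _ (fun i => v ord0 i)).
  apply: indT; rewrite ?enum_valP// big_enum_val.
    by rewrite -[RHS]h1; apply: eq_bigr => i _; rewrite extE.
  by rewrite -[RHS]h2; apply: eq_bigr => i _; rewrite extE.
have fullB : row_full B by rewrite /row_full (eqP freeB) cT.
pose C := pinvmx B.
exists (ext _ (fun i => C (lshift n ord0) i), ext _ (fun i => \row_k C (rshift 1 k) i)).
have yE x i : (row_mx (1%:M : 'rV_1) x *m C) ord0 i =
    C (lshift n ord0) i + dotv (\row_k C (rshift 1 k) i) x.
  rewrite mxE big_split_ord/= big_ord1 row_mxEl mxE eqxx mul1r; congr (_ + _).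
  by apply: eq_bigr => k _; rewrite row_mxEr mxE mulrC.
have yB x : row_mx (1%:M : 'rV_1) x *m C *m B = row_mx (1%:M : 'rV_1) x.
  by rewrite -mulmxA mulVpmx// mulmx1.
split=> x /=; rewrite big_enum_val/=; move: (yB x) (yE x); move: (_ *m C) => y.
  rewrite mulB => /eq_row_mx[/matrixP/(_ ord0 ord0)].
  rewrite !mxE eqxx !mulr1n => <- _ h; apply: eq_bigr => i _.
  by rewrite !extE h.
rewrite mulB => /eq_row_mx[_ h2] h; rewrite -[RHS]h2; apply: eq_bigr => i _.
by rewrite !extE h.
Qed.

Definition barycentric T := get [set cg | is_barycentric T cg].

Definition bary T (j : V) (x : E) : R :=
  (barycentric T).1 j + dotv ((barycentric T).2 j) x.

Lemma hullS S T : S \subset T -> hull S `<=` hull T.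
Proof.
move=> ST x [w [w0 w1 ->]]; exists (fun j => if j \in S then w j else 0); split.
- by move=> i; case: ifP.
- rewrite -w1 -big_mkcondr/=; apply: eq_bigl => i.
  by apply: andb_idl => /(fintype.subsetP ST).
- rewrite [RHS](eq_bigr (fun i => if i \in S then w i *: vertex i else 0)); last first.
    by move=> i _ /=; case: (i \in S); rewrite ?scale0r.
  rewrite -big_mkcondr/=; apply: eq_bigl => i.
  by apply/esym/andb_idl => /(fintype.subsetP ST).
Qed.

Lemma hull_vertex S i : i \in S -> hull S (vertex i).
Proof.
move=> iS; exists (fun j => (j == i)%:R); split => //.
- by rewrite (bigD1 i iS)/= eqxx big1 ?addr0// => j /andP[_ /negbTE ->].
- rewrite (bigD1 i iS)/= eqxx scale1r big1 ?addr0// => j /andP[_ /negbTE ->].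
  by rewrite scale0r.
Qed.

Section Simplex.
Variable T : {set V}.
Hypothesis ndT : nondegenerate T.

Lemma barycentricP : is_barycentric T (barycentric T).
Proof. by have [cg h] := barycentric_exists ndT; exact: (getI h). Qed.

Lemma bary_sum x : \sum_(j in T) bary T j x = 1.
Proof. by have [h _] := barycentricP; exact: h. Qed.

Lemma bary_comb x : \sum_(j in T) bary T j x *: vertex j = x.
Proof. by have [_ h] := barycentricP; exact: h. Qed.

Lemma bary_unique (w : V -> R) x : \sum_(j in T) w j = 1 ->
  \sum_(j in T) w j *: vertex j = x -> forall j, j \in T -> w j = bary T j x.
Proof.
move=> w1 wx j jT; apply/eqP; rewrite -subr_eq0; apply/eqP.
apply: (ndT.2 (fun j => w j - bary T j x)) => //.
  by rewrite sumrB w1 bary_sum subrr.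
under eq_bigr do rewrite scalerBl.
by rewrite sumrB wx bary_comb subrr.
Qed.

Lemma bary_vertex i j : i \in T -> j \in T -> bary T j (vertex i) = (j == i)%:R.
Proof.
move=> iT jT; apply/esym/(@bary_unique (fun j => (j == i)%:R)) => //.
  by rewrite (bigD1 i iT)/= eqxx big1 ?addr0// => k /andP[_ /negbTE ->].
rewrite (bigD1 i iT)/= eqxx scale1r big1 ?addr0// => k /andP[_ /negbTE ->].
by rewrite scale0r.
Qed.

Lemma bary_sumE j (A : {set V}) (w : V -> R) : \sum_(i in A) w i = 1 ->
  bary T j (\sum_(i in A) w i *: vertex i) = \sum_(i in A) w i * bary T j (vertex i).
Proof.
move=> w1; rewrite /bary dotvC dotv_suml.
under [RHS]eq_bigr do rewrite mulrDr.
rewrite big_split/= -mulr_suml w1 mul1r; congr (_ + _).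
by apply: eq_bigr => i _; rewrite dotvZl dotvC.
Qed.

(** Weights on [S] extended by zero are the barycentric coordinates in [T], by uniqueness. *)
Lemma hull_face S x : S \subset T ->
  hull S x <-> (forall j, j \in T -> 0 <= bary T j x) /\
               (forall j, j \in T -> j \notin S -> bary T j x = 0).
Proof.
move=> ST; split=> [[w [w0 w1 xE]]|[h0 h1]].
  pose w' j := if j \in S then w j else 0.
  have w'E j : j \in T -> w' j = bary T j x.
    apply: bary_unique.
      rewrite -w1 -big_mkcondr/=; apply: eq_bigl => i.
      by apply: andb_idl => /(fintype.subsetP ST).
    rewrite xE [LHS](eq_bigr (fun i => if i \in S then w i *: vertex i else 0)); last first.
      by move=> i _; rewrite /w'/=; case: (i \in S); rewrite ?scale0r.
    rewrite -big_mkcondr/=; apply: eq_bigl => i.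
    by apply: andb_idl => /(fintype.subsetP ST).
  split=> j jT; first by rewrite -w'E// /w'; case: ifP.
  by move=> /negbTE jS; rewrite -w'E// /w' jS.
exists (fun j => if j \in T then bary T j x else 0); split.
- by move=> i; case: ifP => // /h0.
- rewrite -[RHS](bary_sum x) [RHS](bigID (mem S))/= [X in _ = _ + X]big1 ?addr0.
    rewrite (eq_bigl (fun i => (i \in T) && (i \in S))).
      by apply: eq_bigr => i /andP[-> _].
    by move=> i; apply/esym/andb_idl => /(fintype.subsetP ST).
  by move=> i /andP[iT iS]; exact: h1.
- rewrite -[LHS](bary_comb x) [LHS](bigID (mem S))/= [X in _ + X]big1 ?addr0.
    rewrite [RHS](eq_bigl (fun i => (i \in T) && (i \in S))).
      by apply: eq_bigr => i /andP[-> _].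
    by move=> i; apply/esym/andb_idl => /(fintype.subsetP ST).
  by move=> i /andP[iT iS]; rewrite h1// scale0r.
Qed.

Lemma hullP x : hull T x <-> (forall j, j \in T -> 0 <= bary T j x).
Proof.
rewrite (hull_face x (subxx T)); split=> [[]//|h]; split => // j -> //.
Qed.

End Simplex.

Lemma bary_continuous T j : continuous (bary T j).
Proof.
rewrite (_ : bary T j = fun x => (barycentric T).1 j +
    \sum_i (barycentric T).2 j ord0 i * x ord0 i)//.
move=> x; apply: continuousD; first exact: cst_continuous.
move: x; apply: continuous_sumr => i _ x.
by apply: continuousM; [exact: cst_continuous|exact: continuous_coord].
Qed.

Lemma near_bary_gt0 T j x : 0 < bary T j x -> \forall y \near x, 0 < bary T j y.
Proof.
by move=> h; apply: (@cvgr_gt R E (nbhs x) (nbhs_filter x) _ _ _ 0 h); exact: bary_continuous.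
Qed.

Lemma near_all_bary_gt0 T S x : (forall j, j \in S -> 0 < bary T j x) ->
  \forall y \near x, forall j, j \in S -> 0 < bary T j y.
Proof.
move=> h; apply: (@filter_forall _ V (fun j y => j \in S -> 0 < bary T j y) (nbhs x)) => j.
have [jS|jS] := boolP (j \in S); last by apply: nearW => y jS'; case/negP: jS.
by apply: filterS (near_bary_gt0 (h j jS)) => y.
Qed.

Definition bary_poly T j : mpoly.mpoly n R :=
  mpoly.mpolyC n ((barycentric T).1 j) + \sum_i (barycentric T).2 j ord0 i *: mvar i.

Lemma peval_bary T j x : peval (bary_poly T j) x = bary T j x.
Proof.
rewrite /bary_poly pevalD pevalC peval_sum; congr (_ + _).
by apply: eq_bigr => i _; rewrite pevalZ peval_var.
Qed.

Lemma deg_le_bary T j : deg_le 1 (bary_poly T j).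
Proof.
apply: deg_leD; first exact: deg_leC.
by apply: deg_le_sum => i _; apply: deg_leZ; exact: deg_le_var.
Qed.

Definition open_simplex T : set E := [set x | forall j, j \in T -> 0 < bary T j x].

Lemma open_open_simplex T : open (open_simplex T).
Proof.
by rewrite openE => x xT; apply: near_all_bary_gt0.
Qed.

Lemma open_simplex_sub T : nondegenerate T -> open_simplex T `<=` (hull T)°.
Proof.
move=> ndT; rewrite -open_subsetE; last exact: open_open_simplex.
by move=> x h; apply/hullP => // j /h/ltW.
Qed.

Definition centroid S : E := \sum_(i in S) (#|S|%:R^-1) *: vertex i.

End Barycentric.

(** Turns an open condition at [x] into information along a ray. The bound [t <= 1] keeps [x + t d]
    a convex combination when [d] leads from [x] to a vertex or a centroid. *)
Lemma near_line {R : realType} {n : nat} (x d : 'rV[R]_n) (P : 'rV[R]_n -> Prop) : (\forall y \near x, P y) ->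
  exists t : R, [/\ 0 < t, t <= 1 & P (x + t *: d)].
Proof.
move=> /nbhs_ballP[e /= e0 xP].
have d1 : 0 < `|d| + 1 by rewrite ltr_wpDl.
have c0 : 0 < e / 2 / (`|d| + 1) by rewrite !divr_gt0.
exists (Num.min 1 (e / 2 / (`|d| + 1))); split.
- by rewrite lt_min ltr01.
- by rewrite ge_min lexx.
apply: xP; rewrite -ball_normE /ball_/= opprD addrA subrr sub0r normrN.
rewrite normrZ ger0_norm ?le_min ?ler01 ?ltW//.
apply: (@le_lt_trans _ _ (e / 2)); last by rewrite ltr_pdivrMr// ltr_pMr// ltr1n.
apply: (@le_trans _ _ (e / 2 / (`|d| + 1) * (`|d| + 1))).
  by rewrite ler_pM ?le_min ?ler01 ?(ltW c0)// ?ge_min ?lexx ?orbT// lerDl.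
by rewrite divfK// gt_eqF.
Qed.

Section MeshGeometry.
Context {R : realType} {m : nat}.
Local Notation n := m.+1.
Local Notation E := 'rV[R]_n.

Variable M : mesh R n.
Local Notation V := 'I_(nverts M).
Implicit Types (S T F : {set V}) (x y : E).

Lemma bary_dir T j x y z t :
  bary T j (x + t *: (y - z)) = bary T j x + t * (bary T j y - bary T j z).
Proof. by rewrite /bary dotvDr dotvZr dotvBr; ring. Qed.

Lemma bary_centroid T S j : nondegenerate T -> S \subset T -> S != finset.set0 ->
  j \in T -> bary T j (centroid S) = (j \in S)%:R / #|S|%:R.
Proof.
move=> ndT ST S0 jT; have cS : #|S|%:R != 0 :> R by rewrite pnatr_eq0 cards_eq0.
rewrite /centroid bary_sumE; last by rewrite sumr_const -[LHS]mulr_natr mulVf.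
rewrite (eq_bigr (fun i => #|S|%:R^-1 * (j == i)%:R)); last first.
  by move=> i /(fintype.subsetP ST) iT; rewrite bary_vertex.
have [jS|jS] := boolP (j \in S).
  rewrite (bigD1 j jS)/= eqxx big1 ?addr0 ?mulr1 ?mul1r// => i /andP[_ ij].
  by rewrite eq_sym (negbTE ij) mulr0.
rewrite mul0r big1// => i iS; case: eqP => [ji|]; last by rewrite mulr0.
by rewrite ji iS in jS.
Qed.

Lemma bary_centroid_gt0 T S j : nondegenerate T -> S \subset T -> j \in S ->
  0 < bary T j (centroid S).
Proof.
move=> ndT ST jS; have S0 : S != finset.set0 by apply/finset.set0Pn; exists j.
rewrite bary_centroid ?jS ?(fintype.subsetP ST)// divr_gt0// ltr0n card_gt0//.
Qed.

Lemma centroid_hull S : S != finset.set0 -> hull S (centroid S).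
Proof.
move=> S0; exists (fun=> #|S|%:R^-1); split=> //.
by rewrite sumr_const -[LHS]mulr_natr mulVf// pnatr_eq0 cards_eq0.
Qed.

Lemma centroid_open_simplex T : nondegenerate T -> open_simplex T (centroid T).
Proof. by move=> ndT j jT; apply: bary_centroid_gt0. Qed.

Lemma near_not_hull T x : nondegenerate T -> ~ hull T x -> \forall y \near x, ~ hull T y.
Proof.
move=> ndT Tx.
have [j jT jx] : exists2 j, j \in T & bary T j x < 0.
  apply: contrapT => h; apply: Tx; apply/(hullP ndT) => j jT.
  by rewrite leNgt; apply/negP => jx; apply: h; exists j.
have : \forall y \near x, bary T j y < 0.
  by apply: (@cvgr_lt R E (nbhs x) (nbhs_filter x) _ _ _ 0 jx); exact: bary_continuous.
by apply: filterS => y yj /(hullP ndT)/(_ _ jT); rewrite leNgt yj.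
Qed.

Lemma hull_bounded T : exists K : R, forall x, hull T x -> forall i, `|x ord0 i| <= K.
Proof.
exists (\sum_(j in T) `|vertex j|) => x [w [w0 w1 ->]] i.
rewrite summxE; apply: le_trans (ler_norm_sum _ _ _) _; apply: ler_sum => j jT.
rewrite mxE normrM ger0_norm// -[leRHS]mul1r ler_pM//.
  by rewrite -w1 (bigD1 j jT)/= lerDl sumr_ge0.
by have := lexx `|vertex j|; rewrite {1}rV_norm_le// => /forallP.
Qed.

Lemma card_facet T a : #|T| = n.+1 -> a \in T -> #|T :\ a| = n.
Proof. by rewrite (cardsD1 a) => + aT; rewrite aT add1n => -[]. Qed.

Lemma facet_setD1 T F : #|T| = n.+1 -> #|F| = n -> F \subset T ->
  exists2 a, a \in T & F = T :\ a.
Proof.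
move=> cT cF FT.
have /cards1P[a TFa] : #|T :\: F| == 1%N.
  by rewrite cardsD (finset.setIidPr FT) cT cF subSnn.
have : a \in T :\: F by rewrite TFa inE.
rewrite inE => /andP[aF aT]; exists a => //; apply/eqP.
rewrite eqEcard cF (card_facet cT aT) leqnn andbT.
apply/fintype.subsetP => i iF; rewrite !inE (fintype.subsetP FT)// andbT.
by apply: contraNneq aF => <-.
Qed.

Section Conforming.
Variable Omega : set E.
Hypothesis oOmega : open Omega.
Hypothesis conf : conforming_mesh M Omega.

Lemma cell_nondegenerate T : T \in cells M -> nondegenerate T.
Proof. by have [h _ _] := conf; exact: h. Qed.

Lemma cell_sub_closure T : T \in cells M -> hull T `<=` closure Omega.
Proof. by have [_ -> _] := conf; move=> TM x Tx; exists T. Qed.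

(** Cells are closed and finite in number, so a neighbourhood of [x] meets only the cells that
    contain [x]. *)
Lemma near_cover x : Omega x ->
  \forall y \near x, exists2 T, T \in cells M & hull T x /\ hull T y.
Proof.
move=> Ox; have nO : \forall y \near x, Omega y by exact: open_nbhs_nbhs.
have nT : \forall y \near x, forall T, T \in cells M -> ~ hull T x -> ~ hull T y.
  apply: (@filter_forall _ {set V}
    (fun T y => T \in cells M -> ~ hull T x -> ~ hull T y) (nbhs x)) => T.
  have [TM|TM] := boolP (T \in cells M); last by apply: nearW => y TM'; case/negP: TM.
  have [Tx|Tx] := pselect (hull T x); first by apply: nearW => y _ /(_ Tx).
  by have := near_not_hull (cell_nondegenerate TM) Tx; apply: filterS.
apply: filterS2 nO nT => y Oy h.
have := subset_closure Oy; have [_ -> _] := conf => -[T TM Ty]; exists T => //.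
by split => //; apply: contrapT => Tx; exact: h Ty.
Qed.

Lemma hull_cellI T T' x : T \in cells M -> T' \in cells M -> hull T x -> hull T' x ->
  forall j, j \in T -> j \notin T' -> bary T j x = 0.
Proof.
move=> TM T'M Tx T'x j jT jT'; have [_ _ /(_ T T' TM T'M) h] := conf.
have : hull (T :&: T') x by rewrite -h.
move=> /(hull_face (cell_nondegenerate TM) _ (subsetIl _ _))[_]; apply => //.
by rewrite inE negb_and jT' orbT.
Qed.

Lemma cell_setD T T' : T \in cells M -> T' \in cells M -> T != T' ->
  exists2 a, a \in T & a \notin T'.
Proof.
move=> TM T'M; apply: contraNP => h.
have TT' : T \subset T'.
  apply/fintype.subsetP => a aT; apply: contrapT => /negP aT'.
  by apply: h; exists a.
rewrite eqEcard TT' (cell_nondegenerate TM).1 (cell_nondegenerate T'M).1.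
exact: leqnn.
Qed.

(** A short move from a common interior point towards a vertex [a] of [T] outside [T'] stays in both
    cells. By conformity the coordinate of [a] vanishes at both ends, yet it has grown by a positive
    amount. *)
Lemma cell_interiors_disjoint T T' x : T \in cells M -> T' \in cells M ->
  (hull T)° x -> (hull T')° x -> T = T'.
Proof.
move=> TM T'M Tx T'x; apply/eqP; apply: contrapT => /negP.
move=> /(cell_setD TM T'M)[a aT aT'].
have ndT := cell_nondegenerate TM.
have [t [t0 t1 [Ty T'y]]] := near_line (vertex a - x) (filterI Tx T'x).
have := hull_cellI TM T'M Ty T'y aT aT'; rewrite bary_dir bary_vertex// eqxx.
rewrite (hull_cellI TM T'M (interior_subset Tx) (interior_subset T'x) aT aT').
by rewrite subr0 add0r mulr1 => t00; rewrite t00 ltxx in t0.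
Qed.

(* Just across [F] from [T], the points of Omega lie in another cell. *)
Lemma facet_neighbour T a : T \in cells M -> a \in T ->
  ~ (hull (T :\ a) `<=` boundary Omega) ->
  exists T', [/\ T' \in cells M, T' != T & T :\ a \subset T'].
Proof.
move=> TM aT hF; have ndT := cell_nondegenerate TM; set F := T :\ a.
have FT : F \subset T by exact: subD1set.
have F0 : F != finset.set0 by rewrite -card_gt0 (card_facet ndT.1 aT).
have [x Fx Ox] : exists2 x, hull F x & Omega x.
  apply: contrapT => h; apply: hF => x Fx; split.
    exact/(cell_sub_closure TM)/(hullS FT).
  by move=> /interior_subset Ox; apply: h; exists x.
(* [x] may lie on the relative boundary of the facet; a small move towards the centroid reaches the
   relative interior and stays in [Omega]. *)
have [t [t0 t1 Oy]] := near_line (centroid F - x) (open_nbhs_nbhs (conj oOmega Ox)).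
set y := x + _ in Oy.
have /(hull_face ndT _ FT)[x0 xF] := Fx.
have yF j : j \in F -> 0 < bary T j y.
  move=> jF; rewrite /y bary_dir mulrBr addrCA -[X in _ + (X - _)]mul1r -mulrBl.
  rewrite ltr_pwDl ?mulr_gt0// ?bary_centroid_gt0// mulr_ge0// ?subr_ge0//.
  by rewrite x0// (fintype.subsetP FT).
have ya : bary T a y = 0.
  by rewrite /y bary_dir bary_centroid// xF// !inE eqxx// mul0r subrr mulr0 addr0.
(* Stepping from [y] away from [a] makes the coordinate of [a] equal to [- s], so the end point
   leaves [T]; a cell containing both it and [y] is the neighbour. *)
have [s [s0 s1 [T' T'M [T'y T'z]]]] := near_line (y - vertex a) (near_cover Oy).
have TT' : T' != T.
  apply/eqP => TT'; move: T'z; rewrite TT' => /(hullP ndT)/(_ a aT).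
  by rewrite bary_dir bary_vertex// eqxx ya add0r sub0r mulrN mulr1 oppr_ge0 leNgt s0.
exists T'; split => //; apply/fintype.subsetP => j jF; apply: contrapT => /negP jT'.
have Ty : hull T y.
  apply/(hullP ndT) => k kT; have [kF|] := boolP (k \in F); first exact/ltW/yF.
  by rewrite !inE kT andbT negbK => /eqP ->; rewrite ya.
have jT := fintype.subsetP FT j jF.
by have := yF j jF; rewrite (hull_cellI TM T'M Ty T'y jT jT') ltxx.
Qed.

End Conforming.
End MeshGeometry.

Lemma mpoly_prod_neq0 (R : realType) n (I : finType) (A : pred I) (F : I -> mpoly.mpoly n R) :
  (forall i, A i -> F i != 0) -> \prod_(i | A i) F i != 0.
Proof. by move=> h; apply/prodf_neq0 => i Ai; exact: h. Qed.

(** * Families of cells closed under crossing facets *)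

Section ClosedFamily.
Context {R : realType} {m : nat}.
Local Notation n := m.+1.
Local Notation E := 'rV[R]_n.
Variables (M : mesh R n) (Omega : set E).
Local Notation V := 'I_(nverts M).
Hypothesis conf : conforming_mesh M Omega.
Implicit Types (T F : {set V}) (x y : E).

(** Expand [x] over the vertices of [T] and apply the affine coordinate of [T']: the shared vertices
    contribute Kronecker symbols, and only the value at [a] stays unknown. *)
Lemma bary_face T T' a x : T \in cells M -> T' \in cells M -> a \in T ->
  T :\ a \subset T' -> forall j, j \in T' ->
  bary T' j x = (if j \in T :\ a then bary T j x else 0)
                + bary T a x * bary T' j (vertex a).
Proof.
move=> TM T'M aT FT' j jT'; have ndT := cell_nondegenerate conf TM.
have ndT' := cell_nondegenerate conf T'M.
rewrite -{1}(bary_comb ndT x) bary_sumE ?bary_sum// (bigD1 a)//= addrC; congr (_ + _).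
rewrite (eq_bigl (fun i => i \in T :\ a)); last by move=> i; rewrite !inE andbC.
rewrite (eq_bigr (fun i => bary T i x * (j == i)%:R)); last first.
  by move=> i iF; rewrite bary_vertex// (fintype.subsetP FT').
case: ifPn => jF.
  rewrite (bigD1 j jF)/= eqxx mulr1 big1 ?addr0// => i /andP[_ /negbTE ij].
  by rewrite eq_sym ij mulr0.
rewrite big1// => i iF; case: eqP => [ji|]; last by rewrite mulr0.
by rewrite ji iF in jF.
Qed.

Variable S : {set {set V}}.
Hypothesis SM : S \subset cells M.
Hypothesis Sclosed : forall T a, T \in S -> a \in T ->
  exists T', [/\ T' \in S, T' != T & T :\ a \subset T'].

Let A : set E := [set x | exists2 T, T \in S & hull T x].

Let ScellM T : T \in S -> T \in cells M.
Proof. exact: (fintype.subsetP SM). Qed.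

(* At a point of the relative interior of a facet [F], the two cells of [S]
   containing [F] lie on both sides of [F] and cover a neighbourhood. *)
Lemma closed_family_boundary x : A x -> (\forall y \near x, A y) \/
  exists T a b, [/\ T \in S, a \in T, b \in T, a != b &
                    bary T a x = 0 /\ bary T b x = 0].
Proof.
move=> [T TS Tx]; have TM := ScellM TS; have ndT := cell_nondegenerate conf TM.
have x0 := (hullP ndT x).1 Tx.
have [[a [aT xa]]|h] := pselect (exists a, a \in T /\ bary T a x = 0); last first.
  left; have : \forall y \near x, forall j, j \in T -> 0 < bary T j y.
    apply: near_all_bary_gt0 => j jT; rewrite lt_def x0// andbT.
    by apply/eqP => xj; apply: h; exists j.
  by apply: filterS => y hy; exists T => //; apply/(hullP ndT) => j /hy/ltW.
have [[b [bT ab xb]]|h] := pselect (exists b, [/\ b \in T, a != b & bary T b x = 0]).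
  by right; exists T, a, b.
left; have [T' [T'S T'T FT']] := Sclosed TS aT.
have T'M := ScellM T'S; have ndT' := cell_nondegenerate conf T'M.
set F := T :\ a in FT'.
have xF j : j \in F -> 0 < bary T j x.
  rewrite !inE => /andP[ja jT]; rewrite lt_def x0// andbT.
  by apply/eqP => xj; apply: h; exists j; split => //; rewrite eq_sym.
have cF : #|F| = n by rewrite (card_facet ndT.1 aT).
have [b bT' FE] := facet_setD1 ndT'.1 cF FT'.
have bF : b \notin F by rewrite FE !inE eqxx.
have aT' : a \notin T'.
  apply: contra T'T => aT'; rewrite eq_sym eqEcard ndT.1 ndT'.1 leqnn andbT.
  apply/fintype.subsetP => j jT; have [->//|ja] := eqVneq j a.
  by apply: (fintype.subsetP FT'); rewrite !inE ja.
have T'xE j : j \in T' -> bary T' j x = if j \in F then bary T j x else 0.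
  by move=> jT'; rewrite (bary_face x TM T'M aT FT' jT') xa mul0r addr0.
have xF' j : j \in F -> 0 < bary T' j x.
  by move=> jF; rewrite T'xE ?(fintype.subsetP FT')// jF xF.
(* [a] and [b] lie strictly on opposite sides of [F]: otherwise a small move from [x] towards [a]
   would end in both cells, and conformity would make the coordinate of [a] vanish there. *)
have ba : bary T' b (vertex a) < 0.
  rewrite ltNge; apply/negP => ba.
  have [t [t0 t1 zF]] := near_line (vertex a - x) (near_all_bary_gt0 xF').
  set z := x + _ in zF.
  have Tz : hull T z.
    apply/(hullP ndT) => j jT; rewrite /z bary_dir bary_vertex// mulrBr addrCA.
    rewrite -[X in _ + (X - _)]mul1r -mulrBl addr_ge0//.
      by rewrite mulr_ge0 ?ler0n// ltW.
    by rewrite mulr_ge0 ?subr_ge0// x0.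
  have T'z : hull T' z.
    apply/(hullP ndT') => j jT'; have [jF|jF] := boolP (j \in F); first exact/ltW/zF.
    have -> : j = b by apply/eqP; move: jF; rewrite FE !inE jT' andbT negbK.
    by rewrite /z bary_dir T'xE// (negbTE bF) subr0 add0r mulr_ge0// ltW.
  have := hull_cellI conf TM T'M Tz T'z aT aT'.
  by rewrite /z bary_dir xa bary_vertex// eqxx subr0 add0r mulr1 => t00; rewrite t00 ltxx in t0.
apply: filterS2 (near_all_bary_gt0 xF) (near_all_bary_gt0 xF') => y yF yF'.
(* The side of [F] decides between [T] and [T']: in the second case the coordinate of [b] is a
   product of two nonpositive numbers. *)
have [ya|/ltW ya] := leP 0 (bary T a y).
  exists T => //; apply/(hullP ndT) => j jT.
  by have [->//|ja] := eqVneq j a; rewrite ltW// yF// !inE ja.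
exists T' => //; apply/(hullP ndT') => j jT'.
have [jF|jF] := boolP (j \in F); first exact/ltW/yF'.
have -> : j = b by apply/eqP; move: jF; rewrite FE !inE jT' andbT negbK.
by rewrite (bary_face y TM T'M aT FT' bT') (negbTE bF) add0r mulr_le0// ltW.
Qed.

Lemma closed_family_closed : closed A.
Proof.
move=> x Ax; apply: contrapT => nAx.
have : \forall y \near x, forall T, T \in S -> ~ hull T y.
  apply: (@filter_forall _ {set V} (fun T y => T \in S -> ~ hull T y) (nbhs x)) => T.
  have [TS|TS] := boolP (T \in S); last by apply: nearW => y TS'; case/negP: TS.
  have Tx : ~ hull T x by move=> Tx; apply: nAx; exists T.
  have := near_not_hull (cell_nondegenerate conf (ScellM TS)) Tx.
  by apply: filterS => y.
by move=> /Ax[y [[T TS Ty] /(_ T TS)]].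
Qed.

(* The last point of [A] on a segment from [x0] in [A] to [y] outside [A] lies
   on a face of codimension 2, so that [y] is on one of finitely many
   hyperplanes through [x0]. *)
Lemma closed_family_exit x0 y : A x0 -> ~ A y ->
  exists T a b, [/\ T \in S, a \in T, b \in T, a != b &
    bary T a x0 * bary T b y - bary T b x0 * bary T a y = 0].
Proof.
move=> Ax0 Ay.
pose K := [set t : R | 0 <= t <= 1 /\ A (x0 + t *: (y - x0))].
have K0 : K 0 by split; rewrite ?lexx ?ler01// scale0r addr0.
have Kub : ubound K 1 by move=> t [/andP[]].
have Ksup : has_sup K by split; [exists 0|exists 1].
pose s := sup K.
have s01 : 0 <= s <= 1.
  by rewrite /s ub_le_sup//= ?ge_sup//; [exists 0|exists 1].
pose g t : E := x0 + t *: (y - x0).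
have cg : continuous g.
  by move=> t; apply: cvgD; [exact: cvg_cst|apply: cvgZr_tmp; exact: cvg_id].
have As : A (g s).
  have cA : closed (g @^-1` A).
    by apply: closed_comp; [move=> ? _; exact: cg|exact: closed_family_closed].
  apply: cA; have := closure_sup Ksup.1 Ksup.2.
  by apply: closure_subset => t [].
have [nA|[T [a [b [TS aT bT ab [ea eb]]]]]] := closed_family_boundary As; last first.
  exists T, a, b; split => //; move: ea eb; rewrite /g !bary_dir.
  move: (bary T a x0) (bary T b x0) (bary T a y) (bary T b y) => u v U W ea eb.
  (* Eliminates [s] between the two linear equations [ea] and [eb]. *)
  rewrite (_ : _ - _ = (W - v) * (u + s * (U - u)) + (u - U) * (v + s * (W - v))).
    by rewrite ea eb !mulr0 addr0.
  by ring.
have s1 : s < 1.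
  rewrite lt_neqAle; case/andP: s01 => _ ->; rewrite andbT; apply/eqP => s1.
  by apply: Ay; move: As; rewrite /g s1 scale1r addrC subrK.
have [t [t0 t1 At]] := near_line ((1 - s) *: (y - x0)) nA.
(* A neighbourhood inside [A] would allow a parameter beyond the supremum. *)
have : K (s + t * (1 - s)).
  split; last by move: At; rewrite /g scalerA -addrA -scalerDl.
  case/andP: s01 => s0 _; apply/andP; split; first by rewrite addr_ge0// mulr_ge0 ?(ltW t0)// subr_ge0 ltW.
  by rewrite -lerBrDl ler_piMl// subr_ge0 ltW.
move=> /(ub_le_sup Ksup.2); rewrite -/s gerDl pmulr_rle0// subr_le0.
by rewrite leNgt s1.
Qed.

(** The starting point is generic: [Q] is a nonzero polynomial, so some [x0] inside [T] lies on no
    hyperplane carrying a facet of a cell of [S]. Each [L] is then nonzero, since its value at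
    [vertex b] is the coordinate of [a] at [x0]. Every point outside [A] is a zero of the product of
    the [L], and the complement of [A] is open, and nonempty because [A] is bounded; so this product
    would be zero although no factor is. *)
Lemma closed_family_empty T : T \in S -> False.
Proof.
move=> TS; have ndT := cell_nondegenerate conf (ScellM TS).
have ndS T' : T' \in S -> nondegenerate T'.
  by move=> /ScellM; exact: (cell_nondegenerate conf).
have lam0 T' a : T' \in S -> a \in T' -> bary_poly T' a != 0.
  move=> /ndS ndT' aT'; apply/eqP => /(congr1 (peval^~ (vertex a))).
  by rewrite peval_bary peval0 bary_vertex// eqxx => /eqP; rewrite oner_eq0.
pose Q := \prod_(p : {set V} * V | (p.1 \in S) && (p.2 \in p.1)) bary_poly p.1 p.2.
have Q0 : Q != 0 by apply: mpoly_prod_neq0 => -[T' a] /andP[/= ? ?]; exact: lam0.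
have [x0 Tx0 Qx0] : exists2 x0, open_simplex T x0 & peval Q x0 != 0.
  apply: contrapT => h; move/eqP: Q0; apply.
  apply: (peval_open_eq0 (@open_open_simplex _ _ _ T)).
    by exists (centroid T); exact: centroid_open_simplex.
  by move=> x Tx; apply/eqP; apply: contrapT => /negP Qx; apply: h; exists x.
have {}Qx0 T' a : T' \in S -> a \in T' -> bary T' a x0 != 0.
  move=> T'S aT'; move: Qx0; rewrite peval_prod => /prodf_neq0/(_ (T', a)).
  by rewrite /= peval_bary T'S aT'; exact.
pose L (p : {set V} * (V * V)) := bary p.1 p.2.1 x0 *: bary_poly p.1 p.2.2
  - bary p.1 p.2.2 x0 *: bary_poly p.1 p.2.1.
pose D (p : {set V} * (V * V)) :=
  [&& p.1 \in S, p.2.1 \in p.1, p.2.2 \in p.1 & p.2.1 != p.2.2].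
have L0 p : D p -> L p != 0.
  case: p => T' [a b] /and4P[/= T'S aT' bT' ab].
  apply/eqP => /(congr1 (peval^~ (vertex b))).
  rewrite /L/= pevalB !pevalZ !peval_bary peval0 !(bary_vertex (ndS _ T'S))// eqxx.
  by rewrite (negbTE ab) mulr0 subr0 mulr1 => /eqP; apply/negP/Qx0.
have /eqP := mpoly_prod_neq0 L0; apply.
have Ax0 : A x0 by exists T => //; apply/(hullP ndT) => j /Tx0/ltW.
apply: (peval_open_eq0 (closed_openC closed_family_closed)).
  have [K hK] := choice (fun T' => hull_bounded (M := M) T').
  (* A point whose coordinates exceed the bounds of all hulls. *)
  exists (const_mx (1 + \sum_T' `|K T'|)) => -[T' _ /hK/(_ ord0)]; rewrite mxE.
  have s0 : 0 <= \sum_T' `|K T'| by exact: sumr_ge0.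
  rewrite ger0_norm ?addr_ge0// => h.
  have : K T' <= \sum_T' `|K T'|.
    rewrite (bigD1 T')//= (le_trans (ler_norm _))// lerDl.
    exact: sumr_ge0.
  lra.
move=> y /(closed_family_exit Ax0)[T' [a [b [T'S aT' bT' ab h]]]].
rewrite peval_prod; apply/eqP/prodf_eq0; exists (T', (a, b)).
  by apply/and4P; split.
by rewrite /L/= pevalB !pevalZ !peval_bary; apply/eqP.
Qed.

End ClosedFamily.

(** * Facet measures and normals *)

Section Facets.
Context {R : realType} {m : nat}.
Local Notation n := m.+1.
Local Notation E := 'rV[R]_n.
Variable M : mesh R n.
Local Notation V := 'I_(nverts M).
Implicit Types (S T F : {set V}) (x y : E).

(** The gradient [g] of the barycentric coordinate of [a] is orthogonal to the facet and points
    towards [a], so [- g / |g|] witnesses that the choice in the definition succeeds. *)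
Lemma outward_unit_normalP T a : nondegenerate T -> a \in T ->
  let nu := outward_unit_normal T (T :\ a) in
  [/\ dotv nu nu = 1,
    forall i j, i \in T :\ a -> j \in T :\ a -> dotv nu (vertex j - vertex i) = 0 &
    forall i, i \in T :\ a -> dotv nu (vertex a - vertex i) < 0].
Proof.
move=> ndT aT; set g := (barycentric T).2 a.
have gE x y : dotv g (x - y) = bary T a x - bary T a y.
  by rewrite /bary dotvBr; ring.
have [b bT] : exists b, b \in T :\ a.
  by apply/finset.set0Pn; rewrite -card_gt0 (card_facet ndT.1 aT).
have gF i j : i \in T :\ a -> j \in T -> dotv g (vertex j - vertex i) = (a == j)%:R.
  rewrite !inE => /andP[ia iT] jT; rewrite gE !bary_vertex//.
  by rewrite [a == i]eq_sym (negbTE ia) subr0.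
have g0 : 0 < dotv g g.
  rewrite lt_def dotv_ge0 andbT; apply/eqP => /dotv_eq0 g0.
  have := gF b a bT aT; rewrite g0 dotv0l eqxx => /esym/eqP.
  by rewrite oner_eq0.
pose r := (Num.sqrt (dotv g g))^-1.
have r0 : 0 < r by rewrite invr_gt0 sqrtr_gt0.
pose P := [set nu : E | [/\ dotv nu nu = 1,
    forall i j, i \in T :\ a -> j \in T :\ a -> dotv nu (vertex j - vertex i) = 0 &
    forall i j, i \in T :\ a -> j \in T :\: (T :\ a) ->
      dotv nu (vertex j - vertex i) < 0]].
have Pnu : P (- (r *: g)).
  split.
  - rewrite dotvNl dotvNr opprK dotvZl dotvZr mulrA -invfM -expr2.
    by rewrite (sqr_sqrtr (ltW g0)) mulVf// gt_eqF.
  - move=> i j iF; rewrite !inE => /andP[ja jT].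
    by rewrite dotvNl dotvZl gF// [a == j]eq_sym (negbTE ja) mulr0 oppr0.
  - move=> i j iF; rewrite !inE negb_and negbK => /andP[/orP[/eqP ->|jT jT']].
      by rewrite dotvNl dotvZl gF// eqxx mulr1 oppr_lt0.
    by rewrite jT' in jT.
have [h1 h2 h3] : P (outward_unit_normal T (T :\ a)) by exact: (getI Pnu).
by split => // i iF; apply: h3 => //; rewrite !inE eqxx aT.
Qed.

Lemma normal_facet_tangent T a b x : nondegenerate T -> a \in T -> b \in T :\ a ->
  hull (T :\ a) x -> dotv (x - vertex b) (outward_unit_normal T (T :\ a)) = 0.
Proof.
move=> ndT aT bF [w [w0 w1 ->]]; have [_ h _] := outward_unit_normalP ndT aT.
rewrite dotvC dotvBr dotvC dotv_suml.
rewrite (eq_bigr (fun i => w i * dotv (outward_unit_normal T (T :\ a)) (vertex b))).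
  by rewrite -mulr_suml w1 mul1r subrr.
move=> i iF; rewrite dotvZl dotvC; congr (_ * _).
by apply/eqP; rewrite -subr_eq0 -dotvBr h.
Qed.

(** [h] is the height of [T] above the facet, so the field [x - a] has a constant positive normal
    component there. *)
Lemma normal_facet_opposite T a : nondegenerate T -> a \in T ->
  exists2 h : R, 0 < h & forall x, hull (T :\ a) x ->
    dotv (x - vertex a) (outward_unit_normal T (T :\ a)) = h.
Proof.
move=> ndT aT; have [_ _ h] := outward_unit_normalP ndT aT.
have [b bF] : exists b, b \in T :\ a.
  by apply/finset.set0Pn; rewrite -card_gt0 (card_facet ndT.1 aT).
exists (- dotv (outward_unit_normal T (T :\ a)) (vertex a - vertex b)).
  by rewrite oppr_gt0 h.
move=> x Fx; have := normal_facet_tangent ndT aT bF Fx.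
by rewrite !dotvBl !dotvBr !(dotvC (outward_unit_normal _ _)); lra.
Qed.

Lemma hull_combination F (I : finType) (w : I -> R) (y : I -> E) :
  (forall i, 0 <= w i) -> \sum_i w i = 1 -> (forall i, hull F (y i)) ->
  hull F (\sum_i w i *: y i).
Proof.
move=> w0 w1 /choice[W hW].
exists (fun j => \sum_i w i * W i j); split.
- by move=> j; apply: sumr_ge0 => i _; rewrite mulr_ge0//; have [] := hW i.
- rewrite exchange_big/= -[RHS]w1; apply: eq_bigr => i _.
  by rewrite -mulr_sumr; have [_ -> _] := hW i; rewrite mulr1.
- under [RHS]eq_bigr do rewrite scaler_suml.
  rewrite exchange_big/=; apply: eq_bigr => i _.
  have [_ _ ->] := hW i; rewrite scaler_sumr; apply: eq_bigr => j _.
  by rewrite scalerA.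
Qed.

Section FacetParam.
Variables (F : {set V}).
Hypothesis cF : #|F| = n.

(** A default element for [nth], available because [F] is nonempty; [arg max] of a constant is an
    arbitrary choice. *)
Let v0 : V := [arg max_(i > (enum_val (cast_ord (esym cF) ord0))) 0%N].

Let facet_vertexE i : (i < n)%N -> facet_vertex F i = vertex (nth v0 (enum F) i).
Proof. by move=> iF; rewrite /facet_vertex (nth_map v0)// -cardE cF. Qed.

Let nth_facet i : (i < n)%N -> nth v0 (enum F) i \in F.
Proof. by move=> iF; rewrite -mem_enum mem_nth// -cardE cF. Qed.

Let sum_facet (K : nmodType) (f : V -> K) :
  \sum_(j in F) f j = f (nth v0 (enum F) 0) + \sum_(i < m) f (nth v0 (enum F) i.+1).
Proof.
by rewrite -big_enum/= (big_nth v0) -cardE cF big_mkord big_ord_recl.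
Qed.

Lemma facet_paramE t : facet_param F t =
  (1 - \sum_i t ord0 i) *: facet_vertex F 0 + \sum_i t ord0 i *: facet_vertex F i.+1.
Proof.
rewrite /facet_param scalerBl scale1r -addrA; congr (_ + _).
rewrite mulmx_sum_row scaler_suml addrC -sumrB; apply: eq_bigr => i _.
by rewrite rowK scalerBr.
Qed.

Lemma facet_param_hull t : reference_simplex t -> hull F (facet_param F t).
Proof.
move=> [t0 t1]; rewrite facet_paramE.
pose w (i : 'I_n) := if unlift ord0 i is Some k then t ord0 k else 1 - \sum_i t ord0 i.
have w_0 : w ord0 = 1 - \sum_i t ord0 i by rewrite /w unlift_none.
have w_S i : w (lift ord0 i) = t ord0 i by rewrite /w liftK.
have -> : (1 - \sum_i t ord0 i) *: facet_vertex F 0 +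
    \sum_i t ord0 i *: facet_vertex F i.+1 = \sum_i w i *: facet_vertex F i.
  rewrite big_ord_recl w_0; congr (_ + _); apply: eq_bigr => i _.
  by rewrite w_S.
apply: hull_combination.
- move=> i; case: (unliftP ord0 i) => [k ->|->]; rewrite ?w_S ?w_0//.
  by rewrite subr_ge0.
- by rewrite big_ord_recl w_0; under [X in _ + X = _]eq_bigr do rewrite w_S; rewrite subrK.
- by move=> i; rewrite facet_vertexE//; apply: hull_vertex; exact: nth_facet.
Qed.

Lemma hull_facet_param x : hull F x -> exists2 t, reference_simplex t & facet_param F t = x.
Proof.
move=> [w [w0 w1 ->]]; pose t : 'rV[R]_m := \row_i w (nth v0 (enum F) i.+1).
have tE : \sum_i t ord0 i = \sum_(i < m) w (nth v0 (enum F) i.+1).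
  by apply: eq_bigr => i _; rewrite mxE.
exists t.
  split=> [i|]; first by rewrite mxE.
  by rewrite tE -w1 sum_facet lerDr.
rewrite facet_paramE sum_facet tE -w1 sum_facet addrK facet_vertexE//.
by congr (_ + _); apply: eq_bigr => i _; rewrite mxE facet_vertexE// ltnS ltn_ord.
Qed.

Lemma facet_jacobian_free : affinely_independent F -> row_free (facet_jacobian F).
Proof.
move=> indF; apply: inj_row_free => v vJ; apply/rowP => k; rewrite mxE.
(* A linear relation between the edges issued from [a_0] becomes an affine relation between the
   vertices once [a_0] receives the weight [- sum v_i]. *)
pose f (j : V) := \sum_(i < m | nth v0 (enum F) i.+1 == j) v ord0 i
  - (if nth v0 (enum F) 0 == j then \sum_i v ord0 i else 0).
have nth_inj i j : (i < n)%N -> (j < n)%N ->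
    (nth v0 (enum F) i == nth v0 (enum F) j) = (i == j).
  by move=> iF jF; rewrite nth_uniq ?enum_uniq// -cardE cF.
have f0 : f (nth v0 (enum F) 0) = - \sum_i v ord0 i.
  by rewrite /f eqxx big1 ?sub0r// => i; rewrite nth_inj// ltnS ltn_ord.
have fS (i : 'I_m) : f (nth v0 (enum F) i.+1) = v ord0 i.
  rewrite /f nth_inj//= ?subr0; last by rewrite ltnS ltn_ord.
  rewrite (bigD1 i)//= big1 ?addr0// => j /andP[].
  by rewrite nth_inj ?ltnS ?ltn_ord// eqSS => /eqP/val_inj ->; rewrite eqxx.
rewrite -fS; apply: indF; last by apply: nth_facet; rewrite ltnS ltn_ord.
  by rewrite sum_facet f0; under [X in _ + X = _]eq_bigr do rewrite fS; rewrite addNr.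
rewrite sum_facet f0 -[RHS]vJ mulmx_sum_row scaleNr scaler_suml -sumrN -big_split/=.
apply: eq_bigr => i _; rewrite fS rowK !facet_vertexE ?ltnS ?ltn_ord// scalerBr.
by rewrite addrC.
Qed.

End FacetParam.

End Facets.

(** For [0 < s <= 1] the matrix [s G + (1 - s) I] is positive definite, hence invertible. Its
    determinant is a polynomial in [s] equal to 1 at 0, so by the intermediate value theorem it
    cannot be nonpositive at 1. *)
Lemma det_gram_gt0 {R : realType} k l (J : 'M[R]_(k, l)) : row_free J -> 0 < \det (J *m J^T).
Proof.
move=> freeJ; set G := J *m J^T.
have G0 (x : 'rV[R]_k) : 0 <= dotv (x *m G) x.
  by rewrite /G mulmxA dotv_mulmx trmxK dotv_ge0.
have unitG (s : R) : 0 < s -> s <= 1 -> \det (s *: G + (1 - s)%:M) != 0.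
  move=> s0 s1; apply: contraTneq isT => /eqP/det0P[x x0 xG].
  case/negP: x0; apply/eqP.
  have : dotv (x *m (s *: G + (1 - s)%:M)) x = 0 by rewrite xG dotv0l.
  rewrite mulmxDr -scalemxAr mul_mx_scalar dotvDl !dotvZl => /eqP.
  rewrite paddr_eq0 ?mulr_ge0 ?subr_ge0 ?dotv_ge0 ?G0 ?(ltW s0)// => /andP[+ _].
  rewrite mulf_eq0 gt_eqF//= /G mulmxA dotv_mulmx trmxK => /eqP/dotv_eq0 xJ.
  by apply: (row_free_inj freeJ); rewrite xJ mul0mx.
pose P : {poly R} := \det ('X *: map_mx polyC G + (1 - 'X)%:M).
have PE s : P.[s] = \det (s *: G + (1 - s)%:M).
  rewrite /P -horner_evalE -det_map_mx; congr (\det _); apply/matrixP => i j.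
  rewrite !mxE /= /horner_eval !hornerE.
  by case: (i == j); rewrite ?mulr1n ?mulr0n !hornerE.
have P1 : P.[1] = \det G by rewrite PE scale1r subrr raddf0 addr0.
have P0 : P.[0] = 1 by rewrite PE scale0r add0r subr0 det1.
rewrite ltNge -P1; apply/negP => P1le.
have [s /andP[s0 s1] /rootP Ps] : exists2 s, 0 <= s <= 1 & root P s.
  have [] := @poly_ivt R (- P) 0 1; rewrite ?ler01//.
    by rewrite !hornerN P0 oppr_le0 ler01 oppr_ge0.
  by move=> s hs rs; exists s; rewrite // -rootN.
have [s00|s0n] := eqVneq s 0; first by move: Ps; rewrite s00 P0 => /eqP; rewrite oner_eq0.
by have := unitG s; rewrite lt_def s0n s0 s1 -PE Ps eqxx => /(_ isT isT).
Qed.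

(** * Functions in [L^2] and [L^infty] *)

Section LpFacts.
Context {R : realType} (n : nat).
Local Notation E := 'rV[R]_n.
Local Notation leb := (lebesgue_rV R n).
Implicit Types (D : set E) (f g : E -> R).

Lemma Lp_measurable D p f : measurable D -> Lp D p f -> measurable_fun D f.
Proof.
move=> mD; rewrite /Lp inE => /andP[+ _]; rewrite inE/= => mf.
exact/(measurable_restrictT _ mD).
Qed.

Lemma Lp_infty_ess_bounded D f : measurable D -> Lp D +oo%E f -> ess_bounded leb D f.
Proof.
move=> mD Lf; split; first exact: Lp_measurable Lf.
move: Lf; rewrite /Lp inE => /andP[_]; rewrite inE/= /finite_norm unlock.
(* The norm at [+oo] is an essential supremum on a space of positive measure and 0 by convention
   otherwise; in the second case every bound holds almost everywhere. *)
have [mu0|] := boolP (0 < leb [set: E])%E; last first.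
  rewrite -leNgt => mu0 _; exists 0; exists setT; split => //.
  by apply/eqP; rewrite eq_le mu0 measure_ge0.
set N := ess_sup _ _ => Ny.
have : {ae leb, forall x, (abse \o (EFin \o (f \_ D))) x <= N}%E by exact: ess_sup_ge.
move=> h; exists (fine N); apply: filterS h => x /= + Dx.
rewrite patchE mem_set// => fN; rewrite -lee_fin fineK//.
by rewrite ge0_fin_numE// (le_trans _ fN).
Qed.

Lemma bounded_Lp_infty D f K : measurable D -> measurable_fun D f ->
  (forall x, D x -> `|f x| <= K) -> Lp D +oo%E f.
Proof.
move=> mD mf fK; rewrite /Lp inE; apply/andP; split.
  by rewrite inE/=; exact/(measurable_restrictT _ mD).
rewrite inE/= /finite_norm unlock; case: ifP => // _.
apply: (@le_lt_trans _ _ `|K|%:E); last exact: ltry.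
apply/ess_supP; apply: aeW => x /=; rewrite lee_fin patchE; case: ifPn => //.
  by rewrite inE => /fK h; rewrite (le_trans h)// ler_norm.
by rewrite normr0.
Qed.

Lemma Lp_norm_infty_le D f K : (forall x, D x -> `|f x| <= K) -> 0 <= K ->
  (Lp_norm D +oo f <= K%:E)%E.
Proof.
move=> fK K0; rewrite /Lp_norm unlock; case: ifP => // _.
apply/ess_supP; apply: aeW => x /=; rewrite lee_fin patchE; case: ifPn => //.
  by rewrite inE => /fK.
by rewrite normr0.
Qed.

Lemma bounded_Lp2 D f : measurable D -> (leb D < +oo)%E -> ess_bounded leb D f ->
  Lp D 2%:E f.
Proof.
move=> mD Dfin bf; rewrite /Lp inE; apply/andP; split.
  by rewrite inE/=; apply/(measurable_restrictT _ mD); exact: bf.1.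
rewrite inE/= /finite_norm unlock; apply: poweR_lty.
rewrite (_ : (fun x => _) = (EFin \o (fun x => f x ^+ 2)) \_ D); last first.
  apply/funext => x; rewrite /= !patchE/=; case: ifP => _.
    by rewrite powR_mulrn// real_normK// num_real.
  by rewrite normr0 powR0.
rewrite -integral_mkcond; apply: integrable_lty => //.
apply: (@ess_bounded_integrable _ _ _ leb D mD Dfin (fun x => f x ^+ 2)).
by rewrite (_ : (fun x => _) = f \* f) //; exact: ess_boundedM.
Qed.

Lemma Lp2_mul_integrable D f g : measurable D -> Lp D 2%:E f -> Lp D 2%:E g ->
  leb.-integrable D (EFin \o (fun x => f x * g x)).
Proof.
move=> mD Lf Lg.
have /Lfun1_integrable ifg : (f \_ D) \* (g \_ D) \in Lfun leb 1 by exact: Lfun2_mul_Lfun1.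
have := @integrableS _ _ _ leb setT D _ measurableT mD (@subsetT _ D) ifg.
by apply: eq_integrable => // x Dx; rewrite /= !patchE Dx.
Qed.

Lemma Lp2_inner_le D f g : measurable D -> Lp D 2%:E f -> Lp D 2%:E g ->
  (`| \int[leb]_(x in D) (f x * g x) |%:E <= Lp_norm D 2%:E f * Lp_norm D 2%:E g)%E.
Proof.
move=> mD Lf Lg; have mf := Lp_measurable mD Lf; have mg := Lp_measurable mD Lg.
have ifgD := Lp2_mul_integrable mD Lf Lg.
apply: (@le_trans _ _ (Lnorm leb 1 (EFin \o ((f \_ D) \* (g \_ D))))); last first.
  apply: hoelder => //; [exact/(measurable_restrictT _ mD)|exact/(measurable_restrictT _ mD)|].
  by rewrite [RHS]splitr !div1r.
rewrite EFin_normr_Rintegral// Lnorm1; apply: le_trans (le_abse_integral _ mD _) _.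
  exact: measurable_int ifgD.
rewrite integral_mkcond le_eqVlt; apply/orP; left; apply/eqP; apply: eq_integral => x _.
by rewrite /= !patchE; case: ifP => //=; rewrite ?mulr0 ?normr0.
Qed.

End LpFacts.

(** * Integrals over facets *)

Section FacetIntegral.
Context {R : realType} {m : nat}.
Local Notation n := m.+1.
Local Notation E := 'rV[R]_n.
Variable M : mesh R n.
Local Notation V := 'I_(nverts M).
Local Notation leb := (lebesgue_rV R m).
Local Notation simplex := (@reference_simplex R m).
Variable F : {set V}.
Implicit Types g h : E -> R.

Lemma continuous_sum_coord k : continuous (fun t : 'rV[R]_k => \sum_i t ord0 i).
Proof. by apply: continuous_sumr => i _; exact: continuous_coord. Qed.

Lemma measurable_reference_simplex : measurable simplex.
Proof.
rewrite (_ : simplex = [set t : 'rV[R]_m | forall i, `[0, +oo[%classic (t ord0 i)] `&`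
    (fun t : 'rV[R]_m => \sum_i t ord0 i) @^-1` `]-oo, 1]%classic).
  apply: measurableI.
    by apply: (@measurable_box R m (fun=> `[0, +oo[%classic)) => i; exact: measurable_itv.
  have mS := @continuous_measurable_rV R m _ setT (@continuous_sum_coord m).
  by rewrite -[X in measurable X]setTI; apply: mS => //; exact: measurable_itv.
apply/seteqP; split=> t /= [h0 h1]; split.
- by move=> i; rewrite in_itv/= h0.
- by rewrite in_itv.
- by move=> i; have := h0 i; rewrite in_itv/= andbT.
- by move: h1; rewrite in_itv.
Qed.

Lemma reference_simplex_le1 t i : simplex t -> 0 <= t ord0 i <= 1.
Proof.
move=> [t0 t1]; rewrite t0/=; apply: le_trans t1.
by rewrite (bigD1 i)//= lerDl sumr_ge0.
Qed.

Lemma reference_simplex_fin : (leb simplex < +oo)%E.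
Proof.
apply: bounded_lebesgue_fin measurable_reference_simplex _.
exists 1; split; first exact: num_real.
move=> r r1 t ht /=; rewrite rV_norm_le ?(le_trans ler01) ?ltW//.
apply/forallP => i; have /andP[h0 h1] := reference_simplex_le1 i ht.
by rewrite ger0_norm// (le_trans h1)// ltW.
Qed.

Definition facet_bounded g : Prop := ess_bounded leb simplex (g \o facet_param F).

Lemma Linfty_facet_bounded g : Linfty_facet F g -> facet_bounded g.
Proof. exact: (Lp_infty_ess_bounded measurable_reference_simplex). Qed.

Lemma facet_bounded_integrable g : facet_bounded g ->
  leb.-integrable simplex (EFin \o (fun t => g (facet_param F t))).
Proof.
exact: (ess_bounded_integrable measurable_reference_simplex reference_simplex_fin).
Qed.

Lemma facet_intD g h : facet_bounded g -> facet_bounded h ->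
  facet_int F (fun x => g x + h x) = facet_int F g + facet_int F h.
Proof.
move=> /facet_bounded_integrable ig /facet_bounded_integrable ih.
by rewrite /facet_int -mulrDr RintegralD//; exact: measurable_reference_simplex.
Qed.

Lemma facet_intZ c g : facet_bounded g ->
  facet_int F (fun x => c * g x) = c * facet_int F g.
Proof.
move=> /facet_bounded_integrable ig.
rewrite /facet_int mulrCA RintegralZl//; exact: measurable_reference_simplex.
Qed.

Hypothesis cF : #|F| = n.

Lemma eq_facet_int g h : (forall x, hull F x -> g x = h x) ->
  facet_int F g = facet_int F h.
Proof.
move=> gh; congr (_ * _); apply: eq_Rintegral => t; rewrite inE => ht.
by apply: gh; exact: facet_param_hull.
Qed.

Lemma ae_eq_facet_int g h : facet_bounded g -> facet_bounded h ->
  ae_facet F (fun x => g x = h x) -> facet_int F g = facet_int F h.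
Proof.
move=> [mg _] [mh _] gh; congr (_ * _); apply: ae_eq_Rintegral => //.
exact: measurable_reference_simplex.
Qed.

Lemma facet_int_ge0 g : (forall x, hull F x -> 0 <= g x) -> 0 <= facet_int F g.
Proof.
move=> g0; rewrite mulr_ge0 ?sqrtr_ge0//; apply: Rintegral_ge0 => t ht.
by apply: g0; exact: facet_param_hull.
Qed.

Lemma facet_int0 g : (forall x, hull F x -> g x = 0) -> facet_int F g = 0.
Proof.
move=> g0; rewrite (eq_facet_int (h := fun=> 0))// /facet_int Rintegral_cst.
  by rewrite mul0r mulr0.
exact: measurable_reference_simplex.
Qed.

Lemma facet_param_coord_continuous i : continuous (fun t => facet_param F t ord0 i).
Proof.
rewrite (_ : (fun t => _) = fun t : 'rV[R]_m => facet_vertex F 0 ord0 i +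
    \sum_k t ord0 k * facet_jacobian F k i); last first.
  by apply/funext => t; rewrite /facet_param !mxE.
move=> t; apply: continuousD; first exact: cst_continuous.
move: t; apply: continuous_sumr => k _ t.
by apply: continuousM; [exact: continuous_coord|exact: cst_continuous].
Qed.

Lemma peval_facet_param_continuous P : continuous (fun t => peval P (facet_param F t)).
Proof.
elim/(@poly_ind_ring R m): P => [c|i|P Q cP cQ|P Q cP cQ].
- rewrite (_ : (fun t => _) = cst c); first exact: cst_continuous.
  by apply/funext => t; rewrite pevalC.
- rewrite (_ : (fun t => _) = fun t => facet_param F t ord0 i).
    exact: facet_param_coord_continuous.
  by apply/funext => t; rewrite peval_var.
- rewrite (_ : (fun t => _) = (fun t => peval P (facet_param F t)) \+
      (fun t => peval Q (facet_param F t))); last first.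
    by apply/funext => t; rewrite pevalD.
  by move=> t; apply: continuousD; [exact: cP|exact: cQ].
- rewrite (_ : (fun t => _) = (fun t => peval P (facet_param F t)) \*
      (fun t => peval Q (facet_param F t))); last first.
    by apply/funext => t; rewrite pevalM.
  by move=> t; apply: continuousM; [exact: cP|exact: cQ].
Qed.

Lemma hull_bounded_set : bounded_set (hull F).
Proof.
have [K hK] := hull_bounded F.
exists `|K|; split; first exact: num_real.
move=> r Kr x Fx /=; rewrite rV_norm_le ?(le_trans _ (ltW Kr))//.
by apply/forallP => i; rewrite (le_trans (hK x Fx i))// (le_trans (ler_norm _))// ltW.
Qed.

Lemma peval_facet_bounded P : facet_bounded (peval P).
Proof.
have [K hK] := peval_bounded P hull_bounded_set.
apply: (@ess_bounded_pointwise _ _ _ _ _ _ K).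
  by apply: continuous_measurable_rV; exact: peval_facet_param_continuous.
by move=> t ht; apply: hK; exact: facet_param_hull.
Qed.

Hypothesis indF : affinely_independent F.

(** The surface element is positive by affine independence, so the pulled-back polynomial vanishes
    almost everywhere on the simplex, hence on its interior [U]. It vanishes at each [t] of the
    closed simplex too, because a move from [t] towards an interior point enters [U] at once. *)
Lemma facet_int_sqr_eq0 P :
  facet_int F (fun x => peval P x ^+ 2) = 0 -> forall x, hull F x -> peval P x = 0.
Proof.
move=> /eqP; rewrite mulf_eq0 gt_eqF/=; last first.
  by rewrite sqrtr_gt0 det_gram_gt0//; exact: facet_jacobian_free.
move=> /eqP int0 x /(hull_facet_param cF)[t ht <-] {x}.
pose g (t : 'rV[R]_m) := peval P (facet_param F t).
have cg : continuous g by exact: peval_facet_param_continuous.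
have bg := peval_facet_bounded P.
have g0 : {ae leb, forall t, simplex t -> g t = 0}.
  have : {ae leb, forall t, simplex t -> g t ^+ 2 = 0}.
    apply: Rintegral_eq0_ae int0; first exact: measurable_reference_simplex.
      apply: (@facet_bounded_integrable (fun x => peval P x ^+ 2)).
      rewrite /facet_bounded (_ : _ \o _ = (peval P \o facet_param F) \*
        (peval P \o facet_param F))//.
      exact: ess_boundedM.
    by apply: aeW => s _; rewrite sqr_ge0.
  by apply: filterS => s h /h/eqP; rewrite sqrf_eq0 => /eqP.
pose U := [set s : 'rV[R]_m | (forall i, 0 < s ord0 i) /\ \sum_i s ord0 i < 1].
have oU : open U.
  rewrite openE => s [s0 s1].
  have h1 : \forall y \near s, forall i, 0 < (y : 'rV[R]_m) ord0 i.
    apply: (@filter_forall _ _ (fun i (y : 'rV[R]_m) => 0 < y ord0 i) (nbhs s)) => i.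
    apply: (@cvgr_gt R _ (nbhs s) (nbhs_filter s) _ _ _ 0 (s0 i)).
    exact: continuous_coord.
  have h2 : \forall y \near s, \sum_i (y : 'rV[R]_m) ord0 i < 1.
    apply: (@cvgr_lt R _ (nbhs s) (nbhs_filter s) _ _ _ 1 s1).
    exact: continuous_sum_coord.
  by apply: filterS2 h1 h2.
have US : U `<=` simplex by move=> s [s0 s1]; split => [i|]; exact: ltW.
have gU := ae_eq0_open oU US cg g0.
(* Coordinates [1/(m+1)] are positive with sum [m/(m+1) < 1], so [t0] is interior. *)
pose t0 : 'rV[R]_m := const_mx (n%:R^-1).
have Ut s : 0 < s -> s <= 1 -> U (t + s *: (t0 - t)).
  move=> s0 s1; have [ht0 ht1] := ht; split=> [i|].
    rewrite !mxE mulrBr addrCA -[X in _ + (X - _)]mul1r -mulrBl ltr_pwDl//.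
      by rewrite mulr_gt0// invr_gt0 ltr0n.
    by rewrite mulr_ge0// subr_ge0.
  under eq_bigr do rewrite !mxE.
  rewrite big_split/= -mulr_sumr sumrB sumr_const card_ord.
  have : m%:R * n%:R^-1 < 1 :> R by rewrite ltr_pdivrMr ?ltr0n// mul1r ltr_nat.
  rewrite mulr_natl; move: (_ *+ m) (\sum_i _) ht1 => c a a1 c1.
  have : 0 <= (1 - s) * (1 - a) by rewrite mulr_ge0 ?subr_ge0.
  have : 0 < s * (1 - c) by rewrite mulr_gt0 ?subr_gt0.
  lra.
apply/eqP; apply: contrapT => /negP gt0.
have : \forall y \near t, g y != 0.
  have : nbhs t (g @^-1` (~` [set 0])).
    apply: open_nbhs_nbhs; split; last exact/eqP.
    by apply: open_comp; [move=> ? _; exact: cg|apply: closed_openC; exact: closed_eq].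
  by apply: filterS => y /eqP.
by move=> /(near_line (t0 - t))[s [s0 s1 /eqP]]; apply; apply: gU; exact: Ut.
Qed.

End FacetIntegral.

(** * The HDG forms *)

Section BrokenPolynomials.
Context {R : realType} {m : nat}.
Local Notation n := m.+1.
Local Notation E := 'rV[R]_n.
Local Notation poly := (mpoly.mpoly n R).
Local Notation leb := (lebesgue_rV R n).
Variables (Omega : set E) (M : mesh R n).
Local Notation cell := (cell M).
Local Notation facet := (facet M).
Hypothesis oOmega : open Omega.
Hypothesis bOmega : bounded_set Omega.
Hypothesis conf : conforming_mesh M Omega.
Implicit Types (u v w : cell -> poly) (q r : cell -> 'I_n -> poly).
Local Notation ebd := (ess_bounded leb Omega).

Let mOmega : measurable Omega. Proof. exact: open_measurable_rV. Qed.

Let Omega_fin : (leb Omega < +oo)%E. Proof. exact: bounded_lebesgue_fin. Qed.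

Let ebd_int f : ebd f -> leb.-integrable Omega (EFin \o f).
Proof. exact: ess_bounded_integrable. Qed.

Lemma cell_ok (T : cell) : nondegenerate (val T).
Proof. exact: (cell_nondegenerate conf (valP T)). Qed.

Lemma fun_of_cell v (T : cell) x : (hull (val T))° x -> fun_of v x = peval (v T) x.
Proof.
move=> Tx; rewrite /fun_of (bigD1 T)//= big1 ?addr0; last first.
  move=> T' T'T; rewrite indicE memNset ?mul0r// => T'x.
  case/eqP: T'T; apply: val_inj.
  exact: (cell_interiors_disjoint conf (valP T') (valP T) T'x Tx).
by rewrite indicE mem_set// mul1r.
Qed.

Lemma fun_of_notin v x : (forall T : cell, ~ (hull (val T))° x) -> fun_of v x = 0.
Proof. by move=> h; rewrite /fun_of big1// => T _; rewrite indicE memNset ?mul0r//. Qed.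

Lemma fun_of_lin (c : R) v w x :
  fun_of (fun T => c *: v T + w T) x = c * fun_of v x + fun_of w x.
Proof.
rewrite /fun_of mulr_sumr -big_split; apply: eq_bigr => T _ /=.
by rewrite pevalD pevalZ; ring.
Qed.

Lemma fun_ofB v w x : fun_of (fun T => v T - w T) x = fun_of v x - fun_of w x.
Proof.
rewrite /fun_of -sumrB; apply: eq_bigr => T _ /=.
by rewrite pevalB; ring.
Qed.

Lemma fun_of0 x : fun_of (fun _ : cell => 0) x = 0.
Proof. by rewrite /fun_of big1// => T _; rewrite peval0 mulr0. Qed.

Lemma fun_ofM v w x : fun_of v x * fun_of w x = fun_of (fun T => v T * w T) x.
Proof.
have [[T Tx]|h] := pselect (exists T : cell, (hull (val T))° x).
  by rewrite !(fun_of_cell _ Tx) pevalM.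
by rewrite !fun_of_notin ?mulr0// => T Tx; apply: h; exists T.
Qed.

Lemma measurable_interior (A : set E) : measurable A°.
Proof. by apply: open_measurable_rV; exact: open_interior. Qed.

Lemma measurable_peval D (P : poly) : measurable_fun D (peval P).
Proof. by apply: continuous_measurable_rV; exact: peval_continuous. Qed.

Lemma fun_of_measurable D v : measurable_fun D (fun_of v).
Proof.
apply: measurable_sum => T; apply: measurable_funM; last exact: measurable_peval.
by apply: measurable_indic; exact: measurable_interior.
Qed.

Lemma fun_of_bounded v : exists2 K : R, 0 <= K & forall x, Omega x -> `|fun_of v x| <= K.
Proof.
have /choice[K hK] : forall T : cell, exists K, forall x, Omega x -> `|peval (v T) x| <= K.
  by move=> T; exact: peval_bounded.
exists (\sum_T `|K T|) => [|x Ox]; first exact: sumr_ge0.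
apply: le_trans (ler_norm_sum _ _ _) _; apply: ler_sum => T _.
rewrite normrM -[leRHS]mul1r ler_pM//; last by rewrite (le_trans (hK _ _ Ox))// ler_norm.
by rewrite indicE; case: (_ \in _); rewrite ?normr1 ?normr0 ?ler01.
Qed.

Lemma fun_of_ebd v : ebd (fun_of v).
Proof.
have [K _ hK] := fun_of_bounded v.
by apply: ess_bounded_pointwise hK; exact: fun_of_measurable.
Qed.

Definition vbounded (f : E -> E) : Prop := forall i, ebd (fun x => f x ord0 i).

Lemma vec_of_bounded q : vbounded (vec_of q).
Proof.
move=> i; rewrite (_ : (fun x => _) = fun_of (fun T => q T i)); first exact: fun_of_ebd.
by apply/funext => x; rewrite mxE.
Qed.

Lemma vboundedZ (k : E -> R) (f : E -> E) : ebd k -> vbounded f ->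
  vbounded (fun x => k x *: f x).
Proof.
move=> bk bf i; rewrite (_ : (fun x => _) = fun x => k x * f x ord0 i).
  exact: ess_boundedM.
by apply/funext => x; rewrite mxE.
Qed.

Lemma dotv_ebd f g : vbounded f -> vbounded g -> ebd (fun x => dotv (f x) (g x)).
Proof.
move=> bf bg; apply: (@ess_bounded_sum _ _ _ _ _ _ _ _
  (fun i x => f x ord0 i * g x ord0 i)) => i _.
exact: ess_boundedM.
Qed.

Lemma innerv_lin (c : R) f f' g : vbounded f -> vbounded f' -> vbounded g ->
  innerv Omega (fun x => c *: f x + f' x) g = c * innerv Omega f g + innerv Omega f' g.
Proof.
move=> bf bf' bg; rewrite /innerv -RintegralZl ?ebd_int//; last exact: dotv_ebd.
rewrite -RintegralD//; last 2 first.
- by apply: ebd_int; apply: ess_boundedZ; exact: dotv_ebd.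
- by apply: ebd_int; exact: dotv_ebd.
by apply: eq_Rintegral => x _; rewrite dotvDl dotvZl.
Qed.

Lemma innervC (f g : E -> E) : innerv Omega f g = innerv Omega g f.
Proof. by apply: eq_Rintegral => x _; rewrite dotvC. Qed.

Lemma vec_of_lin (c : R) q r : vec_of (fun T i => c *: q T i + r T i) =
  fun x => c *: vec_of q x + vec_of r x.
Proof. by apply/funext => x; apply/rowP => i; rewrite !mxE fun_of_lin. Qed.

Lemma inner_lin (c : R) f f' g : leb.-integrable Omega (EFin \o (fun x => f x * g x)) ->
  leb.-integrable Omega (EFin \o (fun x => f' x * g x)) ->
  inner Omega (fun x => c * f x + f' x) g = c * inner Omega f g + inner Omega f' g.
Proof.
move=> bf bf'; rewrite /inner -RintegralZl// -RintegralD//; last first.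
  by have := @integrableZl _ _ _ leb _ mOmega c _ bf; apply: eq_integrable.
by apply: eq_Rintegral => x _; rewrite mulrDl mulrA.
Qed.

Lemma innerC (f g : E -> R) : inner Omega f g = inner Omega g f.
Proof. by apply: eq_Rintegral => x _; rewrite mulrC. Qed.

Lemma facet_card (F : facet) : #|val F| = n.
Proof. by case/andP: (valP F) => /eqP. Qed.

Lemma facet_affinely_independent (F : facet) : affinely_independent (val F).
Proof.
case/andP: (valP F) => _ /existsP[T /andP[TM FT]] w w0 wv i iF.
have ndT := cell_nondegenerate conf TM.
have sE (K : nmodType) (g : 'I_(nverts M) -> K) :
    \sum_(j in T) (if j \in val F then g j else 0) = \sum_(j in val F) g j.
  rewrite -big_mkcondr/=; apply: eq_bigl => j.
  by apply: andb_idl => /(fintype.subsetP FT).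
have := ndT.2 (fun j => if j \in val F then w j else 0); rewrite sE.
move=> /(_ w0) /= h; have := h _ i; rewrite iF; apply; last exact: (fintype.subsetP FT).
rewrite -[RHS]wv -[RHS]sE; apply: eq_bigr => j _.
by case: (j \in val F); rewrite ?scale0r.
Qed.

Lemma skeleton_int_lin (c : R) (g h : cell -> facet -> E -> R) :
  (forall (T : cell) (F : facet), val F \subset val T -> facet_bounded (val F) (g T F)) ->
  (forall (T : cell) (F : facet), val F \subset val T -> facet_bounded (val F) (h T F)) ->
  skeleton_int (fun T F x => c * g T F x + h T F x) = c * skeleton_int g + skeleton_int h.
Proof.
move=> bg bh; rewrite /skeleton_int mulr_sumr -big_split; apply: eq_bigr => T _ /=.
rewrite mulr_sumr -big_split; apply: eq_bigr => F FT /=.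
rewrite facet_intD; [|by apply: ess_boundedZ; exact: bg|exact: bh].
by rewrite facet_intZ//; exact: bg.
Qed.

Lemma eq_skeleton_int (g h : cell -> facet -> E -> R) :
  (forall (T : cell) (F : facet) x, val F \subset val T -> hull (val F) x ->
    g T F x = h T F x) ->
  skeleton_int g = skeleton_int h.
Proof.
move=> gh; apply: eq_bigr => T _; apply: eq_bigr => F FT.
by apply: eq_facet_int; [exact: facet_card|move=> x; exact: gh].
Qed.

End BrokenPolynomials.

Section Forms.
Context {R : realType} {m : nat}.
Local Notation n := m.+1.
Local Notation E := 'rV[R]_n.
Local Notation poly := (mpoly.mpoly n R).
Local Notation leb := (lebesgue_rV R n).
Variables (Omega : set E) (M : mesh R n).
Local Notation cell := (cell M).
Local Notation facet := (facet M).
Hypothesis oOmega : open Omega.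
Hypothesis bOmega : bounded_set Omega.
Hypothesis conf : conforming_mesh M Omega.
Variables (kappa : E -> R) (beta : E -> E) (bn : cell -> facet -> E -> R).
Hypothesis kinv_bounded : ess_bounded leb Omega (fun x => (kappa x)^-1).
Hypothesis beta_bounded : vbounded Omega beta.
Hypothesis bn_bounded : forall (T : cell) (F : facet), val F \subset val T ->
  facet_bounded (val F) (bn T F).
Implicit Types (u v w : cell -> poly) (q r : cell -> 'I_n -> poly) (uh vh : facet -> poly).

Let vec_bd q : vbounded Omega (vec_of q). Proof. exact: vec_of_bounded. Qed.

Lemma gradh_lin (c : R) v w : gradh (fun T => c *: v T + w T) =
  fun T i => c *: gradh v T i + gradh w T i.
Proof.
by apply/funext => T; apply/funext => i; rewrite /gradh mpoly.mderivD mpoly.mderivZ.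
Qed.

Lemma flux_integrand_bounded q v vh (T : cell) (F : facet) :
  facet_bounded (val F) (fun x => (peval (v T) x - peval (vh F) x) *
    dotv (\row_i peval (q T i) x) (outward_unit_normal (val T) (val F))).
Proof.
set nu := outward_unit_normal _ _.
have := @peval_facet_bounded R m M (val F) (facet_card F)
  ((v T - vh F) * \sum_i nu ord0 i *: q T i).
congr facet_bounded; apply/funext => x; rewrite pevalM pevalB peval_sum; congr (_ * _).
by apply: eq_bigr => i _; rewrite pevalZ mxE mulrC.
Qed.

Lemma formB_linl (c : R) q r v vh :
  Defs.formB Omega (fun T i => c *: q T i + r T i) v vh =
  c * Defs.formB Omega q v vh + Defs.formB Omega r v vh.
Proof.
rewrite /Defs.formB vec_of_lin innerv_lin//; try exact: vec_bd.
rewrite [X in _ - X = _](_ : _ = c * skeleton_int (fun (T : cell) (F : facet) x =>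
    (peval (v T) x - peval (vh F) x) * dotv (\row_i peval (q T i) x)
      (outward_unit_normal (val T) (val F))) +
  skeleton_int (fun (T : cell) (F : facet) x =>
    (peval (v T) x - peval (vh F) x) * dotv (\row_i peval (r T i) x)
      (outward_unit_normal (val T) (val F)))); first by ring.
rewrite -skeleton_int_lin; try by move=> T F _; exact: flux_integrand_bounded.
apply: eq_skeleton_int => T F x _ _.
rewrite (_ : \row_i peval (c *: q T i + r T i) x =
  c *: (\row_i peval (q T i) x) + \row_i peval (r T i) x); last first.
  by apply/rowP => i; rewrite !mxE pevalD pevalZ.
by rewrite dotvDl dotvZl; ring.
Qed.

Lemma formB_linr (c : R) q v w vh wh :
  Defs.formB Omega q (fun T => c *: v T + w T) (fun F => c *: vh F + wh F) =
  c * Defs.formB Omega q v vh + Defs.formB Omega q w wh.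
Proof.
rewrite /Defs.formB gradh_lin vec_of_lin innervC innerv_lin//; try exact: vec_bd.
rewrite [X in _ - X = _](_ : _ = c * skeleton_int (fun (T : cell) (F : facet) x =>
    (peval (v T) x - peval (vh F) x) * dotv (\row_i peval (q T i) x)
      (outward_unit_normal (val T) (val F))) +
  skeleton_int (fun (T : cell) (F : facet) x =>
    (peval (w T) x - peval (wh F) x) * dotv (\row_i peval (q T i) x)
      (outward_unit_normal (val T) (val F)))).
  by rewrite !(innervC Omega (vec_of q)); ring.
rewrite -skeleton_int_lin; try by move=> T F _; exact: flux_integrand_bounded.
apply: eq_skeleton_int => T F x _ _.
by rewrite !pevalD !pevalZ; ring.
Qed.

Definition upwind_flux u uh v vh (T : cell) (F : facet) (x : E) : R :=
  bn T F x * (if bn T F x < 0 then peval (uh F) x else peval (u T) x) *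
  (peval (v T) x - peval (vh F) x).

(** With [b = beta.n], the case distinction equals [(b - |b|)/2 uh + (b + |b|)/2 u], a combination
    of essentially bounded functions; this also gives measurability. *)
Lemma upwind_flux_bounded u uh v vh (T : cell) (F : facet) : val F \subset val T ->
  facet_bounded (val F) (upwind_flux u uh v vh T F).
Proof.
move=> FT; have bP P := @peval_facet_bounded R m M (val F) (facet_card F) P.
have := ess_boundedM (ess_boundedD
    (ess_boundedM (ess_boundedZ 2^-1 (ess_boundedB (bn_bounded FT)
       (ess_bounded_norm (bn_bounded FT)))) (bP (uh F)))
    (ess_boundedM (ess_boundedZ 2^-1 (ess_boundedD (bn_bounded FT)
       (ess_bounded_norm (bn_bounded FT)))) (bP (u T))))
  (ess_boundedB (bP (v T)) (bP (vh F))).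
congr (ess_bounded _ _ _); apply/funext => t /=.
rewrite /upwind_flux; set b := bn T F _.
by case: ltP => b0; [rewrite ltr0_norm|rewrite ger0_norm] => //; field.
Qed.

Lemma formAC_linl (c : R) u u' uh uh' v vh :
  formAC Omega beta bn (fun T => c *: u T + u' T) (fun F => c *: uh F + uh' F) v vh =
  c * formAC Omega beta bn u uh v vh + formAC Omega beta bn u' uh' v vh.
Proof.
rewrite /formAC (_ : (fun x => fun_of _ x *: beta x) =
  fun x => c *: (fun_of u x *: beta x) + fun_of u' x *: beta x); last first.
  by apply/funext => x; rewrite fun_of_lin scalerDl scalerA.
have bf w : ess_bounded leb Omega (fun_of w) by exact: fun_of_ebd.
rewrite innerv_lin//; try exact: vec_bd; try by apply: vboundedZ.
rewrite [X in _ + X = _](_ : _ = c * skeleton_int (upwind_flux u uh v vh) +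
  skeleton_int (upwind_flux u' uh' v vh)); first by rewrite /upwind_flux; ring.
rewrite -skeleton_int_lin; try by move=> T F; exact: upwind_flux_bounded.
apply: eq_skeleton_int => T F x _ _.
by rewrite /upwind_flux !pevalD !pevalZ; case: ifP => _; ring.
Qed.

Lemma formAC_linr (c : R) u uh v v' vh vh' :
  formAC Omega beta bn u uh (fun T => c *: v T + v' T) (fun F => c *: vh F + vh' F) =
  c * formAC Omega beta bn u uh v vh + formAC Omega beta bn u uh v' vh'.
Proof.
rewrite /formAC gradh_lin vec_of_lin innervC.
have bf w : ess_bounded leb Omega (fun_of w) by exact: fun_of_ebd.
rewrite innerv_lin//; try exact: vec_bd; try by apply: vboundedZ.
rewrite [X in _ + X = _](_ : _ = c * skeleton_int (upwind_flux u uh v vh) +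
  skeleton_int (upwind_flux u uh v' vh')).
  by rewrite !(innervC Omega (fun x => fun_of u x *: beta x)) /upwind_flux; ring.
rewrite -skeleton_int_lin; try by move=> T F; exact: upwind_flux_bounded.
apply: eq_skeleton_int => T F x _ _.
by rewrite /upwind_flux !pevalD !pevalZ; ring.
Qed.

Definition hdg_form q u uh r v vh : R :=
  formAD Omega kappa q u uh r v vh + formAC Omega beta bn u uh v vh.

Lemma hdg_form_linl (c : R) q q' u u' uh uh' r v vh :
  hdg_form (fun T i => c *: q T i + q' T i) (fun T => c *: u T + u' T)
    (fun F => c *: uh F + uh' F) r v vh =
  c * hdg_form q u uh r v vh + hdg_form q' u' uh' r v vh.
Proof.
rewrite /hdg_form /formAD formAC_linl formB_linr formB_linl vec_of_lin.
rewrite (_ : (fun x => (kappa x)^-1 *: _) =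
  fun x => c *: ((kappa x)^-1 *: vec_of q x) + (kappa x)^-1 *: vec_of q' x); last first.
  by apply/funext => x; rewrite scalerDr !scalerA mulrC.
rewrite innerv_lin//; try exact: vec_bd; try by apply: vboundedZ => //; exact: vec_bd.
by ring.
Qed.

Lemma hdg_form_linr (c : R) q u uh r r' v v' vh vh' :
  hdg_form q u uh (fun T i => c *: r T i + r' T i) (fun T => c *: v T + v' T)
    (fun F => c *: vh F + vh' F) =
  c * hdg_form q u uh r v vh + hdg_form q u uh r' v' vh'.
Proof.
rewrite /hdg_form /formAD formAC_linr formB_linr formB_linl vec_of_lin.
rewrite innervC innerv_lin//; try exact: vec_bd; try by apply: vboundedZ => //; exact: vec_bd.
by rewrite !(innervC Omega (fun x => (kappa x)^-1 *: vec_of q x)); ring.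
Qed.

(** The polynomial that represents a facet function is determined only on the facet, and coordinates
    reproduce a trace only up to its values there; the form has to be blind to the choice. *)
Lemma hdg_form_eqr q u uh r v vh vh' :
  (forall (F : facet) x, hull (val F) x -> peval (vh F) x = peval (vh' F) x) ->
  hdg_form q u uh r v vh = hdg_form q u uh r v vh'.
Proof.
move=> e; rewrite /hdg_form /formAD /formAC /Defs.formB; congr (_ - (_ - _) + (_ + _)).
  by apply: eq_skeleton_int => T F x _ Fx; rewrite e.
by apply: eq_skeleton_int => T F x _ Fx; rewrite e.
Qed.

End Forms.

(** * Energy identity *)

(** Used for the cells around one facet, whose number is not bounded beforehand. With two indices
    the values cancel; with three or more, pairwise opposition forces each value to be its own
    opposite. *)
Lemma sum_antisymmetric (R : realType) (I : finType) (P : pred I) (f : I -> R) (i0 i1 : I) :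
  (forall i j, P i -> P j -> i != j -> f i = - f j) -> P i0 -> P i1 -> i0 != i1 ->
  \sum_(i | P i) f i = 0.
Proof.
move=> fN P0 P1 n01.
have [[i2 [P2 n20 n21]]|h] := pselect (exists i2, [/\ P i2, i2 != i0 & i2 != i1]).
  have f0 : f i0 = 0.
    have := fN _ _ P0 P1 n01; have := fN _ _ P2 P1 n21; have := fN _ _ P2 P0 n20; lra.
  rewrite big1// => i Pi; have [->//|ni] := eqVneq i i0.
  by rewrite (fN _ _ Pi P0 ni) f0 oppr0.
rewrite (bigD1 i0)//= (bigD1 i1) ?P1 1?eq_sym//= big1 => [|i].
  by rewrite addr0 (fN _ _ P0 P1 n01) addNr.
by move=> /andP[/andP[Pi i_0] i_1]; case: h; exists i.
Qed.

Section Energy.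
Context {R : realType} {m : nat}.
Local Notation n := m.+1.
Local Notation E := 'rV[R]_n.
Local Notation poly := (mpoly.mpoly n R).
Local Notation leb := (lebesgue_rV R n).
Variables (Omega : set E) (M : mesh R n).
Local Notation cell := (cell M).
Local Notation facet := (facet M).
Hypothesis oOmega : open Omega.
Hypothesis bOmega : bounded_set Omega.
Hypothesis conf : conforming_mesh M Omega.
Implicit Types (u v w : cell -> poly) (q r : cell -> 'I_n -> poly) (uh vh : facet -> poly).

Let mOmega : measurable Omega. Proof. exact: open_measurable_rV. Qed.

Let Omega_fin : (leb Omega < +oo)%E. Proof. exact: bounded_lebesgue_fin. Qed.

Lemma peval_ebd (P : poly) : ess_bounded leb Omega (peval P).
Proof.
have [K hK] := peval_bounded P bOmega.
by apply: ess_bounded_pointwise hK; exact: measurable_peval.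
Qed.

(** A cell is only known to lie in the closure of [Omega]. Its centroid is a limit of points of
    [Omega], and the open simplex is a neighbourhood of the centroid; so almost everywhere
    information on [Omega] reaches every cell. *)
Lemma cell_meets_domain (T : cell) : (Omega `&` open_simplex (val T)) !=set0.
Proof.
have ndT := cell_ok conf T.
have := cell_sub_closure conf (valP T) (interior_subset (open_simplex_sub ndT (centroid_open_simplex ndT))).
apply; apply: open_nbhs_nbhs; split; first exact: open_open_simplex.
exact: centroid_open_simplex.
Qed.

Lemma fun_of_ae_eq0 v : {ae leb, forall x, Omega x -> fun_of v x = 0} -> forall T, v T = 0.
Proof.
move=> h T; pose U := Omega `&` open_simplex (val T).
have oU : open U by apply: openI => //; exact: open_open_simplex.
apply: (peval_open_eq0 oU (cell_meets_domain T)).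
apply: (ae_eq0_open (D := U) oU) => //; first exact: peval_continuous.
apply: filterS h => x h [Ox Tx]; rewrite -h//; apply/esym/(fun_of_cell conf).
exact: (open_simplex_sub (cell_ok conf T)).
Qed.

Lemma inner_sqr_eq0 v : inner Omega (fun_of v) (fun_of v) = 0 -> forall T, v T = 0.
Proof.
move=> int0; apply: fun_of_ae_eq0.
have : {ae leb, forall x, Omega x -> fun_of v x * fun_of v x = 0}.
  apply: Rintegral_eq0_ae int0 => //.
    apply: ess_bounded_integrable => //; apply: ess_boundedM; exact: fun_of_ebd.
  by apply: aeW => x _; rewrite -expr2 sqr_ge0.
by apply: filterS => x h /h/eqP; rewrite mulf_eq0 orbb => /eqP.
Qed.

Variable kappa : E -> R.
Hypothesis kinv_bounded : ess_bounded leb Omega (fun x => (kappa x)^-1).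
Hypothesis kappa_gt0 : {ae leb, forall x, Omega x -> 0 < kappa x}.

Let flux_norm_bounded q :
  ess_bounded leb Omega (fun x => dotv ((kappa x)^-1 *: vec_of q x) (vec_of q x)).
Proof.
by apply: dotv_ebd; [apply: vboundedZ => //|]; exact: vec_of_bounded.
Qed.

Let flux_norm_ae_ge0 q :
  {ae leb, forall x, Omega x -> 0 <= dotv ((kappa x)^-1 *: vec_of q x) (vec_of q x)}.
Proof.
apply: filterS kappa_gt0 => x h /h k0.
by rewrite dotvZl mulr_ge0 ?dotv_ge0// invr_ge0 ltW.
Qed.

Lemma flux_norm_ge0 q : 0 <= innerv Omega (fun x => (kappa x)^-1 *: vec_of q x) (vec_of q).
Proof.
apply: Rintegral_ae_ge0 => //; exact: (flux_norm_bounded q).1.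
Qed.

Lemma flux_norm_eq0 q :
  innerv Omega (fun x => (kappa x)^-1 *: vec_of q x) (vec_of q) = 0 ->
  forall T i, q T i = 0.
Proof.
move=> int0 T i; apply: (@fun_of_ae_eq0 (fun T => q T i)).
have : {ae leb, forall x, Omega x -> dotv ((kappa x)^-1 *: vec_of q x) (vec_of q x) = 0}.
  by apply: Rintegral_eq0_ae int0 => //; exact: ess_bounded_integrable.
apply: filterS2 kappa_gt0 => x k0 h Ox; have /eqP := h Ox.
rewrite dotvZl mulf_eq0 invr_eq0 gt_eqF ?k0//= => /eqP/dotv_eq0/rowP/(_ i).
by rewrite !mxE.
Qed.

Variables (beta : E -> E) (bn : cell -> facet -> E -> R).
Hypothesis beta_bounded : vbounded Omega beta.
Hypothesis bn_trace : normal_trace Omega beta bn.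
Hypothesis bn_continuous : continuous_normal_components bn.

Lemma normal_trace_bounded (T : cell) (F : facet) : val F \subset val T ->
  facet_bounded (val F) (bn T F).
Proof. by move=> FT; apply: Linfty_facet_bounded; exact: (bn_trace T).1. Qed.

(** On each cell [2 u beta.grad u = beta.grad (u^2)]; Green's formula in [normal_trace], which
    incorporates [div beta = 0], is applied to the smooth function [u_T^2]. *)
Lemma convection_by_parts u :
  innerv Omega (fun x => fun_of u x *: beta x) (vec_of (gradh u)) =
  2^-1 * skeleton_int (fun (T : cell) (F : facet) x => bn T F x * peval (u T) x ^+ 2).
Proof.
pose g (T : cell) x := dotv (beta x) (grad (peval (u T * u T)) x).
have gE T x : g T x = 2 * (peval (u T) x * \sum_i beta x ord0 i * peval (gradh u T i) x).
  rewrite /g grad_peval /dotv !mulr_sumr; apply: eq_bigr => i _.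
  by rewrite mxE mpoly.mderivM pevalD !pevalM /gradh; ring.
have bg T : ess_bounded leb Omega (g T).
  apply: dotv_ebd => // i; rewrite (_ : (fun x => _) = peval (mpoly.mderiv i (u T * u T))).
    exact: peval_ebd.
  by apply/funext => x; rewrite grad_peval mxE.
have b1g T : ess_bounded leb Omega (g T \_ (hull (val T))°).
  rewrite (_ : g T \_ _ = \1_((hull (val T))°) \* g T).
    apply: ess_boundedM => //; apply: (@ess_bounded_pointwise _ _ _ _ _ _ 1).
      by apply: measurable_indic; exact: measurable_interior.
    by move=> x _; rewrite indicE; case: (_ \in _); rewrite ?normr1 ?normr0 ?ler01.
  by apply/funext => x; rewrite patchE/= indicE; case: (_ \in _); rewrite ?mul1r ?mul0r.
rewrite /innerv (_ : \int[leb]_(x in Omega) _ =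
    \int[leb]_(x in Omega) (2^-1 * \sum_T (g T \_ (hull (val T))°) x)); last first.
  apply: eq_Rintegral => x _.
  have [[T Tx]|h] := pselect (exists T : cell, (hull (val T))° x); last first.
    rewrite fun_of_notin ?scale0r ?dotv0l; last by move=> T Tx; apply: h; exists T.
    rewrite big1 ?mulr0// => T _; rewrite patchE memNset// => Tx.
    by apply: h; exists T.
  rewrite (bigD1 T)//= big1 ?addr0; last first.
    move=> T' T'T; rewrite patchE memNset// => T'x; case/eqP: T'T; apply: val_inj.
    exact: (cell_interiors_disjoint conf (valP T') (valP T) T'x Tx).
  rewrite patchE mem_set// gE mulKf// (fun_of_cell conf _ Tx) dotvZl; congr (_ * _).
  by apply: eq_bigr => i _; rewrite mxE (fun_of_cell conf _ Tx).
have bsum : ess_bounded leb Omega (fun x => \sum_T (g T \_ (hull (val T))°) x).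
  by apply: (@ess_bounded_sum _ _ _ _ _ _ _ _ (fun (T : cell) => g T \_ (hull (val T))°)).
rewrite RintegralZl//; last exact: ess_bounded_integrable.
rewrite Rintegral_sum//; last by move=> T _; exact: ess_bounded_integrable.
congr (_ * _); apply: eq_bigr => T _; rewrite -Rintegral_mkcondr (bn_trace T).2.
  apply: eq_bigr => F FT; apply: eq_facet_int; first exact: facet_card.
  by move=> x _; rewrite pevalM expr2.
exact: smooth_peval.
Qed.

(** On interior facets [beta.n] changes sign from one cell to the next while [uh] is single valued;
    on boundary facets [uh] is zero. *)
Lemma facet_flux_cancel uh :
  (forall F : facet, hull (val F) `<=` boundary Omega ->
    forall x, hull (val F) x -> peval (uh F) x = 0) ->
  skeleton_int (fun (T : cell) (F : facet) x => bn T F x * peval (uh F) x ^+ 2) = 0.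
Proof.
move=> uh0; rewrite /skeleton_int (exchange_big_dep xpredT)//=.
rewrite big1// => F _.
have [Fb|Fb] := pselect (hull (val F) `<=` boundary Omega).
  rewrite big1// => T FT; apply: facet_int0; first exact: facet_card.
  by move=> x Fx; rewrite (uh0 F Fb x Fx) expr0n mulr0.
have [/eqP cF /existsP[T0 /andP[T0M FT0]]] := andP (valP F).
have ndT0 := cell_nondegenerate conf T0M.
have [a aT0 FE] := facet_setD1 ndT0.1 cF FT0.
rewrite FE in Fb; have [T1 [T1M T10 FT1]] := facet_neighbour oOmega conf T0M aT0 Fb.
rewrite -FE in FT1.
apply: (@sum_antisymmetric _ _ _ _ (Sub T0 T0M : cell) (Sub T1 T1M : cell)).
- move=> T T' FT FT' TT'.
  have bP : facet_bounded (val F) (fun x => peval (uh F) x ^+ 2).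
    rewrite (_ : (fun x => _) = peval (uh F * uh F)).
      by apply: peval_facet_bounded; exact: facet_card.
    by apply/funext => x; rewrite pevalM expr2.
  have bT := normal_trace_bounded FT; have bT' := normal_trace_bounded FT'.
  rewrite -mulN1r -facet_intZ; last exact: ess_boundedM.
  apply: ae_eq_facet_int; first exact: ess_boundedM.
    by apply: ess_boundedZ; exact: ess_boundedM.
  rewrite /ae_facet; have := bn_continuous TT' FT FT'; rewrite /ae_facet.
  apply: filterS => t h /h ->.
  by ring.
- by [].
- by [].
- by rewrite -val_eqE/= eq_sym.
Qed.

(* The upwind fluxes contribute [1/2 |beta.n| (u - uh)^2] on each facet. *)
Lemma hdg_energy q u uh :
  (forall F : facet, hull (val F) `<=` boundary Omega ->
    forall x, hull (val F) x -> peval (uh F) x = 0) ->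
  innerv Omega (fun x => (kappa x)^-1 *: vec_of q x) (vec_of q) <=
  hdg_form Omega kappa beta bn q u uh q u uh.
Proof.
move=> uh0; rewrite /hdg_form /formAD addrK lerDl /formAC convection_by_parts.
have bF := normal_trace_bounded.
have bsq (P : poly) (T : cell) (F : facet) : val F \subset val T ->
    facet_bounded (val F) (fun x => bn T F x * peval P x ^+ 2).
  move=> FT; rewrite (_ : (fun x => _) = bn T F \* peval (P * P)).
    by apply: ess_boundedM; [exact: bF|apply: peval_facet_bounded; exact: facet_card].
  by apply/funext => x /=; rewrite pevalM expr2.
pose S (P : cell -> facet -> poly) :=
  skeleton_int (fun (T : cell) (F : facet) x => bn T F x * peval (P T F) x ^+ 2).
(* The vanishing sum of the [bn uh^2] is inserted with weight [1/2]: it supplies the term in [uh^2]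
   that completes the square on each facet. *)
suff : 0 <= - 2^-1 * S (fun T _ => u T) +
    (2^-1 * S (fun _ F => uh F) + skeleton_int (upwind_flux bn u uh u uh)).
  by rewrite [S (fun _ F => uh F)]facet_flux_cancel// mulr0 add0r mulNr.
rewrite /S -skeleton_int_lin; last 2 first.
- by move=> T F; exact: bsq.
- by move=> T F; exact: (upwind_flux_bounded bF).
rewrite -skeleton_int_lin; last 2 first.
- by move=> T F; exact: bsq.
- move=> T F FT; apply: ess_boundedD; last exact: (upwind_flux_bounded bF).
  by apply: ess_boundedZ; exact: bsq.
apply: sumr_ge0 => T _; apply: sumr_ge0 => F FT; apply: facet_int_ge0.
  exact: facet_card.
move=> x _.
rewrite (_ : _ + _ = 2^-1 * `|bn T F x| * (peval (u T) x - peval (uh F) x) ^+ 2).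
  by rewrite mulr_ge0 ?sqr_ge0// mulr_ge0// invr_ge0.
rewrite /upwind_flux; case: ltP => b0; [rewrite ltr0_norm|rewrite ger0_norm] => //; by field.
Qed.

End Energy.

(** * Injectivity of the discrete gradient *)

Section TraceInjectivity.
Context {R : realType} {m : nat}.
Local Notation n := m.+1.
Local Notation E := 'rV[R]_n.
Local Notation poly := (mpoly.mpoly n R).
Local Notation leb := (lebesgue_rV R n).
Variables (Omega : set E) (M : mesh R n).
Local Notation cell := (cell M).
Local Notation facet := (facet M).
Hypothesis oOmega : open Omega.
Hypothesis bOmega : bounded_set Omega.
Hypothesis conf : conforming_mesh M Omega.
Variables (p : nat) (u : cell -> poly) (uh : facet -> poly).
Hypothesis up : Vh p u.
Hypothesis uhp : Mh0 Omega p uh.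
Hypothesis B0 : forall r, Sigmah p r -> Defs.formB Omega r u uh = 0.

Let mOmega : measurable Omega. Proof. exact: open_measurable_rV. Qed.

Let Omega_fin : (leb Omega < +oo)%E. Proof. exact: bounded_lebesgue_fin. Qed.

(** [Sigmah] imposes no continuity between cells, so the equation can be tested on one cell at a
    time. *)
Definition supported_on (T : cell) (r : 'I_n -> poly) : cell -> 'I_n -> poly :=
  fun T' i => if T' == T then r i else 0.

Lemma Sigmah_supported (T : cell) (a : 'I_n -> poly) (b : poly) :
  (forall i, deg_le p (a i)) -> deg_le p b ->
  Sigmah p (supported_on T (fun i => a i + mvar i * b)).
Proof.
move=> ap bp T'; rewrite /supported_on; case: eqP => _; last first.
  exists (fun=> 0), 0; split => [i||i x]; rewrite ?deg_le0//.
  by rewrite !peval0 mulr0 addr0.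
by exists a, b; split => // i x; rewrite pevalD pevalM peval_var.
Qed.

Lemma skeleton_supported (T : cell) r :
  skeleton_int (fun (T' : cell) (F : facet) x =>
     (peval (u T') x - peval (uh F) x) *
     dotv (\row_i peval (supported_on T r T' i) x) (outward_unit_normal (val T') (val F))) =
  \sum_(F : facet | val F \subset val T) facet_int (val F) (fun x =>
     (peval (u T) x - peval (uh F) x) *
     dotv (\row_i peval (r i) x) (outward_unit_normal (val T) (val F))).
Proof.
rewrite /skeleton_int (bigD1 T)//= [X in _ + X]big1 ?addr0.
  by apply: eq_bigr => F _; rewrite /supported_on eqxx.
move=> T' T'T; apply: big1 => F FT; apply: facet_int0; first exact: facet_card.
move=> x _; rewrite /supported_on (negbTE T'T) (_ : \row__ _ = 0) ?dotv0l ?mulr0//.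
by apply/rowP => i; rewrite !mxE peval0.
Qed.

Let dir (T : cell) (j : 'I_(nverts M)) : poly :=
  \sum_i vertex j ord0 i *: mpoly.mderiv i (u T).

Let lamdir (T : cell) j : poly := bary_poly (val T) j * dir T j.

(** The directional derivative has degree at most [p - 1], which leaves room for the barycentric
    factor. For [p = 0] the truncated predecessor would break the count, but the derivative is then
    0. *)
Let deg_lamdir T j : deg_le p (lamdir T j).
Proof.
rewrite /lamdir; have [p0|p0] := posnP p.
  rewrite /dir big1 ?mulr0 ?deg_le0// => i _.
  by rewrite mderiv_deg0 ?scaler0// -p0; exact: up.
rewrite -(prednK p0) -add1n; apply: deg_leM; first exact: deg_le_bary.
by apply: deg_le_sum => i _; apply: deg_leZ; apply: deg_le_mderiv; exact: up.
Qed.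

Let bubble (T : cell) (i : 'I_n) : poly :=
  \sum_(j in val T) vertex j ord0 i *: lamdir T j +
  mvar i * (- \sum_(j in val T) lamdir T j).

Let bubbleE (T : cell) x : \row_i peval (bubble T i) x =
  \sum_(j in val T) (- peval (lamdir T j) x) *: (x - vertex j).
Proof.
apply/rowP => i; rewrite mxE pevalD pevalM peval_var pevalN !peval_sum summxE.
rewrite mulrN mulr_sumr -sumrB; apply: eq_bigr => j _.
by rewrite pevalZ !mxE; ring.
Qed.

(** On the facet opposite to [a], the summand of [a] vanishes with its barycentric coordinate; every
    other [a_j] is a vertex of the facet, so [x - a_j] is tangent. *)
Let bubble_normal (T : cell) (F : facet) x : val F \subset val T -> hull (val F) x ->
  dotv (\row_i peval (bubble T i) x) (outward_unit_normal (val T) (val F)) = 0.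
Proof.
move=> FT Fx; have ndT := cell_ok conf T.
have [a aT FE] := facet_setD1 ndT.1 (facet_card F) FT.
rewrite bubbleE dotv_suml big1// => j jT; rewrite dotvZl.
have [->|ja] := eqVneq j a.
  rewrite /lamdir pevalM peval_bary; move: Fx => /(hull_face ndT _ FT)[_ ->]//.
    by rewrite mul0r oppr0 mul0r.
  by rewrite FE !inE eqxx.
rewrite FE (normal_facet_tangent ndT aT) ?mulr0//; first by rewrite !inE ja.
by rewrite -FE.
Qed.

Let dirE (T : cell) j x : peval (dir T j) x =
  dotv (vertex j) (\row_i peval (mpoly.mderiv i (u T)) x).
Proof. by rewrite peval_sum; apply: eq_bigr => i _; rewrite pevalZ mxE. Qed.

(* The barycentric mean of the [dir T j] at [x] is the derivative of [u] in the
   direction [x], so this is a variance. *)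
Let bubble_grad (T : cell) x :
  let D := dotv x (\row_i peval (mpoly.mderiv i (u T)) x) in
  dotv (\row_i peval (bubble T i) x) (\row_i peval (mpoly.mderiv i (u T)) x) =
  \sum_(j in val T) bary (val T) j x * (peval (dir T j) x - D) ^+ 2.
Proof.
set g := \row_i _; move=> D; have ndT := cell_ok conf T.
have xg : dotv x g = D by [].
have DE : D = \sum_(j in val T) bary (val T) j x * peval (dir T j) x.
  rewrite /D -{1}(bary_comb ndT x) dotv_suml; apply: eq_bigr => j _.
  by rewrite dotvZl dirE.
(* The bracket is 0 because [D] is the mean of the [dir T j]; with it the identity holds term by
   term. *)
transitivity (\sum_(j in val T) bary (val T) j x * (peval (dir T j) x - D) ^+ 2
    + (D * \sum_(j in val T) bary (val T) j x * peval (dir T j) x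
       - D * D * \sum_(j in val T) bary (val T) j x)); last first.
  by rewrite bary_sum// -DE mulr1 subrr addr0.
move: D xg {DE} => D xg.
rewrite bubbleE dotv_suml !mulr_sumr -sumrB -big_split; apply: eq_bigr => j _.
rewrite dotvZl dotvBl -dirE xg /lamdir pevalM peval_bary /=; ring.
Qed.

Lemma gradient_eq0 T i : mpoly.mderiv i (u T) = 0.
Proof.
have ndT := cell_ok conf T.
have rS : Sigmah p (supported_on T (bubble T)).
  apply: Sigmah_supported => [j|]; last by apply: deg_leN; exact: deg_le_sum.
  by apply: deg_le_sum => k _; exact: deg_leZ.
have := B0 rS; rewrite /Defs.formB skeleton_supported [X in _ - X]big1 ?subr0; last first.
  move=> F FT; apply: facet_int0; first exact: facet_card.
  by move=> x Fx; rewrite bubble_normal ?mulr0.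
pose Q : poly := \sum_i bubble T i * mpoly.mderiv i (u T).
have QE x : peval Q x = dotv (\row_i peval (bubble T i) x)
    (\row_i peval (mpoly.mderiv i (u T)) x).
  by rewrite /Q peval_sum; apply: eq_bigr => k _; rewrite pevalM !mxE.
have vE x : dotv (vec_of (supported_on T (bubble T)) x) (vec_of (gradh u) x) =
    fun_of (fun T' => if T' == T then Q else 0) x.
  transitivity (\sum_i fun_of (fun T' => supported_on T (bubble T) T' i * gradh u T' i) x).
    by apply: eq_bigr => k _; rewrite !mxE (fun_ofM conf).
  rewrite /fun_of exchange_big/=; apply: eq_bigr => T' _.
  rewrite -mulr_sumr -peval_sum; congr (_ * peval _ _); rewrite /supported_on.
  case: eqP => [->//|_]; by rewrite big1// => k _; rewrite mul0r.
rewrite /innerv => int0.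
have ae0 : {ae leb, forall x, Omega x -> fun_of (fun T' => if T' == T then Q else 0) x = 0}.
  apply: Rintegral_eq0_ae => //.
  - by apply: ess_bounded_integrable => //; exact: fun_of_ebd.
  - apply: aeW => x _; have [Tx|Tx] := pselect ((hull (val T))° x).
      rewrite (fun_of_cell conf _ Tx) eqxx QE bubble_grad; apply: sumr_ge0 => j jT.
      by rewrite mulr_ge0 ?sqr_ge0//; exact: (hullP ndT x).1 (interior_subset Tx) j jT.
    rewrite /fun_of (bigD1 T)//= big1 ?addr0; last first.
      by move=> T' /negbTE ->; rewrite peval0 mulr0.
    by rewrite indicE memNset// mul0r.
  - by rewrite -int0; apply: eq_Rintegral => x _; rewrite vE.
have Q0 : Q = 0.
  by have := fun_of_ae_eq0 oOmega conf ae0 T; rewrite eqxx.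
have oU : open (Omega `&` open_simplex (val T)).
  by apply: openI => //; exact: open_open_simplex.
apply: (peval_open_eq0 oU (cell_meets_domain conf T)) => x [Ox Tx].
have := QE x; rewrite Q0 peval0 bubble_grad => /esym/eqP.
set g := \row_k _; set D := dotv x g.
rewrite psumr_eq0; last by move=> j jT; rewrite mulr_ge0 ?sqr_ge0// ltW// Tx.
move=> /allP h.
(* Zero variance at an interior point makes [a_j.g] independent of [j], hence [y.g] independent of
   [y]; [y = 0] shows that the common value is 0 and [y = g] that [g = 0]. *)
have hj j : j \in val T -> dotv (vertex j) g = D.
  move=> jT; have := h j (mem_index_enum _); rewrite jT/= mulf_eq0 gt_eqF ?Tx//=.
  by rewrite sqrf_eq0 subr_eq0 dirE => /eqP.
have hy y : dotv y g = D.
  rewrite -{1}(bary_comb ndT y) dotv_suml.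
  under eq_bigr => j jT do rewrite dotvZl hj//.
  by rewrite -mulr_suml bary_sum// mul1r.
have D0 : D = 0 by rewrite -(hy 0) dotv0l.
have /dotv_eq0/rowP/(_ i) : dotv g g = 0 by rewrite hy.
by rewrite !mxE.
Qed.

Lemma trace_eq_primal (T : cell) (F : facet) x : val F \subset val T -> hull (val F) x ->
  peval (u T) x = peval (uh F) x.
Proof.
move=> FT Fx; have ndT := cell_ok conf T.
have [a aT FE] := facet_setD1 ndT.1 (facet_card F) FT.
(* Testing with [P (x - a)], where [P] is the jump itself extended to the cell, leaves [h] times the
   integral of [P^2] over [F]: the volume term vanishes with the gradient, and [a] is a vertex of
   all other facets of [T], where [x - a] is tangent. *)
pose P := u T - uh F.
have Pp : deg_le p P by apply: deg_leB; [exact: up|exact: uhp.1].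
pose r i : poly := - vertex a ord0 i *: P + mvar i * P.
have rS : Sigmah p (supported_on T r).
  by apply: Sigmah_supported => // i; exact: deg_leZ.
have rE y : \row_i peval (r i) y = peval P y *: (y - vertex a).
  by apply/rowP => i; rewrite !mxE pevalD pevalM pevalZ peval_var; ring.
have := B0 rS; rewrite /Defs.formB skeleton_supported.
have -> : vec_of (gradh u) = fun=> 0.
  apply/funext => y; apply/rowP => i; rewrite !mxE /gradh.
  rewrite (_ : (fun T' => _) = fun=> 0) ?fun_of0//.
  by apply/funext => T'; exact: gradient_eq0.
rewrite innervC /innerv; under eq_Rintegral do rewrite dotv0l.
rewrite Rintegral_cst// mul0r sub0r => /eqP; rewrite oppr_eq0 => /eqP.
have [h h0] := normal_facet_opposite ndT aT; rewrite -FE => hF.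
have {}hF y : hull (val F) y ->
  dotv (y - vertex a) (outward_unit_normal (sval T) (sval F)) = h by exact: hF.
rewrite (bigD1 F)//= [X in _ + X]big1 ?addr0; last first.
  move=> F' /andP[F'T F'F]; apply: facet_int0; first exact: facet_card.
  move=> y F'y; have [b bT F'E] := facet_setD1 ndT.1 (facet_card F') F'T.
  have ab : a != b.
    by apply: contraNneq F'F => ab; apply/eqP/val_inj; rewrite F'E FE ab.
  rewrite rE dotvZl F'E (normal_facet_tangent ndT bT) ?mulr0//.
    by rewrite !inE ab.
  by rewrite -F'E.
rewrite (@eq_facet_int _ _ _ _ (facet_card F) _ (fun y => h * peval (P * P) y)); last first.
  by move=> y Fy; rewrite rE dotvZl hF// pevalM pevalB; ring.
rewrite (@facet_intZ _ _ _ _ h (peval (P * P))); last by apply: peval_facet_bounded; exact: facet_card.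
move=> /eqP; rewrite mulf_eq0 gt_eqF//= => /eqP int0.
have /(_ x Fx)/eqP : forall y, hull (val F) y -> peval P y = 0.
  apply: facet_int_sqr_eq0; [exact: facet_card|exact: (facet_affinely_independent conf)|].
  by rewrite -[RHS]int0; apply: eq_facet_int => [|y _]; [exact: facet_card|rewrite pevalM expr2].
by rewrite pevalB subr_eq0 => /eqP.
Qed.

Lemma primal_eq0 T : u T = 0.
Proof.
pose c T' := mpoly.mcoeff mpoly.mnm0 (u T').
have uc T' : u T' = mpoly.mpolyC n (c T').
  by apply: mderiv_eq0_const => i; exact: gradient_eq0.
pose S : {set {set 'I_(nverts M)}} := [set val T' | T' : cell & u T' != 0]%SET.
apply/eqP; apply: contrapT => /negP uT0.
apply: (@closed_family_empty R m M Omega conf S _ _ (val T)).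
- by apply/fintype.subsetP => _ /imsetP[T' _ ->]; exact: valP.
- move=> _ a /imsetP[T' + ->] aT'; rewrite inE => uT'0.
  have ndT' := cell_ok conf T'.
  have FT' : val T' :\ a \subset val T' by exact: subD1set.
  have isF : is_facet (val T' :\ a).
    rewrite /is_facet (card_facet ndT'.1 aT') eqxx/=.
    by apply/existsP; exists (val T'); rewrite (valP T').
  pose F : facet := Sub (val T' :\ a) isF.
  have F0 : val F != finset.set0 by rewrite -card_gt0 facet_card.
  (* [u] is constant on each cell, so its value can be carried across the facet at the single point
     given by the centroid. *)
  have cF := centroid_hull F0.
  have c0 : c T' != 0.
    by apply: contra uT'0 => /eqP c0; rewrite uc c0 mpoly.mpolyC0.
  have Fb : ~ (hull (val T' :\ a) `<=` boundary Omega).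
    move=> Fb; have := uhp.2 F Fb _ cF; rewrite -(@trace_eq_primal T' F _ FT' cF) uc pevalC.
    by move/eqP; exact/negP.
  have [T1 [T1M T1T' FT1]] := facet_neighbour oOmega conf (valP T') aT' Fb.
  exists T1; split => //; apply/imsetP; exists (Sub T1 T1M : cell); rewrite ?inE//.
  apply: contra c0 => /eqP u10.
  have := @trace_eq_primal (Sub T1 T1M) F _ FT1 cF.
  by rewrite u10 peval0 -(@trace_eq_primal T' F _ FT' cF) uc pevalC => <-.
- by apply/imsetP; exists T => //; rewrite inE.
Qed.

Lemma trace_eq0 (F : facet) x : hull (val F) x -> peval (uh F) x = 0.
Proof.
have [_ /existsP[T /andP[TM FT]]] := andP (valP F).
move=> Fx; rewrite -(@trace_eq_primal (Sub T TM) F x)//.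
by rewrite primal_eq0 peval0.
Qed.

End TraceInjectivity.

(** * Conjugates and the latent gradient *)

Section Conjugate.
Context {R : realType}.
Implicit Types (g : R -> \bar R) (z w t : R).

(** A conjugate is a supremum of affine functions. The three finiteness assumptions are there
    because [fine] sends infinities to 0. *)
Lemma fconj_convex g z w t : 0 <= t <= 1 ->
  fconj g z \is a fin_num -> fconj g w \is a fin_num ->
  fconj g ((1 - t) * z + t * w) \is a fin_num ->
  fine (fconj g ((1 - t) * z + t * w)) <=
  (1 - t) * fine (fconj g z) + t * fine (fconj g w).
Proof.
move=> /andP[t0 t1] fz fw fu; rewrite -lee_fin fineK//.
apply: ge_ereal_sup => _ [y _ <-].
have hz : ((z * y)%:E - g y <= (fine (fconj g z))%:E)%E.
  by rewrite fineK//; apply: ereal_sup_ubound; exists y.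
have hw : ((w * y)%:E - g y <= (fine (fconj g w))%:E)%E.
  by rewrite fineK//; apply: ereal_sup_ubound; exists y.
move: hz hw; case: (g y) => [r| |] //=; last by rewrite !leNye.
rewrite -!EFinB !lee_fin => hz hw.
have h1 : (1 - t) * (z * y - r) <= (1 - t) * fine (fconj g z).
  by rewrite ler_wpM2l// subr_ge0.
have h2 : t * (w * y - r) <= t * fine (fconj g w) by rewrite ler_wpM2l.
rewrite (_ : _ - r = (1 - t) * (z * y - r) + t * (w * y - r)); last by ring.
exact: lerD.
Qed.

(** Convexity bounds the difference quotients towards [w], whose limit is the derivative at [z].
    Finiteness is given near [z] and at [w], so [small] selects increments at which the conjugate is
    finite. The sign of [w - z] decides how to divide by it. *)
Lemma fconj_tangent g z w : (\forall y \near z, fconj g y \is a fin_num) ->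
  fconj g w \is a fin_num -> derivable (fine \o fconj g) z 1 ->
  derive1 (fine \o fconj g) z * (w - z) <= fine (fconj g w) - fine (fconj g z).
Proof.
move=> nz fw df; set f := fine \o fconj g in df *.
have fz : fconj g z \is a fin_num by exact: nbhs_singleton nz.
have [->|wz] := eqVneq w z; first by rewrite !subrr mulr0.
pose q (h : R) := h^-1 *: (f (h *: (1 : R) + z) - f z).
have cq : q @ 0^' --> derive1 f z by rewrite derive1E; exact: df.
have small (P : R -> Prop) : (\forall h \near 0^', P h) ->
    exists t, [/\ 0 < t, t <= 1, P (t * (w - z)) & fconj g (t * (w - z) + z) \is a fin_num].
  rewrite near_withinE => nP.
  have nz0 : \forall h \near 0, fconj g (h + z) \is a fin_num.
    have : (fun h : R => h + z) @ 0 --> z.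
      by rewrite -[X in _ --> X]add0r; apply: cvgD; [exact: cvg_id|exact: cvg_cst].
    by move=> /(_ _ nz).
  have /nbhs_ballP[e /= e0 he] : nbhs (0 : R)
      [set h | (h != 0 -> P h) /\ fconj g (h + z) \is a fin_num].
    exact: filterI nP nz0.
  have d0 : 0 < `|w - z| by rewrite normr_gt0 subr_eq0.
  have t0 : 0 < Num.min 1 (e / 2 / `|w - z|) by rewrite lt_min ltr01 !divr_gt0.
  exists (Num.min 1 (e / 2 / `|w - z|)); rewrite ge_min lexx t0.
  have [|hP hf] := he (Num.min 1 (e / 2 / `|w - z|) * (w - z)).
    rewrite /ball/= sub0r normrN normrM gtr0_norm//.
    apply: (@le_lt_trans _ _ (e / 2)); last by rewrite ltr_pdivrMr// ltr_pMr// ltr1n.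
    by rewrite -ler_pdivlMr// ge_min lexx orbT.
  by split => //; apply: hP; rewrite mulf_neq0 ?subr_eq0// gt_eqF.
have quot t : 0 < t -> t <= 1 -> fconj g (t * (w - z) + z) \is a fin_num ->
    q (t * (w - z)) * (w - z) <= f w - f z.
  move=> t0 t1 fu; rewrite /q /GRing.scale/= mulr1.
  have uE : t * (w - z) + z = (1 - t) * z + t * w by ring.
  have h : f (t * (w - z) + z) <= (1 - t) * f z + t * f w.
    by rewrite /f /= uE fconj_convex// -?uE// ltW.
  have d0 : w - z != 0 by rewrite subr_eq0.
  have tn0 : t != 0 by rewrite gt_eqF.
  rewrite (_ : _^-1 * _ * (w - z) = (f (t * (w - z) + z) - f z) / t).
    by rewrite ler_pdivrMr//; lra.
  by field; rewrite tn0 d0.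
rewrite -[fine (fconj g w)]/(f w) -[fine (fconj g z)]/(f z) leNgt; apply/negP => lt.
have [wz0|wz0|/eqP] := ltgtP (w - z) 0; last by rewrite subr_eq0 (negbTE wz).
- have /small[t [t0 t1 qt fu]] : \forall h \near 0^', q h < (f w - f z) / (w - z).
    apply: (@cvgr_lt R R (0^') _ q _ cq).
    by rewrite ltr_ndivlMr.
  by have := quot t t0 t1 fu; rewrite leNgt -ltr_ndivlMr// qt.
- have /small[t [t0 t1 qt fu]] : \forall h \near 0^', (f w - f z) / (w - z) < q h.
    apply: (@cvgr_gt R R (0^') _ q _ cq).
    by rewrite ltr_pdivrMr.
  by have := quot t t0 t1 fu; rewrite leNgt -ltr_pdivrMr// qt.
Qed.

Lemma fconj_deriv_monotone g z w :
  (\forall y \near z, fconj g y \is a fin_num) -> derivable (fine \o fconj g) z 1 ->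
  (\forall y \near w, fconj g y \is a fin_num) -> derivable (fine \o fconj g) w 1 ->
  0 <= (derive1 (fine \o fconj g) z - derive1 (fine \o fconj g) w) * (z - w).
Proof.
move=> nz dz nw dw.
have h1 := fconj_tangent nz (nbhs_singleton nw) dz.
have h2 := fconj_tangent nw (nbhs_singleton nz) dw.
nra.
Qed.

End Conjugate.

Section LatentGradient.
Context {R : realType} {m : nat}.
Local Notation n := m.+1.
Local Notation E := 'rV[R]_n.
Local Notation leb := (lebesgue_rV R n).
Variables (Omega : set E) (phi : E -> R) (Rf : E -> R -> \bar R).
Hypothesis oOmega : open Omega.
Hypothesis bOmega : bounded_set Omega.
Hypothesis wb : gradRstar_well_behaved Omega phi Rf.
Implicit Types psi w : E -> R.

Let mOmega : measurable Omega. Proof. exact: open_measurable_rV. Qed.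

Let Omega_fin : (leb Omega < +oo)%E. Proof. exact: bounded_lebesgue_fin. Qed.

Lemma gradRstar_Lp2 psi : Lp Omega +oo%E psi -> Lp Omega 2%:E (gradRstar Rf psi).
Proof. by move=> /(let: And3 _ h _ := wb in h _) []. Qed.

Lemma gradRstar_integrable psi w : Lp Omega +oo%E psi -> ess_bounded leb Omega w ->
  leb.-integrable Omega (EFin \o (fun x => gradRstar Rf psi x * w x)).
Proof.
by move=> /gradRstar_Lp2 Lg bw; apply: Lp2_mul_integrable => //; exact: bounded_Lp2.
Qed.

Lemma gradRstar_inner_continuous psi w (e : R) : Lp Omega +oo%E psi ->
  ess_bounded leb Omega w -> 0 < e ->
  exists2 d : R, 0 < d & forall psi', Lp Omega +oo%E psi' ->
    (forall x, Omega x -> `|psi' x - psi x| <= d) ->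
    `|inner Omega (gradRstar Rf psi') w - inner Omega (gradRstar Rf psi) w| < e.
Proof.
move=> Lpsi bw e0; have Lw := bounded_Lp2 mOmega Omega_fin bw.
have Nfin : Lp_norm Omega 2%:E w \is a fin_num.
  rewrite ge0_fin_numE ?Lnorm_ge0//.
  by move: Lw; rewrite /Lp inE => /andP[_]; rewrite inE.
set N := fine (Lp_norm Omega 2%:E w); have N0 : 0 <= N by rewrite fine_ge0// Lnorm_ge0.
(* [N + 1] stays positive when [w] has norm 0. Below, halving [d] turns the weak pointwise bound
   into a strict bound on the norm. *)
have N1 : 0 < N + 1 by rewrite ltr_wpDl.
have [_ _ /(_ psi Lpsi (e / (N + 1)))[|d d0 hd]] := wb; first by rewrite divr_gt0.
exists (d / 2); first by rewrite divr_gt0.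
move=> psi' Lpsi' hpsi.
have : (Lp_norm Omega +oo (psi' \- psi)%R < d%:E)%E.
  apply: (@le_lt_trans _ _ (d / 2)%:E).
    by apply: Lp_norm_infty_le => //; rewrite divr_ge0// ltW.
  by rewrite lte_fin ltr_pdivrMr// ltr_pMr// ltr1n.
move=> /(hd _ Lpsi'); set h := _ \- _ => hlt.
have Lh : Lp Omega 2%:E h.
  rewrite /Lp /h (_ : (_ \- _) \_ Omega =
    (gradRstar Rf psi' \_ Omega) - (gradRstar Rf psi \_ Omega)).
    have L1 := gradRstar_Lp2 Lpsi'; have L2 := gradRstar_Lp2 Lpsi.
    by rewrite rpredB ?L1 ?L2 ?lee1n.
  by apply/funext => x; rewrite !fctE/= !patchE; case: ifP => // _; rewrite subr0.
have -> : inner Omega (gradRstar Rf psi') w - inner Omega (gradRstar Rf psi) w =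
    \int[leb]_(x in Omega) (h x * w x).
  rewrite /inner -RintegralB//; [|exact: gradRstar_integrable|exact: gradRstar_integrable].
  by apply: eq_Rintegral => x _; rewrite /h mulrBl.
rewrite -lte_fin; apply: le_lt_trans (Lp2_inner_le mOmega Lh Lw) _.
rewrite -(fineK Nfin) -/N.
have hfin : Lp_norm Omega 2%:E h \is a fin_num.
  by rewrite ge0_fin_numE ?Lnorm_ge0// (lt_trans hlt)// ltry.
move: hlt; rewrite -(fineK hfin) -EFinM !lte_fin ltr_pdivlMr// => hlt.
apply: le_lt_trans hlt; rewrite ler_wpM2l// ?lerDl//.
by rewrite fine_ge0// Lnorm_ge0.
Qed.

(** Almost everywhere the integrand is the product of the increments of a nondecreasing function,
    the derivative of a convex conjugate, and of its argument. *)
Lemma gradRstar_monotone psi psi' : Lp Omega +oo%E psi -> Lp Omega +oo%E psi' ->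
  0 <= inner Omega (fun x => gradRstar Rf psi x - gradRstar Rf psi' x) (psi \- psi').
Proof.
move=> Lpsi Lpsi'; have [h _ _] := wb.
apply: Rintegral_ae_ge0 => //.
  apply: measurable_funM; apply: measurable_funB;
    by [exact: Lp_measurable (gradRstar_Lp2 _)|exact: Lp_measurable Lpsi|
        exact: Lp_measurable Lpsi'].
apply: filterS2 (h _ Lpsi) (h _ Lpsi') => x h1 h2 Ox.
have [n1 d1] := h1 Ox; have [n2 d2] := h2 Ox.
exact: fconj_deriv_monotone.
Qed.

End LatentGradient.

(** * Solvability of one step *)

Section Definiteness.
Context {R : realType} {m : nat}.
Local Notation n := m.+1.
Local Notation E := 'rV[R]_n.
Local Notation poly := (mpoly.mpoly n R).
Local Notation leb := (lebesgue_rV R n).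
Variables (Omega : set E) (M : mesh R n).
Local Notation cell := (cell M).
Local Notation facet := (facet M).
Hypothesis oOmega : open Omega.
Hypothesis bOmega : bounded_set Omega.
Hypothesis conf : conforming_mesh M Omega.
Variables (kappa : E -> R) (beta : E -> E) (bn : cell -> facet -> E -> R).
Hypothesis kinv_bounded : ess_bounded leb Omega (fun x => (kappa x)^-1).
Hypothesis kappa_gt0 : {ae leb, forall x, Omega x -> 0 < kappa x}.
Hypothesis beta_bounded : vbounded Omega beta.
Hypothesis bn_trace : normal_trace Omega beta bn.
Hypothesis bn_continuous : continuous_normal_components bn.
Implicit Types (u v w : cell -> poly) (q r : cell -> 'I_n -> poly) (uh vh : facet -> poly).
Variable p : nat.

Local Notation a := (hdg_form Omega kappa beta bn).

Lemma Vh_lin k (c : R) v w : Vh k v -> Vh k w -> Vh k (fun T => c *: v T + w T).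
Proof. by move=> hv hw T; apply: deg_leD; [exact: deg_leZ|]. Qed.

Lemma Vh0 k : Vh k (fun _ : cell => 0).
Proof. by move=> T; exact: deg_le0. Qed.

Lemma Sigmah_lin (c : R) q r : Sigmah p q -> Sigmah p r ->
  Sigmah p (fun T i => c *: q T i + r T i).
Proof.
move=> hq hr T; have [a1 [b1 [a1p b1p E1]]] := hq T; have [a2 [b2 [a2p b2p E2]]] := hr T.
exists (fun i => c *: a1 i + a2 i), (c *: b1 + b2); split.
- by move=> i; apply: deg_leD; [exact: deg_leZ|].
- by apply: deg_leD; [exact: deg_leZ|].
- by move=> i x; rewrite !pevalD !pevalZ E1 E2; ring.
Qed.

Lemma Sigmah0 : Sigmah p (fun (_ : cell) _ => 0).
Proof.
move=> T; exists (fun=> 0), 0; split => [i||i x]; rewrite ?deg_le0//.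
by rewrite !peval0 mulr0 addr0.
Qed.

Lemma Mh0_lin (c : R) uh vh : Mh0 Omega p uh -> Mh0 Omega p vh ->
  Mh0 Omega p (fun F => c *: uh F + vh F).
Proof.
move=> [hu u0] [hv v0]; split=> [F|F Fb x Fx].
  by apply: deg_leD; [exact: deg_leZ|].
by rewrite pevalD pevalZ u0// v0// mulr0 addr0.
Qed.

Lemma Mh00 : Mh0 Omega p (fun _ : facet => 0).
Proof. by split=> [F|F _ x _]; [exact: deg_le0|exact: peval0]. Qed.

Let bn_bounded := normal_trace_bounded bn_trace.

Lemma hdg_form0l r v vh : a (fun _ _ => 0) (fun=> 0) (fun=> 0) r v vh = 0.
Proof.
have := @hdg_form_linl _ _ _ _ oOmega bOmega kappa beta bn kinv_bounded
  beta_bounded bn_bounded 1 (fun _ _ => 0) (fun _ _ => 0) (fun=> 0) (fun=> 0)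
  (fun=> 0) (fun=> 0) r v vh.
rewrite (_ : (fun (_ : cell) (_ : 'I_n) => _ *: _ + _) = fun _ _ => 0); last first.
  by apply/funext => T; apply/funext => i; rewrite scaler0 addr0.
rewrite (_ : (fun _ : cell => _ *: _ + _) = fun=> 0); last first.
  by apply/funext => T; rewrite scaler0 addr0.
rewrite (_ : (fun _ : facet => _ *: _ + _) = fun=> 0); last first.
  by apply/funext => T; rewrite scaler0 addr0.
by rewrite mul1r; lra.
Qed.

Lemma vec_of0 : vec_of (fun (_ : cell) (_ : 'I_n) => 0) = fun=> 0.
Proof. by apply/funext => x; apply/rowP => i; rewrite !mxE fun_of0. Qed.

Lemma gradh0 : gradh (fun _ : cell => 0) = fun _ _ => 0.
Proof. by apply/funext => T; apply/funext => i; rewrite /gradh mpoly.mderiv0. Qed.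

Lemma innerv0r (f : E -> E) : innerv Omega f (fun=> 0) = 0.
Proof.
rewrite /innerv; under eq_Rintegral do rewrite dotv0r.
by rewrite Rintegral_cst ?mul0r//; exact: open_measurable_rV.
Qed.

Lemma skeleton_int0 (g : cell -> facet -> E -> R) :
  (forall (T : cell) (F : facet) x, hull (val F) x -> g T F x = 0) -> skeleton_int g = 0.
Proof.
move=> g0; apply: big1 => T _; apply: big1 => F _; apply: facet_int0.
  exact: facet_card.
by move=> x Fx; exact: g0.
Qed.

Lemma formB0l v vh : Defs.formB Omega (fun (_ : cell) _ => 0) v vh = 0.
Proof.
rewrite /Defs.formB vec_of0 innervC innerv0r skeleton_int0 ?subr0// => T F x _.
rewrite (_ : \row__ _ = 0) ?dotv0l ?mulr0//.
by apply/rowP => i; rewrite !mxE peval0.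
Qed.

Lemma formB0r q : Defs.formB Omega q (fun _ : cell => 0) (fun _ : facet => 0) = 0.
Proof.
rewrite /Defs.formB gradh0 vec_of0 innerv0r skeleton_int0 ?subr0// => T F x _.
by rewrite !peval0 subrr mul0r.
Qed.

Lemma formAC0r u uh : formAC Omega beta bn u uh (fun=> 0) (fun=> 0) = 0.
Proof.
rewrite /formAC gradh0 vec_of0 innerv0r skeleton_int0 ?subr0 ?oppr0 ?addr0// => T F x _.
by rewrite !peval0 subrr mulr0.
Qed.

Lemma formAC0l v vh : formAC Omega beta bn (fun=> 0) (fun=> 0) v vh = 0.
Proof.
rewrite /formAC (_ : (fun x => _ *: _) = fun=> 0); last first.
  by apply/funext => x; rewrite fun_of0 scale0r.
rewrite innervC innerv0r skeleton_int0 ?subr0 ?oppr0 ?addr0// => T F x _.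
by rewrite !peval0; case: ifP => _; rewrite mulr0 mul0r.
Qed.

Lemma hdg_form_flux_test u uh r : a (fun _ _ => 0) u uh r (fun=> 0) (fun=> 0) =
  Defs.formB Omega r u uh.
Proof.
rewrite /hdg_form /formAD formAC0r formB0r vec_of0.
rewrite (_ : (fun x => _ *: _) = fun=> 0); last by apply/funext => x; rewrite scaler0.
by rewrite innervC innerv0r add0r subr0 addr0.
Qed.

Lemma hdg_form_flux_trial q v vh : a q (fun=> 0) (fun=> 0) (fun _ _ => 0) v vh =
  - Defs.formB Omega q v vh.
Proof.
by rewrite /hdg_form /formAD formAC0l formB0l vec_of0 innerv0r !add0r addr0.
Qed.

Lemma hdg_form_eql q u uh uh' r v vh :
  (forall (F : facet) x, hull (val F) x -> peval (uh F) x = peval (uh' F) x) ->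
  a q u uh r v vh = a q u uh' r v vh.
Proof.
move=> e; rewrite /hdg_form /formAD /formAC /Defs.formB; congr (_ + (_ - _) - _ + (_ + _)).
  by apply: eq_skeleton_int => T F x _ Fx; rewrite e.
by apply: eq_skeleton_int => T F x _ Fx; rewrite e.
Qed.

Lemma flux_eq0 q u uh : Mh0 Omega p uh -> a q u uh q u uh <= 0 -> q = fun _ _ => 0.
Proof.
move=> [_ uh0] le0.
have E := hdg_energy oOmega bOmega conf kappa beta_bounded bn_trace bn_continuous q u uh0.
have q0 : innerv Omega (fun x => (kappa x)^-1 *: vec_of q x) (vec_of q) = 0.
  apply/eqP; rewrite eq_le (le_trans E le0)/=.
  exact: flux_norm_ge0.
by apply/funext => T; apply/funext => i; apply: (flux_norm_eq0 oOmega bOmega conf _ kappa_gt0 q0).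
Qed.

(** Testing with the solution makes the energy nonpositive, hence [q = 0]; flux tests then give
    [B(r, (u, uh)) = 0], hence [u = 0] and [uh = 0] on the facets; the remainder is tested with
    [v = w], which is why [w] lies in [Vh p]. The sign condition covers two uses: for two solutions
    it is the monotonicity of [grad R*], in the elimination the product is 0. *)
Lemma hdg_mixed_injective (c : R) q u uh w : 0 < c ->
  Sigmah p q -> Vh p u -> Mh0 Omega p uh -> Vh p w ->
  (forall r v vh, Sigmah p r -> Vh p v -> Mh0 Omega p vh ->
    a q u uh r v vh + c * inner Omega (fun_of w) (fun_of v) = 0) ->
  0 <= inner Omega (fun_of w) (fun_of u) ->
  [/\ q = (fun _ _ => 0), u = (fun=> 0), w = (fun=> 0) &
      forall (F : facet) x, hull (val F) x -> peval (uh F) x = 0].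
Proof.
move=> c0 qp up uhp wp h wu.
have inner0 g : inner Omega g (fun_of (fun _ : cell => 0)) = 0.
  rewrite /inner; under eq_Rintegral do rewrite fun_of0 mulr0.
  by rewrite Rintegral_cst ?mul0r//; exact: open_measurable_rV.
have q0 : q = fun _ _ => 0.
  apply: (flux_eq0 uhp (u := u)).
  have := h q u uh qp up uhp; have := mulr_ge0 (ltW c0) wu; lra.
have B0 r : Sigmah p r -> Defs.formB Omega r u uh = 0.
  move=> rp; have := h r (fun=> 0) (fun=> 0) rp (Vh0 p) Mh00.
  by rewrite inner0 mulr0 addr0 q0 hdg_form_flux_test.
have u0 : u = fun=> 0.
  by apply/funext => T; exact: (primal_eq0 oOmega bOmega conf up uhp B0).
have uh0 := trace_eq0 oOmega bOmega conf up uhp B0.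
split=> //; apply/funext; apply: (inner_sqr_eq0 oOmega bOmega conf).
have := h (fun _ _ => 0) w (fun=> 0) Sigmah0 wp Mh00.
rewrite q0 u0 (hdg_form_eql _ _ (uh' := fun=> 0)); last first.
  by move=> F x Fx; rewrite uh0// peval0.
by rewrite hdg_form0l add0r => /eqP; rewrite mulf_eq0 gt_eqF//= => /eqP.
Qed.

(** The diagonal test again removes [r], and pure flux trials leave [B(q, (v, vh)) = 0], the
    situation already treated for the primal problem. The conclusion concerns [v], the component
    seen by the coupling and the load. *)
Lemma hdg_adjoint_injective r v vh : Sigmah p r -> Vh p v -> Mh0 Omega p vh ->
  (forall q u uh, Sigmah p q -> Vh p u -> Mh0 Omega p uh -> a q u uh r v vh = 0) ->
  v = fun=> 0.
Proof.
move=> rp vp vhp h.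
have r0 : r = fun _ _ => 0 by apply: (flux_eq0 vhp (u := v)); rewrite h.
apply/funext => T; apply: (primal_eq0 oOmega bOmega conf vp vhp) => q qp.
have := h q (fun=> 0) (fun=> 0) qp (Vh0 p) Mh00.
by rewrite r0 hdg_form_flux_trial => /eqP; rewrite oppr_eq0 => /eqP.
Qed.

End Definiteness.

Section LinearFunctionals.
Context {R : realType}.

Lemma linear_coords N (f : 'rV[R]_N -> R) :
  (forall (c : R) x y, f (c *: x + y) = c * f x + f y) ->
  forall x, f x = dotv (\row_i f (delta_mx ord0 i)) x.
Proof.
move=> fl x; have f0 : f 0 = 0 by have := fl 1 0 0; rewrite scaler0 addr0 mul1r; lra.
have fD y z : f (y + z) = f y + f z by have := fl 1 y z; rewrite scale1r mul1r.
have fZ c y : f (c *: y) = c * f y by have := fl c y 0; rewrite f0 !addr0.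
rewrite {1}(row_sum_delta x) (big_morph f fD f0) /dotv; apply: eq_bigr => i _.
by rewrite fZ mxE mulrC.
Qed.

Lemma bilinear_coords N k (f : 'rV[R]_N -> 'rV[R]_k -> R) :
  (forall (c : R) x x' y, f (c *: x + x') y = c * f x y + f x' y) ->
  (forall (c : R) x y y', f x (c *: y + y') = c * f x y + f x y') ->
  forall x y, f x y =
    dotv (x *m \matrix_(i, j) f (delta_mx ord0 i) (delta_mx ord0 j)) y.
Proof.
move=> fl fr x y.
rewrite (@linear_coords _ (f x) (fun c z z' => fr c x z z')); congr (dotv _ y).
apply/rowP => j; rewrite mxE.
rewrite (@linear_coords _ (fun z => f z (delta_mx ord0 j)) (fun c z z' => fl c z z' _)).
by rewrite mxE; apply: eq_bigr => i _; rewrite !mxE mulrC.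
Qed.

Lemma dotv_continuous_coords N k (G : 'rV[R]_N -> 'rV[R]_k) :
  (forall i x (e : R), 0 < e -> exists2 d : R, 0 < d &
    forall y, dotv (y - x) (y - x) < d -> `|G y ord0 i - G x ord0 i| < e) ->
  dotv_continuous G.
Proof.
move=> cG x e e0.
(* As [e' <= 1], each squared coordinate is at most [e'], and the sum of [k] of them is at most
   [k e' < (k + 1) e' <= e]. *)
pose e' := Num.min 1 (e / k.+1%:R).
have e'0 : 0 < e' by rewrite lt_min ltr01 divr_gt0.
have /choice[d hd] : forall i, exists d : R, 0 < d /\
    forall y, dotv (y - x) (y - x) < d -> `|G y ord0 i - G x ord0 i| < e'.
  by move=> i; have [d d0 hd] := cG i x e' e'0; exists d.
have s0 : 0 <= \sum_i (d i)^-1.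
  by apply: sumr_ge0 => i _; rewrite invr_ge0 ltW//; have [] := hd i.
(* A positive number below every [d i] that also makes sense for [k = 0]. *)
exists (1 + \sum_i (d i)^-1)^-1; first by rewrite invr_gt0 ltr_wpDr.
move=> y hy.
have hi i : `|G y ord0 i - G x ord0 i| < e'.
  have [di0] := hd i; apply; apply: lt_le_trans hy _.
  rewrite -[leRHS]invrK lef_pV2 ?posrE ?invr_gt0// ?ltr_wpDr//.
  by rewrite (bigD1 i)//= addrCA lerDl addr_ge0// sumr_ge0// => j _;
    rewrite invr_ge0 ltW//; have [] := hd j.
apply: (@le_lt_trans _ _ (k%:R * e')).
  rewrite mulr_natl -[k in leRHS]card_ord -sumr_const; apply: ler_sum => i _.
  rewrite !mxE -expr2 -real_normK ?num_real// expr2 -[leRHS]mul1r.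
  by rewrite ler_pM// ltW// (lt_le_trans (hi i))// ge_min lexx.
apply: (@lt_le_trans _ _ (k.+1%:R * e')); first by rewrite ltr_pM2r// ltr_nat.
by rewrite -ler_pdivlMl// mulrC ge_min lexx orbT.
Qed.

End LinearFunctionals.

(** * Coordinates on the discrete spaces *)

Section PolynomialCoordinates.
Context {R : realType} {m : nat}.
Local Notation n := m.+1.
Local Notation poly := (mpoly.mpoly n R).

(** [bmultinom] bounds the degree strictly, so [k.+1] gives the exponents of degree at most [k]. *)
Definition monomials (k : nat) := mpoly.bmultinom n k.+1.

Definition poly_of_coef k (c : monomials k -> R) : poly :=
  \sum_u c u *: mpoly.mpolyX R (mpoly.bmnm u).

Lemma deg_le_poly_of_coef k c : deg_le k (@poly_of_coef k c).
Proof.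
apply: deg_le_sum => u _; apply: deg_leZ; rewrite deg_leE mpoly.msizeX.
exact: mpoly.bmdeg.
Qed.

Lemma poly_of_coef_lin k (a : R) (c d : monomials k -> R) :
  poly_of_coef (fun u => a * c u + d u) = a *: poly_of_coef c + poly_of_coef d.
Proof.
rewrite /poly_of_coef scaler_sumr -big_split; apply: eq_bigr => u _ /=.
by rewrite scalerDl scalerA.
Qed.

Lemma poly_of_coefK k (P : poly) : deg_le k P ->
  poly_of_coef (fun u : monomials k => mpoly.mcoeff (mpoly.bmnm u) P) = P.
Proof. by rewrite deg_leE => Pk; rewrite [RHS](mpoly.mpolywE Pk). Qed.

Lemma mcoeff_poly_of_coef k (c : monomials k -> R) (u : monomials k) :
  mpoly.mcoeff (mpoly.bmnm u) (poly_of_coef c) = c u.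
Proof.
rewrite /poly_of_coef raddf_sum /= (bigD1 u)//= mpoly.mcoeffZ mpoly.mcoeffX eqxx mulr1.
rewrite big1 ?addr0// => v vu; rewrite mpoly.mcoeffZ mpoly.mcoeffX.
by rewrite (negbTE (_ : mpoly.bmnm v != mpoly.bmnm u)) ?mulr0// -mpoly.bmeqP.
Qed.

Lemma peval_inj (P Q : poly) : (forall x, peval P x = peval Q x) -> P = Q.
Proof.
move=> PQ; apply/eqP; rewrite -subr_eq0; apply/eqP.
apply: (peval_open_eq0 openT); first by exists 0.
by move=> x _; rewrite pevalB PQ subrr.
Qed.

End PolynomialCoordinates.

Section HDGCoordinates.
Context {R : realType} {m : nat}.
Local Notation n := m.+1.
Local Notation E := 'rV[R]_n.
Local Notation poly := (mpoly.mpoly n R).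
Variables (Omega : set E) (M : mesh R n) (p : nat).
Local Notation cell := (cell M).
Local Notation facet := (facet M).
Local Notation mono := (@monomials m p).

(** In order: coefficients of [a] and [b] in the flux [a + x b], of the primal polynomial, and of
    one polynomial per facet. The coordinates are redundant: low degree parts of [x b] can be moved
    into [a], and different polynomials may agree on a facet. *)
Definition hdg_index : finType :=
  ((cell * 'I_n * mono) + (cell * mono) + ((cell * mono) + (facet * mono)))%type.

Local Notation N := #|hdg_index|.
Implicit Types x y : 'rV[R]_N.

Definition hdg_coef x (i : hdg_index) : R := x ord0 (enum_rank i).

Definition hdg_flux x (T : cell) (i : 'I_n) : poly :=
  poly_of_coef (fun u => hdg_coef x (inl (inl (T, i, u)))) +
  mvar i * poly_of_coef (fun u => hdg_coef x (inl (inr (T, u)))).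

Definition hdg_primal x (T : cell) : poly :=
  poly_of_coef (fun u => hdg_coef x (inr (inl (T, u)))).

(** Setting boundary facets to zero makes every coordinate vector admissible, so the unknowns range
    over a full space of row vectors. *)
Definition hdg_trace x (F : facet) : poly :=
  if `[< hull (val F) `<=` boundary Omega >] then 0
  else poly_of_coef (fun u => hdg_coef x (inr (inr (F, u)))).

Lemma hdg_flux_Sigmah x : Sigmah p (hdg_flux x).
Proof.
move=> T.
exists (fun i => poly_of_coef (fun u => hdg_coef x (inl (inl (T, i, u))))),
  (poly_of_coef (fun u => hdg_coef x (inl (inr (T, u))))).
by split=> [i||i z]; rewrite ?deg_le_poly_of_coef// pevalD pevalM peval_var.
Qed.

Lemma hdg_primal_Vh x : Vh p (hdg_primal x).
Proof. by move=> T; exact: deg_le_poly_of_coef. Qed.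

Lemma hdg_trace_Mh0 x : Mh0 Omega p (hdg_trace x).
Proof.
split=> [F|F Fb z Fz]; rewrite /hdg_trace.
  by case: ifP => _; [exact: deg_le0|exact: deg_le_poly_of_coef].
by rewrite ifT ?peval0//; exact/asboolP.
Qed.

Lemma hdg_coef_lin c x y : hdg_coef (c *: x + y) = fun i => c * hdg_coef x i + hdg_coef y i.
Proof. by apply/funext => i; rewrite /hdg_coef !mxE. Qed.

Lemma hdg_flux_lin c x y :
  hdg_flux (c *: x + y) = fun T i => c *: hdg_flux x T i + hdg_flux y T i.
Proof.
apply/funext => T; apply/funext => i; rewrite /hdg_flux hdg_coef_lin !poly_of_coef_lin.
by rewrite scalerDr mulrDr scalerAr addrACA.
Qed.

Lemma hdg_primal_lin c x y :
  hdg_primal (c *: x + y) = fun T => c *: hdg_primal x T + hdg_primal y T.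
Proof. by apply/funext => T; rewrite /hdg_primal hdg_coef_lin poly_of_coef_lin. Qed.

Lemma hdg_trace_lin c x y :
  hdg_trace (c *: x + y) = fun F => c *: hdg_trace x F + hdg_trace y F.
Proof.
apply/funext => F; rewrite /hdg_trace hdg_coef_lin; case: ifP => _.
  by rewrite scaler0 addr0.
exact: poly_of_coef_lin.
Qed.

(** Surjectivity lets matrix identities be read as equations for all test functions. [Sigmah]
    provides the decomposition of the flux by values only, which determine a polynomial. *)
Lemma hdg_coords_onto r (v : cell -> poly) (vh : facet -> poly) :
  Sigmah p r -> Vh p v -> Mh0 Omega p vh ->
  exists x, [/\ hdg_flux x = r, hdg_primal x = v &
    forall (F : facet) z, hull (val F) z -> peval (hdg_trace x F) z = peval (vh F) z].
Proof.
move=> /choice[a /choice[b ab]] vp [vhp vh0].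
pose coef (i : hdg_index) : R := match i with
  | inl (inl (T, i, u)) => mpoly.mcoeff (mpoly.bmnm u) (a T i)
  | inl (inr (T, u)) => mpoly.mcoeff (mpoly.bmnm u) (b T)
  | inr (inl (T, u)) => mpoly.mcoeff (mpoly.bmnm u) (v T)
  | inr (inr (F, u)) => mpoly.mcoeff (mpoly.bmnm u) (vh F) end.
exists (\row_j coef (enum_val j)).
have coefE i : hdg_coef (\row_j coef (enum_val j)) i = coef i.
  by rewrite /hdg_coef mxE enum_rankK.
have {}coefE : hdg_coef (\row_j coef (enum_val j)) = coef by apply/funext.
split.
- apply/funext => T; apply/funext => i; have [aT bT rE] := ab T.
  rewrite /hdg_flux coefE /= !poly_of_coefK//; apply: peval_inj => z.
  by rewrite pevalD pevalM peval_var rE.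
- by apply/funext => T; rewrite /hdg_primal coefE /= poly_of_coefK.
- move=> F z Fz; rewrite /hdg_trace coefE; case: ifP => [/asboolP Fb|_] /=.
    by rewrite vh0// peval0.
  by rewrite poly_of_coefK.
Qed.

Definition latent_index : finType := (cell * mono)%type.

Definition latent_poly (y : 'rV[R]_#|latent_index|) (T : cell) : poly :=
  poly_of_coef (fun u => y ord0 (enum_rank ((T, u) : latent_index))).

Lemma latent_poly_Vh (y : 'rV[R]_#|latent_index|) : Vh p (latent_poly y).
Proof. by move=> T; exact: deg_le_poly_of_coef. Qed.

Lemma latent_poly_lin (c : R) (x y : 'rV[R]_#|latent_index|) :
  latent_poly (c *: x + y) = fun T => c *: latent_poly x T + latent_poly y T.
Proof.
apply/funext => T; rewrite /latent_poly -poly_of_coef_lin; congr poly_of_coef.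
by apply/funext => u; rewrite !mxE.
Qed.

(** In contrast to the other unknowns, the latent coordinates are faithful; the injectivity
    condition of the mixed system asks for a zero coordinate vector. *)
Lemma latent_poly_eq0 (y : 'rV[R]_#|latent_index|) : latent_poly y = (fun=> 0) -> y = 0.
Proof.
move=> y0; apply/rowP => j; rewrite mxE -[j]enum_valK.
case: (enum_val j) => T u; have := congr1 (mpoly.mcoeff (mpoly.bmnm u)) (congr1 (@^~ T) y0).
by rewrite /latent_poly mcoeff_poly_of_coef mpoly.mcoeff0.
Qed.

Lemma latent_poly_onto (w : cell -> poly) : Vh p w ->
  exists y : 'rV[R]_#|latent_index|, latent_poly y = w.
Proof.
move=> wp; pose coef (i : latent_index) := mpoly.mcoeff (mpoly.bmnm i.2) (w i.1).
exists (\row_j coef (enum_val j)); apply/funext => T.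
rewrite -[RHS](poly_of_coefK (wp T)); congr poly_of_coef.
by apply/funext => u; rewrite mxE enum_rankK.
Qed.

End HDGCoordinates.

Lemma scaled_dist_lt (R : realFieldType) (c u v e : R) : 0 < c ->
  `|u - v| < c * e -> `|c^-1 * u - c^-1 * v| < e.
Proof.
by move=> c0 h; rewrite -mulrBr normrM gtr0_norm ?invr_gt0// mulrC ltr_pdivrMr// mulrC.
Qed.

Section Step.
Context {R : realType} {m : nat}.
Local Notation n := m.+1.
Local Notation E := 'rV[R]_n.
Local Notation poly := (mpoly.mpoly n R).
Local Notation leb := (lebesgue_rV R n).
Variables (Omega : set E) (M : mesh R n).
Local Notation cell := (cell M).
Local Notation facet := (facet M).
Hypothesis oOmega : open Omega.
Hypothesis bOmega : bounded_set Omega.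
Hypothesis conf : conforming_mesh M Omega.
Variables (kappa : E -> R) (beta : E -> E) (bn : cell -> facet -> E -> R).
Hypothesis kinv_bounded : ess_bounded leb Omega (fun x => (kappa x)^-1).
Hypothesis kappa_gt0 : {ae leb, forall x, Omega x -> 0 < kappa x}.
Hypothesis beta_bounded : vbounded Omega beta.
Hypothesis bn_trace : normal_trace Omega beta bn.
Hypothesis bn_continuous : continuous_normal_components bn.
Variables (f phi : E -> R) (Rf : E -> R -> \bar R) (q p : nat).
Hypothesis Lf : Lp Omega 2%:E f.
Hypothesis wb : gradRstar_well_behaved Omega phi Rf.
Hypothesis qp : (q <= p)%N.
Variables (alpha : R) (prev : cell -> poly).
Hypothesis alpha_gt0 : 0 < alpha.

Local Notation a := (hdg_form Omega kappa beta bn).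
Local Notation solves := (step_solution Omega p q kappa beta bn f Rf alpha prev).

Let mOmega : measurable Omega. Proof. exact: open_measurable_rV. Qed.

Let Omega_fin : (leb Omega < +oo)%E. Proof. exact: bounded_lebesgue_fin. Qed.

Let bn_bounded := normal_trace_bounded bn_trace.

Let fun_of_bd (v : cell -> poly) : ess_bounded leb Omega (fun_of v).
Proof. exact: fun_of_ebd. Qed.

Lemma fun_of_Lp_infty (v : cell -> poly) : Lp Omega +oo%E (fun_of v).
Proof.
have [K _ hK] := fun_of_bounded bOmega v.
by apply: (bounded_Lp_infty mOmega _ hK); exact: fun_of_measurable.
Qed.

Lemma mul_fun_of_integrable g (v : cell -> poly) : Lp Omega 2%:E g ->
  leb.-integrable Omega (EFin \o (fun x => g x * fun_of v x)).
Proof. by move=> Lg; apply: Lp2_mul_integrable => //; exact: bounded_Lp2. Qed.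

Let Lfun_of (v : cell -> poly) : Lp Omega 2%:E (fun_of v).
Proof. exact: bounded_Lp2. Qed.

Let LgR (v : cell -> poly) : Lp Omega 2%:E (gradRstar Rf (fun_of v)).
Proof. by apply: (gradRstar_Lp2 wb); exact: fun_of_Lp_infty. Qed.

Lemma inner_fun_of_linr g (c : R) (v w : cell -> poly) : Lp Omega 2%:E g ->
  inner Omega g (fun_of (fun T => c *: v T + w T)) =
  c * inner Omega g (fun_of v) + inner Omega g (fun_of w).
Proof.
move=> Lg; rewrite !(innerC Omega g).
rewrite (_ : fun_of _ = fun x => c * fun_of v x + fun_of w x); last first.
  by apply/funext => x; exact: fun_of_lin.
rewrite inner_lin//.
- by under eq_fun do rewrite mulrC; exact: mul_fun_of_integrable.
- by under eq_fun do rewrite mulrC; exact: mul_fun_of_integrable.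
Qed.

Lemma innerBl g h (v : cell -> poly) : Lp Omega 2%:E g -> Lp Omega 2%:E h ->
  inner Omega (fun x => g x - h x) (fun_of v) =
  inner Omega g (fun_of v) - inner Omega h (fun_of v).
Proof.
move=> Lg Lh; rewrite /inner -RintegralB//; try exact: mul_fun_of_integrable.
by apply: eq_Rintegral => x _; rewrite mulrBl.
Qed.

Lemma gradRstar_fun_of_monotone (v w : cell -> poly) :
  0 <= inner Omega (fun x => gradRstar Rf (fun_of v) x - gradRstar Rf (fun_of w) x)
         (fun_of (fun T => v T - w T)).
Proof.
rewrite (_ : fun_of (fun T => _ - _) = fun_of v \- fun_of w).
  by apply: (gradRstar_monotone oOmega wb); exact: fun_of_Lp_infty.
by apply/funext => x; rewrite fun_ofB.
Qed.

Lemma step_unique (s s' : state M) : solves s -> solves s' -> same_state s' s.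
Proof.
move=> [[Sq Su Sh Sl] S1 S2] [[Sq' Su' Sh' Sl'] S1' S2'].
(* Differences are written [-1 *: s + s'] to fit linearity lemmas of the form [c *: x + y]. *)
pose dq (T : cell) i := -1 *: flux s T i + flux s' T i.
pose du (T : cell) := -1 *: primal s T + primal s' T.
pose dh (F : facet) := -1 *: trace s F + trace s' F.
pose dl (T : cell) := -1 *: latent s T + latent s' T.
have dlE g : Lp Omega 2%:E g -> inner Omega g (fun_of dl) =
    inner Omega g (fun_of (latent s')) - inner Omega g (fun_of (latent s)).
  by move=> Lg; rewrite inner_fun_of_linr// mulN1r addrC.
have dlp : Vh q dl by apply: Vh_lin.
have Vqp (v : cell -> poly) : Vh q v -> Vh p v.
  by move=> vq T; exact: deg_leW (vq T).
have [] := @hdg_mixed_injective _ _ _ _ oOmega bOmega conf _ _ _ kinv_bounded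
    kappa_gt0 beta_bounded bn_trace bn_continuous p alpha^-1 dq du dh dl.
- by rewrite invr_gt0.
- exact: Sigmah_lin.
- exact: Vh_lin.
- exact: Mh0_lin.
- exact: Vqp.
- move=> r v vh rp vp vhp.
  rewrite (hdg_form_linl oOmega bOmega kinv_bounded beta_bounded bn_bounded).
  have := S1 r v vh rp vp vhp; have := S1' r v vh rp vp vhp.
  rewrite -/(a _ _ _ _ _ _) -[in X in _ -> X]/(a _ _ _ _ _ _) /hdg_form.
  rewrite [inner Omega (fun_of dl) _]innerC dlE// !(innerC Omega (fun_of v)).
  rewrite !innerBl//; lra.
(* By the second equation tested with [dl], the pairing of [dl] with [du] equals its pairing with
   the increment of [grad R*], which is nonnegative. *)
- rewrite inner_fun_of_linr// mulN1r !(innerC Omega (fun_of dl)).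
  rewrite (subr0_eq (S2 _ dlp)) (subr0_eq (S2' _ dlp)).
  rewrite addrC -innerBl//.
  have -> : dl = fun T => latent s' T - latent s T.
    by apply/funext => T; rewrite /dl scaleN1r addrC.
  exact: gradRstar_fun_of_monotone.
have eqN (V : lmodType R) (x y : V) : -1 *: x + y = 0 -> y = x.
  by rewrite scaleN1r addrC => /eqP; rewrite subr_eq0 => /eqP.
move=> q0 u0 l0 h0; split.
- by apply/funext => T; apply/funext => i; apply: eqN; exact: (congr1 (fun g : cell -> 'I_n -> poly => g T i) q0).
- by apply/funext => T; apply: eqN; exact: (congr1 (fun g : cell -> poly => g T) u0).
- by apply/funext => T; apply: eqN; exact: (congr1 (fun g : cell -> poly => g T) l0).
- move=> F x Fx; have := h0 F x Fx; rewrite pevalD pevalZ mulN1r addrC => /eqP.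
  by rewrite subr_eq0 => /eqP.
Qed.

Local Notation N := #|hdg_index M p|.
Local Notation K := #|latent_index M q|.
Implicit Types (x y : 'rV[R]_N) (z w : 'rV[R]_K).

Let pa x y : R := a (hdg_flux x) (hdg_primal x) (hdg_trace Omega x)
  (hdg_flux y) (hdg_primal y) (hdg_trace Omega y).

Let pc z y : R := alpha^-1 * inner Omega (fun_of (latent_poly z)) (fun_of (hdg_primal y)).

Let pl y : R := inner Omega f (fun_of (hdg_primal y)) +
  alpha^-1 * inner Omega (fun_of prev) (fun_of (hdg_primal y)).

(** The second equation is scaled by [1/alpha], so that its linear part is the transpose of the
    coupling [pc] in the first. *)
Let pg z w : R := alpha^-1 *
  inner Omega (gradRstar Rf (fun_of (latent_poly z))) (fun_of (latent_poly w)).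

Let A : 'M[R]_N := \matrix_(i, j) pa (delta_mx ord0 i) (delta_mx ord0 j).
Let C : 'M[R]_(K, N) := \matrix_(i, j) pc (delta_mx ord0 i) (delta_mx ord0 j).
Let l : 'rV[R]_N := \row_i pl (delta_mx ord0 i).
Let G z : 'rV[R]_K := \row_i pg z (delta_mx ord0 i).

Let paE x y : pa x y = dotv (x *m A) y.
Proof.
apply: bilinear_coords => [c x1 x2 y1|c x1 y1 y2]; rewrite /pa.
  rewrite hdg_flux_lin hdg_primal_lin hdg_trace_lin.
  exact: (hdg_form_linl oOmega bOmega kinv_bounded beta_bounded bn_bounded).
rewrite hdg_flux_lin hdg_primal_lin hdg_trace_lin.
exact: (hdg_form_linr oOmega bOmega kinv_bounded beta_bounded bn_bounded).
Qed.

Let pcE z y : pc z y = dotv (z *m C) y.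
Proof.
apply: bilinear_coords => [c z1 z2 y1|c z1 y1 y2]; rewrite /pc.
  rewrite latent_poly_lin !(innerC Omega _ (fun_of (hdg_primal y1))).
  by rewrite inner_fun_of_linr// mulrDr mulrCA.
by rewrite hdg_primal_lin inner_fun_of_linr// mulrDr mulrCA.
Qed.

Let plE y : pl y = dotv l y.
Proof.
apply: linear_coords => c y1 y2; rewrite /pl hdg_primal_lin !inner_fun_of_linr//.
by rewrite mulrDr mulrCA addrACA -mulrDr.
Qed.

Let pgE z w : pg z w = dotv (G z) w.
Proof.
apply: linear_coords => c w1 w2; rewrite /pg latent_poly_lin inner_fun_of_linr//.
by rewrite mulrDr mulrCA.
Qed.

Let inner_fun_of0 g : inner Omega g (fun_of (fun _ : cell => 0)) = 0.
Proof.
rewrite /inner; under eq_Rintegral do rewrite fun_of0 mulr0.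
by rewrite Rintegral_cst// mul0r.
Qed.

Let pa_flux_le x : 0 <= pa x x.
Proof.
apply: le_trans (hdg_energy oOmega bOmega conf kappa beta_bounded bn_trace bn_continuous
  (hdg_flux x) (hdg_primal x) (hdg_trace_Mh0 Omega x).2).
exact: flux_norm_ge0.
Qed.

Let GE z i : G z ord0 i = pg z (delta_mx ord0 i).
Proof. by rewrite /G mxE. Qed.

Let pg_continuous (i : 'I_K) z e : 0 < e -> exists2 d : R, 0 < d &
  forall z', dotv (z' - z) (z' - z) < d ->
    `|pg z' (delta_mx ord0 i) - pg z (delta_mx ord0 i)| < e.
Proof.
move=> e0; pose wi : 'rV[R]_K := delta_mx ord0 i.
have ae0 : 0 < alpha * e by rewrite mulr_gt0.
have [d d0 hd] := gradRstar_inner_continuous oOmega bOmega wb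
  (fun_of_Lp_infty (latent_poly z)) (fun_of_bd (latent_poly wi)) ae0.
(* [B j] bounds the [j]-th basis function on [Omega]. If the coordinates of [z' - z] are at most [r]
   in absolute value, the two functions differ by at most [r] times the sum of the [B j], hence by
   at most [d]. *)
have /choice[B hB] : forall j : 'I_K, exists B : R, 0 <= B /\
    forall t : E, Omega t -> `|fun_of (latent_poly (delta_mx ord0 j : 'rV[R]_K)) t| <= B.
  move=> j; have [B B0 hB] := fun_of_bounded bOmega (latent_poly (delta_mx ord0 j : 'rV[R]_K)).
  by exists B.
have s0 : 0 <= \sum_j B j by apply: sumr_ge0 => j _; have [] := hB j.
have s1 : 0 < \sum_j B j + 1 by rewrite ltr_wpDl.
pose r := d / (\sum_j B j + 1); have r0 : 0 < r by rewrite divr_gt0.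
exists (r ^+ 2); first exact: exprn_gt0.
move=> z' hz.
rewrite /pg; apply: (scaled_dist_lt alpha_gt0).
apply: hd; first exact: fun_of_Lp_infty.
move=> x Ox; rewrite -fun_ofB.
have -> : (fun T => latent_poly z' T - latent_poly z T) = latent_poly (z' - z).
  by rewrite -scaleN1r addrC latent_poly_lin; apply/funext => T; rewrite scaleN1r addrC.
rewrite (@linear_coords _ _ (fun w => fun_of (latent_poly w) x)); last first.
  by move=> c w1 w2; rewrite latent_poly_lin fun_of_lin.
apply: (@le_trans _ _ (\sum_j B j * r)); last first.
  rewrite -mulr_suml /r mulrC mulrAC ler_pdivrMr// ler_wpM2l// ?ltW//.
  by rewrite ltrDl.
apply: le_trans (ler_norm_sum _ _ _) _; apply: ler_sum => j _.
rewrite normrM mxE ler_pM//; first by have [_] := hB j; apply.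
rewrite -(@ler_pXn2r _ 2) ?nnegrE ?normr_ge0 ?(ltW r0)// real_normK ?num_real//.
by apply: le_trans (ltW hz); exact: coord_dotv.
Qed.

Let pg_monotone z z' : 0 <= pg z (z - z') - pg z' (z - z').
Proof.
rewrite /pg -mulrBr -innerBl//; apply: mulr_ge0; first by rewrite invr_ge0 ltW.
have -> : latent_poly (z - z') = fun T => latent_poly z T - latent_poly z' T.
  by rewrite -scaleN1r addrC latent_poly_lin; apply/funext => T; rewrite scaleN1r addrC.
exact: gradRstar_fun_of_monotone.
Qed.

Let G_continuous : dotv_continuous G.
Proof.
apply: dotv_continuous_coords => i z e /(pg_continuous i z)[d d0 hd].
exists d => // z' hz.
have GE' : G z' ord0 i - G z ord0 i = pg z' (delta_mx ord0 i) - pg z (delta_mx ord0 i) :=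
  congr2 (fun s t => s - t) (GE z' i) (GE z i).
exact: etrans (congr1 (fun t => `|t| < e) GE') (hd z' hz).
Qed.

Lemma step_exists : exists s : state M, solves s.
Proof.
have Vqp (v : cell -> poly) : Vh q v -> Vh p v.
  by move=> vq T; exact: deg_leW (vq T).
(* The right kernel of [A] consists of the test vectors annihilated by all trial vectors, that is,
   of the solutions of the homogeneous adjoint problem. *)
have coker (y : 'cV[R]_N) : A *m y = 0 -> hdg_primal y^T = fun=> 0.
  move=> Ay; have ay x : pa x y^T = 0.
    by rewrite paE dotv_mx trmxK -mulmxA Ay mulmx0 mxE.
  apply: (@hdg_adjoint_injective _ _ _ _ oOmega bOmega conf _ _ _ kinv_bounded
    kappa_gt0 beta_bounded bn_trace bn_continuous p (hdg_flux y^T) _ (hdg_trace Omega y^T)).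
  - exact: hdg_flux_Sigmah.
  - exact: hdg_primal_Vh.
  - exact: hdg_trace_Mh0.
  - move=> r v vh rp vp vhp; have [x [rE vE vhE]] := hdg_coords_onto rp vp vhp.
    rewrite -[RHS](ay x) /pa rE vE; apply: hdg_form_eql => F t Ft.
    by rewrite vhE.
have [x [z [eq1 eq2]]] : exists x z, x *m A + z *m C = l /\ x *m C^T = G z.
  apply: mixed_system_solvable => //.
  - by move=> x; rewrite -paE.
  - move=> y /coker y0; split.
      apply/colP => i; rewrite [RHS]mxE.
      have := pcE (delta_mx ord0 i) y^T.
      by rewrite /pc y0 inner_fun_of0 mulr0 dotv_mx trmxK -mulmxA -rowE [RHS]mxE.
    apply/matrixP => i j; rewrite !ord1 [RHS]mxE -[y]trmxK -dotv_mx -plE /pl y0.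
    by rewrite !inner_fun_of0 mulr0 addr0.
  - move=> x z eq0 a0.
    have h0 y : pa x y + pc z y = 0 by rewrite paE pcE -dotvDl eq0 dotv0l.
    have [] := @hdg_mixed_injective _ _ _ _ oOmega bOmega conf _ _ _ kinv_bounded
      kappa_gt0 beta_bounded bn_trace bn_continuous p alpha^-1 (hdg_flux x)
      (hdg_primal x) (hdg_trace Omega x) (latent_poly z).
    + by rewrite invr_gt0.
    + exact: hdg_flux_Sigmah.
    + exact: hdg_primal_Vh.
    + exact: hdg_trace_Mh0.
    + by apply: Vqp; exact: latent_poly_Vh.
    + move=> r v vh rp vp vhp; have [y [rE vE vhE]] := hdg_coords_onto rp vp vhp.
      rewrite -[RHS](h0 y) /pa /pc rE vE; congr (_ + _).
      by apply: hdg_form_eqr => F t Ft; rewrite vhE.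
    (* With zero energy, testing with [x] itself leaves [pc z x = 0], so the sign condition holds
       with equality. *)
    + have := h0 x; rewrite paE a0 add0r /pc => /eqP.
      by rewrite mulf_eq0 invr_eq0 gt_eqF//= => /eqP ->.
    + by move=> _ _ /latent_poly_eq0.
  - move=> z z'; rewrite dotvBl.
    exact: (etrans (congr1 (fun t => 0 <= t) (congr2 (fun s t => s - t)
      (esym (pgE z (z - z'))) (esym (pgE z' (z - z')))))) (pg_monotone z z').
exists (State (hdg_flux x) (hdg_primal x) (hdg_trace Omega x) (latent_poly z)).
split => /=.
- split; [exact: hdg_flux_Sigmah|exact: hdg_primal_Vh|exact: hdg_trace_Mh0|exact: latent_poly_Vh].
- move=> r v vh rp vp vhp; have [y [rE vE vhE]] := hdg_coords_onto rp vp vhp.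
  have := congr1 (fun g => dotv g y) eq1; rewrite dotvDl -paE -pcE -plE.
  rewrite /pa /pc /pl rE vE.
  have -> := hdg_form_eqr Omega kappa beta bn (hdg_flux x) (hdg_primal x) (hdg_trace Omega x) r v vhE.
  rewrite /hdg_form innerBl//; lra.
- move=> w wq; have [w' wE] := latent_poly_onto wq.
  have := congr1 (fun g => dotv g w') eq2; rewrite dotv_mulmx trmxK dotvC -pcE -pgE.
  rewrite /pc /pg wE innerC => /mulfI h; apply/eqP; rewrite (subr_eq0 (inner _ _ _)); apply/eqP.
  by apply: h; rewrite invr_eq0 gt_eqF.
Qed.

End Step.

(** * The inverse coefficient and the sequence of steps *)

Lemma measurable_fun_inv d (T : measurableType d) (R : realType) (D : set T) (f : T -> R) :
  measurable_fun D f -> measurable_fun D (fun x => (f x)^-1).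
Proof.
(* Writing [1/f = f (f^2)^(-1)] reduces the inverse to a real power of a nonnegative function; at
   zeros of [f] both sides are 0. *)
move=> mf; rewrite (_ : (fun x => _) = f \* (fun x => (f x ^+ 2) `^ (-1))).
  apply: measurable_funM => //; apply: (measurableT_comp (measurable_powR _)).
  by rewrite (_ : (fun x => _) = f \* f)//; exact: measurable_funM.
apply/funext => x; rewrite /= powR_inv1 ?sqr_ge0//.
by have [->|fx0] := eqVneq (f x) 0; [rewrite invr0 mul0r|field].
Qed.

Lemma inv_ess_bounded (R : realType) n (D : set 'rV[R]_n) (kappa : 'rV[R]_n -> R) (k0 : R) :
  measurable D -> Lp D +oo%E kappa -> 0 < k0 ->
  {ae lebesgue_rV R n, forall x, D x -> k0 <= kappa x} ->
  ess_bounded (lebesgue_rV R n) D (fun x => (kappa x)^-1).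
Proof.
move=> mD Lk k00 hk; split.
  by apply: measurable_fun_inv; exact: Lp_measurable Lk.
exists k0^-1; apply: filterS hk => x hx /hx kx.
have kx0 : 0 < kappa x by exact: lt_le_trans kx.
by rewrite gtr0_norm ?invr_gt0// lef_pV2 ?posrE.
Qed.

Unset Implicit Arguments.

Theorem theorem4p2 (R : realType) (m : nat)
    (Omega : set 'rV[R]_m.+1) (M : mesh R m.+1) (sigma : R)
    (kappa : 'rV[R]_m.+1 -> R) (beta : 'rV[R]_m.+1 -> 'rV[R]_m.+1)
    (bn : cell M -> facet M -> 'rV[R]_m.+1 -> R)
    (f phi : 'rV[R]_m.+1 -> R) (Rf : 'rV[R]_m.+1 -> R -> \bar R)
    (q p : nat) (psi0 : cell M -> mpoly.mpoly m.+1 R) (alpha : nat -> R) :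
  bounded_lipschitz_domain Omega ->
  conforming_mesh M Omega ->
  shape_regular M sigma ->
  Lp Omega +oo%E kappa ->
  (exists2 kappa0 : R, 0 < kappa0 &
    {ae lebesgue_rV R m.+1, forall x, Omega x -> kappa0 <= kappa x}) ->
  (forall i, Lp Omega +oo%E (fun x => beta x ord0 i)) ->
  weakly_divergence_free Omega beta ->
  normal_trace Omega beta bn ->
  continuous_normal_components bn ->
  Lp Omega 2%:E f ->
  H1 Omega phi ->
  {within closure Omega, continuous phi} ->
  (forall x, boundary Omega x -> phi x <= 0) ->
  legendre_function Omega phi Rf ->
  gradRstar_well_behaved Omega phi Rf ->
  (q <= p)%N ->
  Vh q psi0 ->
  (forall k, (0 < k)%N -> 0 < alpha k) ->
  exists s : nat -> state M,
    latent (s 0%N) = psi0 /\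
    forall k, (0 < k)%N ->
      step_solution Omega p q kappa beta bn f Rf (alpha k)
        (latent (s k.-1)) (s k) /\
      forall s' : state M,
        step_solution Omega p q kappa beta bn f Rf (alpha k)
          (latent (s k.-1)) s' ->
        same_state s' (s k).
Proof.
move=> [_ oOmega _ bOmega _] conf _ Lkappa [kappa0 kappa00 kappa_ge] Lbeta _ bn_trace
  bn_cont Lf _ _ _ _ wb qp _ alpha_gt0.
have mOmega := open_measurable_rV oOmega.
have kinv := inv_ess_bounded mOmega Lkappa kappa00 kappa_ge.
have kappa_gt0 : {ae lebesgue_rV R m.+1, forall x, Omega x -> 0 < kappa x}.
  by apply: filterS kappa_ge => x h /h; exact: lt_le_trans.
have beta_bd : vbounded Omega beta by move=> i; exact: Lp_infty_ess_bounded.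
(* The step map takes the index and the previous latent variable as one argument, ready for a
   recursive definition of the sequence. The guard is there because the sign of [alpha 0] is
   unknown; at index 0 an arbitrary state is returned. *)
have /choice[S hS] : forall kpsi : nat * (cell M -> mpoly.mpoly m.+1 R),
    exists s : state M, (0 < kpsi.1)%N ->
      step_solution Omega p q kappa beta bn f Rf (alpha kpsi.1) kpsi.2 s.
  move=> [k psi]; have [k0|k0] := posnP k; last first.
    have [s hs] := step_exists oOmega bOmega conf kinv kappa_gt0 beta_bd bn_trace
      bn_cont Lf wb qp psi (alpha_gt0 k k0).
    by exists s.
  by exists (State (fun _ _ => 0) (fun=> 0) (fun=> 0) psi); rewrite k0.
(* The initial state is prescribed through its latent field [psi0]; zeros fill the other fields. *)
pose s := fix s k := if k is k'.+1 then S (k, latent (s k'))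
  else State (fun _ _ => 0) (fun=> 0) (fun=> 0) psi0.
exists s; split => // -[//|k] _; have hs : step_solution Omega p q kappa beta bn f Rf
  (alpha k.+1) (latent (s k)) (s k.+1) := hS (k.+1, latent (s k)) isT.
split => // s' hs'.
exact: (step_unique oOmega bOmega conf kinv kappa_gt0 beta_bd bn_trace bn_cont wb qp
  (alpha_gt0 k.+1 isT) hs hs').
Qed.
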